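(* Let $M$, $\mathcal{F}$, $x$, $LE_{\mathcal F}(x)$, the group of monomials $\mathcal{X}$ and the residue fields $LE_{\mathcal F}(x)w\subseteq LE_{\mathcal F}(x)$ be as fixed in the context. Take $h\in LE_{\mathcal F}(x)$ such that $vh<0$. Then there are convex valuations $w_1<w_2<\ldots<w_k=v$ on $LE_{\mathcal F}(x)$, $m_i\in\mathbb{N}$, monomials $d_{i,j}\in\mathcal{X}$ and elements $c_{i,j}\in LE_{\mathcal F}(x)w_i$, $1\le i\le k$, $1\le j\le m_i$, some $r_h\in\mathbb{R}$, and $h^{+}\in LE_{\mathcal F}(x)$ of value $vh^{+}>0$, such that $$h=c_{1,1}d_{1,1}+\ldots+c_{1,m_1}d_{1,m_1}+\ldots+c_{k,1}d_{k,1}+\ldots+c_{k,m_k}d_{k,m_k}+r_h+h^{+}$$ with: 1) the values of the summands under the valuation $v$ are strictly increasing; 2) for each $i$, $1\le i\le k$, $$w_ic_{i,1}d_{i,1}<\ldots<w_ic_{i,m_i}d_{i,m_i},$$ and the values $vd_{i,j}$, $1\le j\le m_i$, generate an archimedean ordered subgroup of $vLE_{\mathcal F}(x)$; 3) for each $i$, $1\le i\le k-1$, $$c_{i+1,1}d_{i+1,1}+\ldots+c_{i+1,m_{i+1}}d_{i+1,m_{i+1}}+\ldots+c_{k,1}d_{k,1}+\ldots+c_{k,m_k}d_{k,m_k}$$ lies in $LE_{\mathcal F}(x)w_i$. With these properties, the summands $c_{i,j}$, $d_{i,j}$ and the elements $r_h$ and $h^{+}$ are uniquely determined.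
   Context: $\mathcal{F}_{\mathrm{an}}$ is the family of restricted analytic functions, i.e. functions $\mathbb{R}^n\to\mathbb{R}$ given on $[-1,1]^n$ by a real power series converging on a neighbourhood of $[-1,1]^n$ and equal to $0$ outside $[-1,1]^n$; $T_{\mathrm{an}}(\exp)$ is the theory of $\mathbb{R}_{\mathrm{an},\exp}$, the ordered field of reals with all restricted analytic functions and the unrestricted exponential. $\mathcal{F}\subseteq\mathcal{F}_{\mathrm{an}}$ is a set of convergent power series representing restricted analytic functions, closed under partial derivatives and containing the restricted exponential and restricted logarithm. $M$ is a non-archimedean model of $T_{\mathrm{an}}(\exp)$ containing $(\mathbb{R},+,\cdot,<,\mathcal{F},\exp)$ as a substructure, and $x\in M$ is positive and infinitely large ($x>0$, $vx<0$). $LE_{\mathcal F}(x)$ is the closure in $M$ of $\mathbb{R}(x)$ under real closure, $\mathcal{F}$, $\exp$ and its inverse $\log$. Valuations: for a valuation $w$ on a field $K$, $wa$ is the value of $a$, $wK$ the value group, $\mathcal{O}_w$ the valuation ring, $Kw$ the residue field. A valuation on an ordered field is convex if its valuation ring is convex; $v$ denotes the natural valuation, i.e. the finest convex valuation. For convex valuations, $w<w'$ means that $w$ is a proper coarsening of $w'$, i.e. $\mathcal{O}_{w'}\subsetneq\mathcal{O}_w$. A cross-section of $(K,v)$ is an embedding $\iota:vK\to K^\times$ of groups with $v\iota(\alpha)=\alpha$ for all $\alpha\in vK$. A field of representatives for $Kw$ is a subfield $k\subseteq K$ on which $w$ is trivial such that for every $a\in\mathcal{O}_w$ there is $b\in k$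 with $w(a-b)>0$. For a subfield $F\subseteq M$, $F^{\mathrm{h}\mathcal F}$ is the smallest subfield of $M$ containing $F$ which is closed under the functions in $\mathcal{F}$ and henselian with respect to $v$; $F^{\mathrm{r}\mathcal F}$ is the smallest such subfield that is in addition real closed. Fixed choice of monomials: fix a subgroup $\mathcal{X}$ of the multiplicative group of positive elements of $LE_{\mathcal F}(x)$ which is the image of a cross-section of $(LE_{\mathcal F}(x),v)$, contains $x$ and all iterated logarithms $\log_m x$ ($m\in\mathbb{N}$), satisfies $LE_{\mathcal F}(x)=\mathbb{R}(\mathcal{X})^{\mathrm{r}\mathcal F}=\mathbb{R}(\mathcal{X})^{\mathrm{h}\mathcal F}$, and is such that for every convex valuation $w$ on $LE_{\mathcal F}(x)$, with $\mathcal{X}_w:=\{x'\in\mathcal{X}\mid wx'=0\}$, the field $\mathbb{R}(\mathcal{X}_w)^{\mathrm{r}\mathcal F}=\mathbb{R}(\mathcal{X}_w)^{\mathrm{h}\mathcal F}$ is a field of representatives for the residue field of $LE_{\mathcal F}(x)$ with respect to $w$ (such an $\mathcal{X}$ exists). The elements of $\mathcal{X}$ are called the monomials of $LE_{\mathcal F}(x)$, and the residue field $LE_{\mathcal F}(x)w$ is identified with the subfield $\mathbb{R}(\mathcal{X}_w)^{\mathrm{h}\mathcal F}$ of $LE_{\mathcal F}(x)$.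
   Formalization: Condition 2) is read with the chain ending below 0, i.e. w_i c_{i,j}d_{i,j} < 0 for all i, j (uniqueness fails otherwise); uniqueness is of the products c_{i,j}d_{i,j}, grouped in nonempty blocks, and of r_h and h^+, not of the separate factors c_{i,j} and d_{i,j}. *)

(* Defs.v *)
From HB Require Import structures.
From mathcomp Require Import all_boot all_order all_algebra.
From mathcomp Require Import all_classical all_reals all_analysis.

Set Implicit Arguments.
Unset Strict Implicit.
Unset Printing Implicit Defensive.

Import Order.TTheory GRing.Theory Num.Theory.
Import numFieldNormedType.Exports.

Local Open Scope classical_set_scope.
Local Open Scope ring_scope.

Definition power_series (R : realType) (n : nat) : Type := ('I_n -> nat) -> R.

Definition series_term (R : realType) n (p : power_series R n) (y : 'I_n -> R)
    (al : 'I_n -> nat) : R :=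
  p al * \prod_(i < n) y i ^+ al i.

(* Absolute convergence on a neighbourhood of [-1,1]^n.  The partial sums run
   over the boxes {0, ..., N-1}^n of multi-indices. *)
Definition converges_near_cube (R : realType) n (p : power_series R n) : Prop :=
  exists2 rho : R, 1 < rho &
    forall y : 'I_n -> R, (forall i, `|y i| < rho) ->
      cvg ((fun N : nat => \sum_(al : {ffun 'I_n -> 'I_N})
              `|series_term p y (fun i => al i : nat)|) @ \oo).

Definition series_sum (R : realType) n (p : power_series R n) (y : 'I_n -> R) : R :=
  lim ((fun N : nat => \sum_(al : {ffun 'I_n -> 'I_N})
          series_term p y (fun i => al i : nat)) @ \oo).

Definition restricted_fun (R : realType) n (p : power_series R n)
    (y : 'I_n -> R) : R :=
  if [forall i, `|y i| <= 1] then series_sum p y else 0.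

Definition series_deriv (R : realType) n (i : 'I_n) (p : power_series R n) :
    power_series R n :=
  fun al => p (fun j => al j + (j == i))%N *+ (al i).+1.

Record an_series (R : realType) (n : nat) : Type := AnSeries {
  an_coef :> power_series R n;
  an_converges : converges_near_cube an_coef }.

(* Variables are de Bruijn indices: [an_formula R n] is the type of formulas
   whose free variables are among n given ones. *)
Inductive an_term (R : realType) (n : nat) : Type :=
| TVar of 'I_n
| TZero
| TOne
| TOpp of an_term R n
| TAdd of an_term R n & an_term R n
| TMul of an_term R n & an_term R n
| TAn (m : nat) (f : an_series R m) (args : 'I_m -> an_term R n)
| TExp of an_term R n.

Inductive an_formula (R : realType) : nat -> Type :=
| FEq n of an_term R n & an_term R n : an_formula R n
| FLt n of an_term R n & an_term R n : an_formula R n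
| FNot n of an_formula R n : an_formula R n
| FAnd n of an_formula R n & an_formula R n : an_formula R n
| FAll n of an_formula R n.+1 : an_formula R n.

(* The interpretation on an ordered field of the symbols of the language other
   than those of ordered fields. *)
Record an_exp_structure (R : realType) (K : realFieldType) : Type :=
  AnExpStructure {
    an_fun : forall n, an_series R n -> ('I_n -> K) -> K;
    exp_fun : K -> K }.

Fixpoint eval_term (R : realType) (K : realFieldType)
    (S : an_exp_structure R K) n (e : 'I_n -> K) (t : an_term R n) : K :=
  match t with
  | TVar i => e i
  | TZero => 0
  | TOne => 1
  | TOpp t1 => - eval_term S e t1
  | TAdd t1 t2 => eval_term S e t1 + eval_term S e t2
  | TMul t1 t2 => eval_term S e t1 * eval_term S e t2
  | TAn _ f args => an_fun S f (fun i => eval_term S e (args i))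
  | TExp t1 => exp_fun S (eval_term S e t1)
  end.

Definition extend_env (T : Type) n (a : T) (e : 'I_n -> T) (i : 'I_n.+1) : T :=
  if unlift ord0 i is Some j then e j else a.

Fixpoint holds (R : realType) (K : realFieldType) (S : an_exp_structure R K)
    n (phi : an_formula R n) : ('I_n -> K) -> Prop :=
  match phi in an_formula _ n0 return ('I_n0 -> K) -> Prop with
  | FEq _ t1 t2 => fun e => eval_term S e t1 = eval_term S e t2
  | FLt _ t1 t2 => fun e => eval_term S e t1 < eval_term S e t2
  | FNot _ phi1 => fun e => ~ holds S phi1 e
  | FAnd _ phi1 phi2 => fun e => holds S phi1 e /\ holds S phi2 e
  | FAll _ phi1 => fun e => forall a, holds S phi1 (extend_env a e)
  end.

Definition no_var (T : Type) (i : 'I_0) : T := False_rect T (notF (valP i)).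

Definition real_an_exp (R : realType) : an_exp_structure R R :=
  AnExpStructure (fun n (f : an_series R n) => restricted_fun f) expR.

(* T_an(exp) is the complete theory of [real_an_exp R]. *)
Definition model_of_Tanexp (R : realType) (K : realFieldType)
    (S : an_exp_structure R K) : Prop :=
  forall phi : an_formula R 0,
    holds (real_an_exp R) phi (@no_var R) -> holds S phi (@no_var K).

(* The series of log(1 + t) does not converge on a neighbourhood of [-1,1], so
   the restricted logarithm is t |-> log(1 + rho t) for some 0 < rho < 1. *)
Record admissible_family (R : realType) (F : forall n, set (power_series R n)) :
    Prop := AdmissibleFamily {
  family_converges : forall n p, F n p -> converges_near_cube p;
  family_deriv : forall n (i : 'I_n) p, F n p -> F n (series_deriv i p);
  family_exp : exists2 p, F 1 p &
    forall y : 'I_1 -> R, `|y ord0| <= 1 -> series_sum p y = expR (y ord0);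
  family_log : exists2 p, F 1 p &
    exists2 rho : R, 0 < rho < 1 &
    forall y : 'I_1 -> R, `|y ord0| <= 1 ->
      series_sum p y = ln (1 + rho * y ord0) }.

(* [iota] embeds (R, +, *, <, F, exp) in the structure [S] on M. *)
Record embeds_reals (R : realType) (F : forall n, set (power_series R n))
    (M : realFieldType) (S : an_exp_structure R M) (iota : {rmorphism R -> M}) :
    Prop := EmbedsReals {
  embeds_lt : {mono iota : a b / a < b};
  embeds_family : forall n (f : an_series R n), F n f ->
    forall y : 'I_n -> R,
      iota (restricted_fun f y) = an_fun S f (fun i => iota (y i));
  embeds_exp : forall a : R, iota (expR a) = exp_fun S (iota a) }.

Definition is_subring (M : realFieldType) (A : set M) : Prop :=
  [/\ A 1, (forall a b, A a -> A b -> A (a - b)) &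
      (forall a b, A a -> A b -> A (a * b))].

Definition is_subfield (M : realFieldType) (A : set M) : Prop :=
  is_subring A /\ (forall a, A a -> A a^-1).

Definition generated_subfield (M : realFieldType) (A : set M) : set M :=
  [set y | forall K : set M, is_subfield K -> A `<=` K -> K y].

(* [Num.real_closed_axiom], relative to a subfield. *)
Definition is_real_closed (M : realFieldType) (K : set M) : Prop :=
  forall (p : {poly M}) (a b : M), (forall i, K p`_i) -> K a -> K b ->
    a <= b -> p.[a] <= 0 <= p.[b] ->
    exists2 z, K z & (a <= z <= b) && root p z.

(* A valuation w on a subfield K is given, up to equivalence, by its valuation
   ring O.  Then wK is the group of cosets a O^* (a in K nonzero), and
   wa <= wb iff b lies in a O; in particular 0 has the largest value. *)
Record is_valuation_ring (M : realFieldType) (K O : set M) : Prop :=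
  IsValuationRing {
    valuation_ring_sub : O `<=` K;
    valuation_ring_subring : is_subring O;
    valuation_ring_total : forall a, K a -> O a \/ O a^-1 }.

Definition is_convex_valuation (M : realFieldType) (K O : set M) : Prop :=
  is_valuation_ring K O /\
  (forall a b c, O a -> O c -> K b -> a <= b <= c -> O b).

Definition val_le (M : realFieldType) (O : set M) (a b : M) : Prop :=
  exists2 u, O u & b = a * u.

Definition val_lt (M : realFieldType) (O : set M) (a b : M) : Prop :=
  val_le O a b /\ ~ val_le O b a.

Definition val_eq (M : realFieldType) (O : set M) (a b : M) : Prop :=
  val_le O a b /\ val_le O b a.

(* The natural valuation ring of K, that is, the smallest convex one. *)
Definition natural_ring (M : realFieldType) (K : set M) : set M :=
  [set a | K a /\ forall O, is_convex_valuation K O -> O a].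

(* The valued field (K, O) satisfies Hensel's lemma. *)
Definition is_henselian (M : realFieldType) (K O : set M) : Prop :=
  forall (p : {poly M}) (a : M), (forall i, O p`_i) -> O a ->
    val_lt O 1 p.[a] -> val_eq O 1 p^`().[a] ->
    exists b, [/\ K b, root p b & val_lt O 1 (b - a)].

(* [s] represents the cross-section: it maps a nonzero a in K to the element of
   K^* that the cross-section assigns to the value of a. *)
Definition is_cross_section (M : realFieldType) (K O : set M) (s : M -> M) :
    Prop :=
  [/\ (forall a, K a -> a != 0 -> [/\ K (s a), s a != 0 & val_eq O (s a) a]),
      (forall a b, K a -> a != 0 -> K b -> b != 0 ->
         val_eq O a b -> s a = s b) &
      (forall a b, K a -> a != 0 -> K b -> b != 0 -> s (a * b) = s a * s b)].

Definition is_field_of_representatives (M : realFieldType) (K O k : set M) :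
    Prop :=
  [/\ is_subfield k, k `<=` K,
      (forall a, k a -> a != 0 -> val_eq O 1 a) &
      (forall a, O a -> exists2 b, k b & val_lt O 1 (a - b))].

(* The values of the [d j] generate an archimedean ordered subgroup of the value
   group; the elements of this subgroup are the values of products of integer
   powers of the [d j]. *)
Definition archimedean_values (M : realFieldType) (O : set M) m
    (d : 'I_m -> M) : Prop :=
  let mon (e : 'I_m -> int) := \prod_(j < m) d j ^ e j in
  forall e f : 'I_m -> int, val_lt O 1 (mon e) -> val_lt O 1 (mon f) ->
    exists n : nat, val_le O (mon f) (mon e ^+ n).

Section LogExp.
Variables (R : realType) (F : forall n, set (power_series R n)).
Variables (M : realFieldType) (S : an_exp_structure R M).
Variable iota : {rmorphism R -> M}.

Definition closed_under_family (K : set M) : Prop :=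
  forall n (f : an_series R n) (y : 'I_n -> M), F (f : power_series R n) ->
    (forall i, K (y i)) -> K (an_fun S f y).

Definition log_fun (a : M) : M := xget 0 [set b | exp_fun S b = a].

Definition LE (x : M) : set M :=
  [set y | forall K : set M, is_subfield K -> range iota `<=` K -> K x ->
     is_real_closed K -> closed_under_family K ->
     (forall a, K a -> K (exp_fun S a)) ->
     (forall a, K a -> 0 < a -> K (log_fun a)) -> K y].

Definition hF_closure (A : set M) : set M :=
  [set y | forall K : set M, is_subfield K -> A `<=` K ->
     closed_under_family K -> is_henselian K (natural_ring K) -> K y].

Definition rF_closure (A : set M) : set M :=
  [set y | forall K : set M, is_subfield K -> A `<=` K ->
     closed_under_family K -> is_henselian K (natural_ring K) ->
     is_real_closed K -> K y].

Definition real_adjoin (X : set M) : set M :=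
  generated_subfield (range iota `|` X).

(* X_w, where O is the valuation ring of w. *)
Definition trivial_monomials (X O : set M) : set M :=
  [set u | X u /\ val_eq O 1 u].

(* The residue field of w, as the field of representatives R(X_w)^hF. *)
Definition residue_field (X O : set M) : set M :=
  hF_closure (real_adjoin (trivial_monomials X O)).

Record is_monomial_group (x : M) (X : set M) : Prop := IsMonomialGroup {
  monomial_sub : X `<=` LE x;
  monomial_gt0 : forall u, X u -> 0 < u;
  monomial_one : X 1;
  monomial_div : forall u u', X u -> X u' -> X (u / u');
  monomial_section : exists2 s : M -> M,
    is_cross_section (LE x) (natural_ring (LE x)) s &
    X = s @` [set a | LE x a /\ a != 0];
  monomial_log : forall m : nat, X (iter m log_fun x);
  monomial_rF : LE x = rF_closure (real_adjoin X);
  monomial_hF : LE x = hF_closure (real_adjoin X);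
  monomial_residue : forall O, is_convex_valuation (LE x) O ->
    rF_closure (real_adjoin (trivial_monomials X O)) = residue_field X O /\
    is_field_of_representatives (LE x) O (residue_field X O) }.

(* There are k.+1 valuations w_1 < ... < w_(k.+1) = v, indexed from 0, and the
   number m i of summands of a block may be 0.

   The clause [decomp_w_neg] makes explicit that the chain of w_i-values in
   [decomp_w_lt] ends below 0, the elements of value >= 0 being left to the
   residue field of w_i, hence to the later blocks.  Uniqueness fails without
   it: for w_1 trivial and w_2 = v, the residue field of w_1 is LE x, so that
   x = (x + s) 1 - s is then a decomposition of x for every real s. *)
Record is_decomposition (x : M) (X : set M) (h : M)
    (k : nat) (w : 'I_k.+1 -> set M) (m : 'I_k.+1 -> nat)
    (c d : forall i, 'I_(m i) -> M) (r : R) (hp : M) : Prop :=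
  IsDecomposition {
  decomp_convex : forall i, is_convex_valuation (LE x) (w i);
  decomp_coarser : forall i i' : 'I_k.+1, (i < i')%N -> w i' `<` w i;
  decomp_last : w ord_max = natural_ring (LE x);
  decomp_d : forall i j, X (d i j);
  decomp_c : forall i j, residue_field X (w i) (c i j);
  decomp_hp : LE x hp /\ val_lt (natural_ring (LE x)) 1 hp;
  decomp_sum :
    h = \sum_(i < k.+1) \sum_(j < m i) c i j * d i j + iota r + hp;
  decomp_v_lt : forall i (j j' : 'I_(m i)), (j < j')%N ->
    val_lt (natural_ring (LE x)) (c i j * d i j) (c i j' * d i j');
  decomp_v_lt_blocks : forall i i' (j : 'I_(m i)) (j' : 'I_(m i')),
    (i < i')%N ->
    val_lt (natural_ring (LE x)) (c i j * d i j) (c i' j' * d i' j');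
  decomp_w_lt : forall i (j j' : 'I_(m i)), (j < j')%N ->
    val_lt (w i) (c i j * d i j) (c i j' * d i j');
  decomp_w_neg : forall i (j : 'I_(m i)), val_lt (w i) (c i j * d i j) 1;
  decomp_archimedean : forall i,
    archimedean_values (natural_ring (LE x)) (d i);
  decomp_rest : forall i : 'I_k.+1, (i < k)%N ->
    residue_field X (w i)
      (\sum_(i' < k.+1 | (i < i')%N) \sum_(j < m i') c i' j * d i' j) }.

(* The list of blocks of summands c_ij d_ij.  Empty blocks are dropped, since
   they can be inserted in a decomposition at will. *)
Definition summand_blocks (k : nat) (m : 'I_k.+1 -> nat)
    (c d : forall i, 'I_(m i) -> M) : seq (seq M) :=
  [seq b <- [seq [seq c i j * d i j | j <- enum 'I_(m i)] | i <- enum 'I_k.+1]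
  | b != [::]].

End LogExp.

(* Main.v *)
Require Import Defs.
From HB Require Import structures.
From mathcomp Require Import all_boot all_order all_algebra.
From mathcomp Require Import all_classical all_reals all_analysis.
From mathcomp Require Import ring lra zify.

Set Implicit Arguments.
Unset Strict Implicit.
Unset Printing Implicit Defensive.

Import Order.TTheory GRing.Theory Num.Theory.
Import numFieldNormedType.Exports.

Local Open Scope classical_set_scope.
Local Open Scope ring_scope.

(** For a group [Y] of monomials let [R(Y)^hF] be the field that it generates. An
    element is bounded by [Y] if some [n * y] dominates it; these elements form a
    convex ring, which defines a convex valuation.

    Existence. An element [h] involves finitely many monomials. As the group of
    monomials is divisible, these lie in a product of divisible archimedean groups
    [D_1], ..., [D_k], each of them infinitely large relative to the following
    ones ([chain_of_monomials]). Let [Y] be the product of the groups after [D_1].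
    In the valuation defined by [Y], the elements of [R(Y D_1)^hF] that are limits
    of finite sums of terms [c * d] with [c] in [R(Y)^hF] and [d] in [D_1] form a
    field, because the group [D_1] is archimedean and the geometric series
    converges. This field is closed under the functions of the family, by Taylor
    expansion around residues, whose partial derivatives lie in [R(Y)^hF]; and it
    is henselian, by Newton iteration from the root of the residue polynomial.
    Hence it is all of [R(Y D_1)^hF] ([approximableE]). Cutting an approximation
    of [h] off at value [0] leaves finitely many terms with [d] infinite, an
    element of [R(Y)^hF], and an infinitesimal ([product_group_expansion]). The
    terms are the first block, and induction on [k] treats the element of
    [R(Y)^hF] ([chain_expansion]).

    The Taylor expansion is the only place where analysis is used: over the reals
    it is a bound with a constant, for each order, proved term by term from the
    binomial formula ([restricted_fun_taylor]); such a bound is a sentence of the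
    theory, so it holds in the model ([an_fun_taylor]).

    Uniqueness. Of the valuations of the first nonempty blocks of two
    decompositions one is coarser. As the values of the monomials of a block
    generate an archimedean group, on which the coarser valuation is nontrivial,
    nothing in the other block is lost by passing to it ([block_terms_coarsen]).
    For the same valuation, the difference of the two leading terms is a monomial
    times an element of the residue field, hence is zero or of the same value as
    these terms; so the leading terms agree, and so on
    ([block_terms_unique]). *)

(** * Sums over boxes of multi-indices *)

Definition box_sum (R : realType) n (g : ('I_n -> nat) -> R) (L : nat) : R :=
  \sum_(al : {ffun 'I_n -> 'I_L}) g (fun i => al i : nat).

Definition box_summable (R : realType) n (g : ('I_n -> nat) -> R) : Prop :=
  exists B, forall L, box_sum (fun al => `|g al|) L <= B.

Definition shift_index n (i : 'I_n) (a : nat) (al : 'I_n -> nat) (j : 'I_n) :=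
  (al j + a * (j == i))%N.

Section BoxSums.
Variables (R : realType) (n : nat).
Implicit Types (g : ('I_n -> nat) -> R) (al : 'I_n -> nat).

Lemma box_sum_ge0 g L : (forall al, 0 <= g al) -> 0 <= box_sum g L.
Proof. by move=> g0; apply: sumr_ge0. Qed.

Lemma ler_box_sum g g' L : (forall al, g al <= g' al) ->
  box_sum g L <= box_sum g' L.
Proof. by move=> gg'; apply: ler_sum. Qed.

Lemma ler_norm_box_sum g L : `|box_sum g L| <= box_sum (fun al => `|g al|) L.
Proof. exact: ler_norm_sum. Qed.

Lemma box_sumD g g' L :
  box_sum (fun al => g al + g' al) L = box_sum g L + box_sum g' L.
Proof. exact: big_split. Qed.

Lemma box_sumZ k g L : box_sum (fun al => k * g al) L = k * box_sum g L.
Proof. by rewrite /box_sum mulr_sumr. Qed.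

Lemma box_sum_restrict g L L' : (L <= L')%N ->
  box_sum g L = box_sum (fun al => if [forall j, al j < L]%N then g al else 0) L'.
Proof.
move=> LL'; rewrite /box_sum -big_mkcond /=.
case: L LL' => [|L] LL'.
  have [n0|n0] := posnP n.
    move: g; rewrite {}n0 => g.
    pose z m := [ffun i : 'I_0 => False_rect 'I_m (notF (valP i))].
    have zE m (f : {ffun 'I_0 -> 'I_m}) : f = z m by apply/ffunP => -[].
    rewrite (big_pred1 (z 0)) => [|f]; last by rewrite (zE _ f) /= eqxx.
    rewrite (big_pred1 (z L')) => [|f]; first by congr g; apply/funext => -[].
    by rewrite (zE _ f) /= eqxx; apply/forallP => -[].
  rewrite big1 => [|f]; last by case: (f (Ordinal n0)).
  by rewrite big1 // => f /forallP/(_ (Ordinal n0)).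
case: L' LL' => // L' LL'.
rewrite [RHS](reindex_onto
  (fun al : {ffun 'I_n -> 'I_L.+1} => [ffun j => widen_ord LL' (al j)])
  (fun be : {ffun 'I_n -> 'I_L'.+1} => [ffun j => inord (be j)])) /=; last first.
  by move=> be /forallP bL; apply/ffunP => j; rewrite !ffunE; apply/val_inj;
     rewrite /= inordK.
apply: eq_big => [al|al _].
  apply/esym/andP; split; first by apply/forallP => j; rewrite ffunE /=.
  apply/eqP/ffunP => j; rewrite !ffunE /=; apply/val_inj; rewrite /= inordK //.
by congr g; apply/funext => j; rewrite ffunE.
Qed.

Lemma ler_box_sum_size g L L' : (forall al, 0 <= g al) -> (L <= L')%N ->
  box_sum g L <= box_sum g L'.
Proof.
move=> g0 LL'; rewrite (box_sum_restrict _ LL'); apply: ler_box_sum => al.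
by case: ifP.
Qed.

Lemma box_sum_shift g i a L :
  (forall al, (al i < a)%N -> g al = 0) ->
  box_sum g (L + a) =
  box_sum (fun al => if (al i < L)%N then g (shift_index i a al) else 0) (L + a).
Proof.
move=> g0; rewrite /box_sum -big_mkcond /=.
rewrite (bigID (fun al : {ffun 'I_n -> 'I_(L + a)} => (a <= al i)%N)) /=.
rewrite [X in _ + X]big1 ?addr0; last first.
  by move=> al; rewrite -ltnNge => al_lt; apply: g0.
have [m0|[m mE]] : (L + a = 0)%N \/ exists m, (L + a = m.+1)%N.
  by case: (L + a)%N => [|m]; [left|right; exists m].
  rewrite big1 => [|al _]; last by move: (ltn_ord (al i)) m0; lia.
  by rewrite big1 // => al _; move: (ltn_ord (al i)) m0; lia.
rewrite mE.
(* [inord] is [0] out of bounds, so a shifted index in the range of the shift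
   has stayed in the box. *)
have in_box (u : 'I_m.+1) : (a <= (inord (u + a) : 'I_m.+1))%N ->
    (u + a < m.+1)%N.
  case: (ltnP (u + a) m.+1) => [//|ge].
  have -> : (inord (u + a) : 'I_m.+1) = 0 :> nat.
    by rewrite /inord val_insubd ltnNge ge.
  by move: ge (ltn_ord u); lia.
rewrite (reindex_onto
  (fun al : {ffun 'I_n -> 'I_m.+1} =>
     [ffun j => inord (shift_index i a (fun j => al j : nat) j)])
  (fun be : {ffun 'I_n -> 'I_m.+1} =>
     [ffun j => inord (be j - a * (j == i))%N])) /=; last first.
  move=> be abe; apply/ffunP => j; rewrite !ffunE /=; apply/val_inj => /=.
  rewrite /shift_index !ffunE.
  rewrite !inordK; case: eqP => [->|_]; move: (ltn_ord (be i)) (ltn_ord (be j)); lia.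
have sub_box (al : {ffun 'I_n -> 'I_m.+1}) :
    let be := [ffun j => inord (shift_index i a (fun j => al j : nat) j)] :
      {ffun 'I_n -> 'I_m.+1} in
    (a <= be i)%N && ([ffun j => inord (be j - a * (j == i))%N] == al) ->
    (al i + a < m.+1)%N.
  by move=> be /andP[+ _]; rewrite /be ffunE /shift_index eqxx muln1 => /in_box.
apply: eq_big => [al|al].
  apply/idP/idP => [/sub_box|aL]; first by move: mE; lia.
  apply/andP; split.
    by rewrite ffunE /shift_index eqxx inordK; move: (ltn_ord (al i)); lia.
  apply/eqP/ffunP => j; rewrite !ffunE /=; apply/val_inj => /=.
  rewrite /shift_index.
  rewrite !inordK; case: eqP => [->|_];
    move: (ltn_ord (al i)) (ltn_ord (al j)); rewrite ?inordK; lia.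
move=> /sub_box lt; congr g; apply/funext => j; rewrite ffunE inordK //.
by rewrite /shift_index; case: eqP => [->|_]; rewrite ?muln0 ?addn0 ?muln1.
Qed.

Lemma box_summable_cvg g : box_summable g -> cvgn (box_sum g).
Proof.
move=> [B gB].
pose p al := Num.max (g al) 0; pose q al := Num.max (- g al) 0.
have cvg_part (f : ('I_n -> nat) -> R) : (forall al, 0 <= f al <= `|g al|) ->
    cvgn (box_sum f).
  move=> fg; apply: nondecreasing_is_cvgn.
    move=> L L' LL'; apply: ler_box_sum_size => // al.
    by case/andP: (fg al).
  exists B => _ [L _ <-]; apply: le_trans (gB L); apply: ler_box_sum => al.
  by case/andP: (fg al).
have -> : box_sum g = (fun L => box_sum p L - box_sum q L).
  apply/funext => L; rewrite -[- box_sum q L]mulN1r -box_sumZ -box_sumD.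
  congr box_sum; apply/funext => al; rewrite /p /q mulN1r.
  rewrite maxEle maxEle oppr_le0; case: (lerP (g al) 0); case: (lerP 0 (g al));
   rewrite ?oppr0 ?opprK ?addr0 ?add0r //; lra.
apply: is_cvgB; apply: cvg_part => al; rewrite /p /q le_max lexx orbT /=;
  rewrite ge_max normr_ge0 andbT ?ler_norm //.
by rewrite -normrN ler_norm.
Qed.

Lemma box_summableD g g' : box_summable g -> box_summable g' ->
  box_summable (fun al => g al + g' al).
Proof.
move=> [B gB] [B' gB']; exists (B + B') => L.
apply: le_trans (lerD (gB L) (gB' L)); rewrite -box_sumD.
by apply: ler_box_sum => al; apply: ler_normD.
Qed.

Lemma box_summableZ k g : box_summable g -> box_summable (fun al => k * g al).
Proof.
move=> [B gB]; exists (`|k| * B) => L.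
under [X in box_sum X]funext do rewrite normrM.
by rewrite box_sumZ ler_wpM2l.
Qed.

Lemma lim_box_sumD g g' : box_summable g -> box_summable g' ->
  limn (box_sum (fun al => g al + g' al)) = limn (box_sum g) + limn (box_sum g').
Proof.
move=> gs gs'; under [X in limn X]funext do rewrite box_sumD.
by apply: limD; apply: box_summable_cvg.
Qed.

Lemma lim_box_sumZ k g : box_summable g ->
  limn (box_sum (fun al => k * g al)) = k * limn (box_sum g).
Proof.
move=> gs; under [X in limn X]funext do rewrite box_sumZ.
apply: (@cvg_lim R^o) => //; apply: cvgMl_tmp.
exact: box_summable_cvg.
Qed.

Lemma ler_norm_lim_box_sum g B :
  (forall L, box_sum (fun al => `|g al|) L <= B) -> `|limn (box_sum g)| <= B.
Proof.
move=> gB; have gc : cvgn (box_sum g) by apply: box_summable_cvg; exists B.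
rewrite -lim_norm //; apply: limr_le; first exact: is_cvg_norm.
by near=> L; apply: le_trans (gB L); apply: ler_norm_box_sum.
Unshelve. all: by end_near. Qed.

Lemma box_sum_shift_bounds g i a L : (forall al, 0 <= g al) ->
  (forall al, (al i < a)%N -> g al = 0) ->
  box_sum (g \o shift_index i a) L <= box_sum g (L + a)
    <= box_sum (g \o shift_index i a) (L + a).
Proof.
move=> g0 ga; rewrite (box_sum_shift _ ga); apply/andP; split.
  rewrite (box_sum_restrict _ (leq_addr a L)); apply: ler_box_sum => al /=.
  by case: ifP => [/forallP/(_ i) ->//|_]; case: ifP.
by apply: ler_box_sum => al /=; case: ifP.
Qed.

(** Terms whose index is too small to be reached by the shift vanish, so both
    sums run over the same terms; only the boxes differ, which is harmless for
    absolutely convergent sums. *)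
Lemma box_summable_shift g i a : (forall al, (al i < a)%N -> g al = 0) ->
  box_summable (g \o shift_index i a) -> box_summable g.
Proof.
move=> ga [B gB]; exists B => L.
pose h al := `|g al|.
have h0 al : 0 <= h al by exact: normr_ge0.
have ha al : (al i < a)%N -> h al = 0 by rewrite /h => /ga ->; rewrite normr0.
apply: le_trans (gB (L + a)%N); have /andP[_] := box_sum_shift_bounds L h0 ha.
by apply: le_trans; apply: ler_box_sum_size => //; apply: leq_addr.
Qed.

Lemma lim_box_sum_shift g i a : (forall al, (al i < a)%N -> g al = 0) ->
  box_summable (g \o shift_index i a) ->
  limn (box_sum (g \o shift_index i a)) = limn (box_sum g).
Proof.
move=> ga gs; have g_s := box_summable_shift ga gs.
set k := g \o _ in gs *.
have k_abs : cvgn (box_sum (fun al => `|k al|)).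
  by apply: box_summable_cvg; case: gs => B gB; exists B => L;
     under [X in box_sum X]funext do rewrite normr_id.
have shiftE (u : nat -> R) : cvgn u -> limn (fun L => u (L + a)%N) = limn u.
  by move=> u_cvg; apply: (@cvg_lim R^o) => //; rewrite (cvg_shiftn a u).
have cvg_shift (u : nat -> R) : cvgn u -> cvgn (fun L => u (L + a)%N).
  by move=> u_cvg; apply/cvg_ex; exists (limn u); rewrite (cvg_shiftn a u).
have diff0 : (fun L => box_sum g (L + a) - box_sum k L) @ \oo --> (0 : R).
  pose e L := box_sum (fun al => `|k al|) (L + a) - box_sum (fun al => `|k al|) L.
  have e0 : e @ \oo --> (0 : R).
    rewrite -[X in _ --> X](subrr (limn (box_sum (fun al => `|k al|)))).
    apply: cvgB => //; rewrite -(shiftE _ k_abs); exact: cvg_shift.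
  apply: norm_cvg0; apply: (squeeze_cvgr _ (cvg_cst (0 : R)) e0).
  near=> L; rewrite normr_ge0 /= (box_sum_shift _ ga).
  rewrite (box_sum_restrict k (leq_addr a L)) /e.
  rewrite (box_sum_restrict (fun al => `|k al|) (leq_addr a L)).
  rewrite -[- box_sum _ _]mulN1r -box_sumZ -box_sumD.
  rewrite -[- box_sum _ _]mulN1r -box_sumZ -box_sumD.
  apply: le_trans (ler_norm_box_sum _ _) _; apply: ler_box_sum => al.
  rewrite !mulN1r; have [/forallP aL|_] := boolP [forall j, (al j < L)%N].
    by rewrite aL !subrr normr0.
  by rewrite oppr0 !addr0; case: ifP; rewrite ?normr0.
apply/eqP; rewrite eq_sym -subr_eq0 -(shiftE _ (box_summable_cvg g_s)).
rewrite -limB; last 2 first.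
- exact/cvg_shift/box_summable_cvg.
- exact: box_summable_cvg.
by apply/eqP; apply: (@cvg_lim R^o).
Unshelve. all: by end_near. Qed.
End BoxSums.

(** * Taylor polynomials of restricted analytic functions *)

(** Pascal's rule gives the recursion [r N.+1 m.+1 = c * r N.+1 m + u * r N m]
    for these remainders, whence the bound by Pascal's rule again. *)
Lemma ler_binomial_remainder (R : realDomainType) (c u : R) (m N : nat) :
  `|c| <= 1 -> `|c + u| <= 1 ->
  `|(c + u) ^+ m - \sum_(a < N) u ^+ a * c ^+ (m - a) *+ 'C(m, a)|
    <= `|u| ^+ N *+ 'C(m, N).
Proof.
move=> c1 cu1; pose T N m := \sum_(a < N) u ^+ a * c ^+ (m - a) *+ 'C(m, a).
rewrite -/(T N m).
have TS k l : T k.+1 l.+1 = c * T k.+1 l + u * T k l.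
  rewrite /T; elim: k => [|k IHk].
    by rewrite !big_ord_recr !big_ord0 /= !bin0 !subn0 exprS; ring.
  rewrite big_ord_recr IHk /= [in RHS]big_ord_recr /=.
  rewrite [X in _ = _ + u * X]big_ord_recr /= binS subSS.
  rewrite mulrnDr.
  have -> : u ^+ k.+1 * c ^+ (l - k) *+ 'C(l, k.+1) =
      c * (u ^+ k.+1 * c ^+ (l - k.+1) *+ 'C(l, k.+1)).
    have [lk|kl] := leqP l k; first by rewrite bin_small // !mulr0n mulr0.
    have -> : (l - k = (l - k.+1).+1)%N by lia.
    by rewrite [RHS]mulrnAr [c ^+ _.+1]exprS [in LHS]mulrCA.
  move: (T k.+1 l) (T k l) => t1 t2.
  rewrite [u ^+ k.+1]exprS; move: (u ^+ k) (c ^+ (l - k)) (c ^+ (l - k.+1)).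
  by move: 'C(l, k.+1) 'C(l, k) => i j x y z; ring.
elim: m N => [|m IHm] [|N].
- by rewrite /T big_ord0 subr0 !expr0 bin0 normr1.
- rewrite /T big_ord_recl big1 => [|a _]; last by rewrite bin_small.
  by rewrite /= !expr0 mulr1 addr0 subrr normr0 bin_small.
- by rewrite /T big_ord0 subr0 expr0 bin0 normrX exprn_ile1.
rewrite TS; set r := _ - _.
have -> : r = c * ((c + u) ^+ m - T N.+1 m) + u * ((c + u) ^+ m - T N m).
  by rewrite /r exprS; ring.
rewrite binS mulrnDr; apply: le_trans (ler_normD _ _) _; rewrite !normrM.
apply: lerD; first by apply: le_trans (IHm _); rewrite ler_piMl.
by rewrite exprS -mulrnAr ler_wpM2l.
Qed.

Definition set_coord (T : Type) n (i : 'I_n) (c : T) (y : 'I_n -> T) (j : 'I_n) : T :=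
  if j == i then c else y j.

Section RealTaylor.
Variables (R : realType) (n : nat).
Implicit Types (p : power_series R n) (i : 'I_n) (y : 'I_n -> R).

Lemma iter_series_deriv p i a al :
  iter a (series_deriv i) p al =
  p (shift_index i a al) *+ (al i + a) ^_ a.
Proof.
elim: a al => [|a IHa] al.
  by rewrite ffactn0 mulr1n /=; congr p; apply/funext => j; rewrite /shift_index addn0.
rewrite iterS {1}/series_deriv IHa -mulrnA eqxx.
have -> : shift_index i a (fun j => al j + (j == i))%N = shift_index i a.+1 al.
  by apply/funext => j; rewrite /shift_index mulSn addnA.
by congr (_ *+ _); rewrite ffactnSr addn1 addSnnS; congr (_ * _)%N; lia.
Qed.

Lemma box_summable_term p y : converges_near_cube p ->
  (forall i, `|y i| <= 1) -> box_summable (series_term p y).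
Proof.
move=> [rho rho1 p_cvg] y1.
have c : cvgn (box_sum (fun al => `|series_term p y al|)).
  by apply: p_cvg => i; apply: le_lt_trans (y1 i) rho1.
exists (limn (box_sum (fun al => `|series_term p y al|))) => L.
apply: nondecreasing_cvgn_le => // L1 L2 L12.
by apply: ler_box_sum_size.
Qed.

Lemma restricted_funE p y : (forall i, `|y i| <= 1) ->
  restricted_fun p y = limn (box_sum (series_term p y)).
Proof. by rewrite /restricted_fun => y1; case: forallP => // -[]. Qed.

(** Term by term, the partial derivatives of the series at the base point are
    the summands of the binomial expansion of the terms, up to a shift of the
    indices. *)
Lemma restricted_fun_taylor p i N :
  (forall a, converges_near_cube (iter a (series_deriv i) p)) ->
  exists C : nat, forall y (c : R), (forall j, `|y j| <= 1) -> `|c| <= 1 ->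
    `|restricted_fun p y *+ N`! - \sum_(a < N)
        ((y i - c) ^+ a *
          restricted_fun (iter a (series_deriv i) p) (set_coord i c y)) *+
        (N ^_ (N - a))| <= C%:R * `|y i - c| ^+ N.
Proof.
move=> pd.
have [B pB] : box_summable (series_term (iter N (series_deriv i) p) (fun=> 1)).
  by apply: box_summable_term => // j; rewrite normr1.
have B0 : 0 <= B by apply: le_trans (pB 0%N); apply: box_sum_ge0.
exists (Num.truncn B).+1 => y c y1 c1.
set z := set_coord i c y; set u := y i - c.
have z1 j : `|z j| <= 1 by rewrite /z /set_coord; case: eqP.
pose others (be : 'I_n -> nat) := \prod_(j < n | j != i) y j ^+ be j.
pose G a (be : 'I_n -> nat) : R :=
  p be * (c ^+ (be i - a) * others be) *+ be i ^_ a.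
have G0 a be : (be i < a)%N -> G a be = 0 by move=> ?; rewrite /G ffact_small.
have Gshift a : G a \o shift_index i a =
    series_term (iter a (series_deriv i) p) z.
  apply/funext => al; rewrite /= /G /series_term iter_series_deriv.
  have -> : shift_index i a al i = (al i + a)%N by rewrite /shift_index eqxx muln1.
  rewrite addnK mulrnAl; congr (_ * _ *+ _).
  rewrite (bigD1 i) //= /z /set_coord eqxx; congr (_ * _).
  apply: eq_bigr => j ji; rewrite /shift_index !(negbTE ji).
  by rewrite muln0 addn0.
have Gs : forall b, box_summable (G b \o shift_index i b).
  move=> b.
  rewrite Gshift; exact: (box_summable_term (pd b) z1).
have Gs' : forall b, box_summable (G b).
  by move=> b; exact: (@box_summable_shift _ _ _ i b (G0 b) (Gs b)).
have limG a : restricted_fun (iter a (series_deriv i) p) z = limn (box_sum (G a)).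
  by rewrite restricted_funE // -Gshift; apply: lim_box_sum_shift => // al; apply: G0.
have ps : box_summable (series_term p y) by apply: box_summable_term (pd 0%N) y1.
pose Q k (be : 'I_n -> nat) := series_term p y be *+ N`! -
   \sum_(a < k) (u ^+ a * G a be) *+ (N ^_ (N - a)).
have [limQ Qs] : limn (box_sum (Q N)) = restricted_fun p y *+ N`! - \sum_(a < N)
    (u ^+ a * restricted_fun (iter a (series_deriv i) p) z) *+ (N ^_ (N - a)) /\
    box_summable (Q N).
  have : forall k, limn (box_sum (Q k)) = restricted_fun p y *+ N`! - \sum_(a < k)
    (u ^+ a * restricted_fun (iter a (series_deriv i) p) z) *+ (N ^_ (N - a)) /\
    box_summable (Q k); last by [].
  elim=> [|k [IHk IHs]].
    have QE : Q 0%N = fun be => N`!%:R * series_term p y be.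
      by apply/funext => be; rewrite /Q big_ord0 subr0 mulr_natl.
    rewrite QE big_ord0 subr0 lim_box_sumZ // -restricted_funE // mulr_natl.
    by split=> //; apply: box_summableZ.
  have QE : Q k.+1 = fun be => Q k be + - (u ^+ k *+ (N ^_ (N - k))) * G k be.
    apply/funext => be; rewrite /Q big_ord_recr /= opprD addrA; congr (_ + _).
    by rewrite mulNr mulrnAl.
  rewrite QE big_ord_recr /= opprD addrA -IHk lim_box_sumD //; last exact: box_summableZ.
  rewrite lim_box_sumZ // -limG mulNr mulrnAl; split=> //.
  by apply: box_summableD => //; apply: box_summableZ.
rewrite -limQ; apply: ler_norm_lim_box_sum => L.
pose W (be : 'I_n -> nat) := `|p be| *+ be i ^_ N.
have QW be : `|Q N be| <= `|u| ^+ N * W be.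
  have o1 : `|others be| <= 1.
    rewrite normr_prod; apply: prodr_ile1 => j _ //.
    by rewrite normr_ge0 normrX exprn_ile1.
  have -> : Q N be = p be * others be * ((c + u) ^+ be i -
      \sum_(a < N) u ^+ a * c ^+ (be i - a) *+ 'C(be i, a)) *+ N`!.
    rewrite /Q /series_term (bigD1 i) //= -/(others be) /u subrKC.
    rewrite mulrBr mulrnBl; congr (_ - _); first by congr (_ *+ _); ring.
    rewrite mulr_sumr -sumrMnl; apply: eq_bigr => a _.
    rewrite /G -[in LHS](bin_ffact (be i) a).
    rewrite -[in RHS](ffact_fact (leq_subr a N)) subKn ?(ltnW (ltn_ord a)) //.
    rewrite !mulrnA; move: (c ^+ _) 'C(_, _) (a`!) (N ^_ _) (u ^+ _) => e1 e2 e3 e4 e5.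
    by ring.
  rewrite normrMn normrM normrM /W.
  have h : `|p be| * `|others be| * `|(c + u) ^+ be i -
      \sum_(a < N) u ^+ a * c ^+ (be i - a) *+ 'C(be i, a)| <=
      `|p be| * (`|u| ^+ N *+ 'C(be i, N)).
    rewrite -mulrA ler_wpM2l // -[leRHS]mul1r ler_pM //.
    by apply: ler_binomial_remainder => //; rewrite /u subrKC.
  apply: le_trans (ler_wMn2r N`! h) _.
  rewrite -(bin_ffact (be i) N) mulrnA.
  move: (`|u| ^+ N) 'C(_, _) N`! => e1 e2 e3.
  by rewrite le_eqVlt; apply/orP; left; apply/eqP; ring.
apply: le_trans (ler_box_sum _ QW) _; rewrite box_sumZ mulrC ler_wpM2r ?exprn_ge0 //.
have Wshift : W \o shift_index i N =
    fun al => `|series_term (iter N (series_deriv i) p) (fun=> 1) al|.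
  apply/funext => al /=; rewrite /series_term iter_series_deriv big1 => [|j _].
    by rewrite mulr1 normrMn /W {2}/shift_index eqxx muln1.
  by rewrite expr1n.
apply: le_trans (_ : B <= _); last by apply/ltW; apply: truncnS_gt.
apply: le_trans (pB (L + N)%N); rewrite -Wshift.
have W0 al : 0 <= W al by rewrite /W mulrn_wge0.
have /andP[_] : box_sum (W \o shift_index i N) L <= box_sum W (L + N)
    <= box_sum (W \o shift_index i N) (L + N).
  by apply: box_sum_shift_bounds => // al ?; rewrite /W ffact_small.
by apply: le_trans; apply: ler_box_sum_size => //; apply: leq_addr.
Qed.
End RealTaylor.

(** * Transfer to models of the theory *)

Lemma extend_env0 (T : Type) n (a : T) (e : 'I_n -> T) : extend_env a e ord0 = a.
Proof. by rewrite /extend_env unlift_none. Qed.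

Lemma extend_envS (T : Type) n (a : T) (e : 'I_n -> T) j :
  extend_env a e (lift ord0 j) = e j.
Proof. by rewrite /extend_env liftK. Qed.

Lemma extend_env_eta (T : Type) n (e : 'I_n.+1 -> T) :
  e = extend_env (e ord0) (e \o lift ord0).
Proof. by apply/funext => j; rewrite /extend_env; case: unliftP => [j' ->|->]. Qed.

Section Formulas.
Variable R : realType.

Fixpoint universal_closure (n : nat) : an_formula R n -> an_formula R 0 :=
  match n with
  | 0 => id
  | n'.+1 => fun phi => universal_closure (FAll phi)
  end.

Fixpoint term_nat n (k : nat) : an_term R n :=
  if k is k'.+1 then TAdd (TOne R n) (term_nat n k') else TZero R n.

Fixpoint term_pow n (t : an_term R n) (k : nat) : an_term R n :=
  if k is k'.+1 then TMul t (term_pow t k') else TOne R n.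

Definition term_sum n (T : eqType) (s : seq T) (t : T -> an_term R n) :=
  foldr (fun k acc => TAdd (t k) acc) (TZero R n) s.

Definition FImp n (phi psi : an_formula R n) := FNot (FAnd phi (FNot psi)).

Definition FLe n (s t : an_term R n) := FNot (FLt t s).

Definition FBigAnd n (T : Type) (s : seq T) (phi : T -> an_formula R n) :=
  foldr (fun k acc => FAnd (phi k) acc) (FEq (TZero R n) (TZero R n)) s.

Variables (K : realFieldType) (S : an_exp_structure R K).

Lemma holds_universal_closure n (phi : an_formula R n) :
  holds S (universal_closure phi) (@no_var K) <-> forall e, holds S phi e.
Proof.
elim: n phi => [|n IHn] phi /=.
  by split=> [phi0 e|//]; rewrite (_ : e = @no_var K) //; apply/funext => -[].
rewrite IHn /=; split=> [phi_all e|phi_all e a //].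
by rewrite [e]extend_env_eta.
Qed.

Lemma eval_term_nat n (e : 'I_n -> K) k : eval_term S e (term_nat n k) = k%:R.
Proof. by elim: k => //= k ->; rewrite -natr1 addrC. Qed.

Lemma eval_term_pow n (e : 'I_n -> K) t k :
  eval_term S e (term_pow t k) = eval_term S e t ^+ k.
Proof. by elim: k => //= k ->; rewrite exprS. Qed.

Lemma eval_term_sum n (e : 'I_n -> K) (T : eqType) (s : seq T) t :
  eval_term S e (term_sum s t) = \sum_(k <- s) eval_term S e (t k).
Proof. by elim: s => [|k s IHs] /=; rewrite ?big_nil // big_cons -IHs. Qed.

Lemma holds_FAnd n (phi psi : an_formula R n) e :
  holds S (FAnd phi psi) e <-> holds S phi e /\ holds S psi e.
Proof. by []. Qed.

Lemma holds_FImp n (phi psi : an_formula R n) e :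
  holds S (FImp phi psi) e <-> (holds S phi e -> holds S psi e).
Proof. by rewrite /FImp /=; split=> [h p|h [p]]; [apply: contrapT => np; apply: h|apply; exact: h]. Qed.

Lemma holds_FLe n (s t : an_term R n) e :
  holds S (FLe s t) e <-> eval_term S e s <= eval_term S e t.
Proof. by rewrite /FLe /= leNgt; split => /negP. Qed.

Lemma holds_FBigAnd n (T : eqType) (s : seq T) (phi : T -> an_formula R n) e :
  holds S (FBigAnd s phi) e <-> (forall k, k \in s -> holds S (phi k) e).
Proof.
elim: s => [|k s IHs] /=; first by split.
rewrite IHs; split=> [[hk hs] l|h].
  by rewrite inE => /predU1P[->|/hs].
by split=> [|l ls]; apply: h; rewrite inE ?eqxx // ls orbT.
Qed.
End Formulas.

Section Transfer.
Variables (R : realType) (M : realFieldType) (S : an_exp_structure R M).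
Hypothesis M_model : model_of_Tanexp S.

(** Formulas with free variables are transferred through their universal
    closures. *)
Lemma transfer_forall n (phi : an_formula R n) :
  (forall e, holds (real_an_exp R) phi e) -> forall e, holds S phi e.
Proof.
by move=> h; apply/holds_universal_closure/M_model/holds_universal_closure.
Qed.

Definition abs_le_one n (t : an_term R n) : an_formula R n :=
  FAnd (FLe t (TOne R n)) (FLe (TOpp (TOne R n)) t).

Lemma holds_abs_le_one (K : realFieldType) (S' : an_exp_structure R K) n
    (t : an_term R n) e :
  holds S' (abs_le_one t) e <-> `|eval_term S' e t| <= 1.
Proof.
rewrite ler_norml; split=> [[/holds_FLe h1 /holds_FLe h2]|/andP[h1 h2]].
  by rewrite h1 h2.
by split; apply/holds_FLe.
Qed.

Lemma an_fun_eq0 n (f : an_series R n) (y : 'I_n -> M) (i : 'I_n) :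
  1 < `|y i| -> an_fun S f y = 0.
Proof.
pose phi := FImp (FNot (abs_le_one (TVar R i)))
  (FEq (TAn f (fun j => TVar R j)) (TZero R n)).
suff /holds_FImp h : holds S phi y.
  move=> yi; apply: h => yi1.
  by have := (holds_abs_le_one S (TVar R i) y).1 yi1; rewrite /= leNgt yi.
apply: transfer_forall => e; apply/holds_FImp => /= ei.
rewrite /restricted_fun; case: forallP => // /(_ i) ei1.
move: ei1; rewrite ler_norml !leNgt => /andP[/negP ei1 /negP ei2].
by exfalso; apply: ei.
Qed.

Definition taylor_formula n (i : 'I_n) (f : an_series R n)
    (g : nat -> an_series R n) (N C : nat) : an_formula R n.+1 :=
  let y (j : 'I_n) := TVar R (lift ord0 j) in
  let c := TVar R (ord0 : 'I_n.+1) in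
  let u := TAdd (y i) (TOpp c) in
  let t := TAdd (TMul (term_nat R n.+1 N`!) (TAn f y)) (TOpp (term_sum (iota 0 N)
    (fun a => TMul (term_nat R n.+1 (N ^_ (N - a)))
      (TMul (term_pow u a) (TAn (g a) (set_coord i c y)))))) in
  FImp (FAnd (abs_le_one c) (FBigAnd (enum 'I_n) (fun j => abs_le_one (y j))))
    (FLe (TMul t t) (term_pow (TMul (term_nat R n.+1 C) (term_pow u N)) 2)).

Lemma holds_taylor_formula (K : realFieldType) (S' : an_exp_structure R K) n
    (i : 'I_n) (f : an_series R n) (g : nat -> an_series R n) (N C : nat)
    (c : K) (y : 'I_n -> K) :
  holds S' (taylor_formula i f g N C) (extend_env c y) <->
  (`|c| <= 1 -> (forall j, `|y j| <= 1) ->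
   `|an_fun S' f y *+ N`! - \sum_(a < N)
       ((y i - c) ^+ a * an_fun S' (g a) (set_coord i c y)) *+ (N ^_ (N - a))|
     <= C%:R * `|y i - c| ^+ N).
Proof.
have e0 := extend_env0 c y; have eS := extend_envS c y.
rewrite holds_FImp; set P := holds S' _ _.
have -> : P <-> (`|c| <= 1 /\ forall j, `|y j| <= 1).
  rewrite /P holds_FAnd holds_FBigAnd holds_abs_le_one [eval_term _ _ _]/= e0.
  split=> -[c1 ys]; split=> // j.
    have := ys j; rewrite holds_abs_le_one [eval_term _ _ _]/= eS.
    by apply; exact: mem_enum.
  by rewrite holds_abs_le_one [eval_term _ _ _]/= eS.
rewrite holds_FLe /=.
rewrite eval_term_sum !eval_term_nat eval_term_pow /= e0 eS mulr1.
have -> : (fun j => extend_env c y (lift ord0 j)) = y by apply/funext.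
set t := _ - \sum_(_ <- _) _; set t' := _ - \sum_(_ < _) _.
have -> : t = t'.
  rewrite /t /t' mulr_natl; congr (_ - _).
  rewrite -[N in iota 0 N]subn0 -/(index_iota 0 N) big_mkord.
  apply: eq_bigr => a _; rewrite eval_term_nat eval_term_pow mulr_natl /= e0 eS.
  congr (_ * an_fun _ _ _ *+ _); apply/funext => j.
  by rewrite /set_coord; case: (j == i); rewrite /= ?e0 ?eS.
have -> : (t' * t' <= C%:R * (y i - c) ^+ N * (C%:R * (y i - c) ^+ N)) =
    (`|t'| <= C%:R * `|y i - c| ^+ N).
  rewrite -!expr2 -(real_normK (num_real t')) -[X in _ <= X]real_normK ?num_real //.
  rewrite normrM normr_nat normrX.
  by rewrite ler_sqr // nnegrE ?mulr_ge0 ?exprn_ge0.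
by split=> [h c1 y1|h [c1 y1]]; apply: h.
Qed.

Lemma an_fun_taylor n (i : 'I_n) (f : an_series R n) (g : nat -> an_series R n)
    (N : nat) :
  (forall a, an_coef (g a) = iter a (series_deriv i) f) ->
  exists C : nat, forall (y : 'I_n -> M) (c : M),
    (forall j, `|y j| <= 1) -> `|c| <= 1 ->
   `|an_fun S f y *+ N`! - \sum_(a < N)
       ((y i - c) ^+ a * an_fun S (g a) (set_coord i c y)) *+ (N ^_ (N - a))|
     <= C%:R * `|y i - c| ^+ N.
Proof.
move=> gE; have [|C fC] := @restricted_fun_taylor R n f i N.
  by move=> a; rewrite -gE; apply: an_converges.
exists C => y c y1 c1.
suff /holds_taylor_formula h : holds S (taylor_formula i f g N C) (extend_env c y).
  exact: h.
apply: transfer_forall => e.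
rewrite [e]extend_env_eta.
apply/holds_taylor_formula => c1' y1' /=.
by under eq_bigr do rewrite gE; apply: fC.
Qed.
End Transfer.

(** * Convex subrings of an ordered field *)

Section ConvexRings.
Variable M : realFieldType.
Implicit Types (B K O Y : set M) (a b c : M).

Record convex_ring B : Prop := ConvexRing {
  convex_ring1 : B 1;
  convex_ringB : forall a b, B a -> B b -> B (a - b);
  convex_ringM : forall a b, B a -> B b -> B (a * b);
  convex_ring_le : forall a b, B b -> `|a| <= `|b| -> B a }.

(** The maximal ideal of [B], that is, the elements of positive value. *)
Definition infinitesimal B a : Prop := a != 0 -> ~ B a^-1.

Section Theory.
Variable B : set M.
Hypothesis cB : convex_ring B.

Lemma cring0 : B 0.
Proof. by apply: (convex_ring_le cB (convex_ring1 cB)); rewrite normr0. Qed.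

Lemma cringN a : B a -> B (- a).
Proof. by move=> Ba; rewrite -[- a]sub0r; apply: (convex_ringB cB) => //; apply: cring0. Qed.

Lemma cringD a b : B a -> B b -> B (a + b).
Proof. by move=> Ba Bb; rewrite -[b]opprK; apply: (convex_ringB cB) => //; apply: cringN. Qed.

Lemma cringX a n : B a -> B (a ^+ n).
Proof.
move=> Ba; elim: n => [|n IHn]; first by rewrite expr0; apply: convex_ring1.
by rewrite exprS; apply: (convex_ringM cB).
Qed.

Lemma cring_nat n : B n%:R.
Proof.
elim: n => [|n IHn]; first exact: cring0.
by rewrite -natr1; apply: cringD => //; apply: convex_ring1.
Qed.

Lemma cring_sum (I : Type) (r : seq I) (P : pred I) (f : I -> M) :
  (forall i, P i -> B (f i)) -> B (\sum_(i <- r | P i) f i).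
Proof. by move=> fB; elim/big_rec: _ => [|i a Pi Ba]; [exact: cring0|apply: cringD; [exact: fB|]]. Qed.

Lemma cring_total a : B a \/ B a^-1.
Proof.
have [a1|/ltW a1] := lerP `|a| 1.
  by left; apply: (convex_ring_le cB (convex_ring1 cB)); rewrite normr1.
right; apply: (convex_ring_le cB (convex_ring1 cB)); rewrite normr1 normfV.
by rewrite invf_le1 //; apply: lt_le_trans a1.
Qed.

Lemma cringPn a : ~ infinitesimal B a -> a != 0 /\ B a^-1.
Proof. by rewrite /infinitesimal => /not_implyP[a0 /contrapT]. Qed.

Lemma infinitesimal0 : infinitesimal B 0.
Proof. by rewrite /infinitesimal eqxx. Qed.

Lemma infinitesimal_cring a : infinitesimal B a -> B a.
Proof.
have [->|a0] := eqVneq a 0; first by move=> _; exact: cring0.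
by move=> /(_ a0) na; case: (cring_total a).
Qed.

Lemma infinitesimal_inv_eq0 a : infinitesimal B a -> B a^-1 -> a = 0.
Proof. by have [//|a0] := eqVneq a 0; move=> /(_ a0). Qed.

Lemma infinitesimal1 : ~ infinitesimal B 1.
Proof. by move=> /(_ (oner_neq0 _)); rewrite invr1; apply; exact: convex_ring1. Qed.

(** The product with [b] cannot be a unit of [B], since [a] would be one. *)
Lemma infinitesimalMr a b : infinitesimal B a -> B b -> infinitesimal B (a * b).
Proof.
move=> na Bb; rewrite /infinitesimal mulf_eq0 negb_or => /andP[a0 b0] h.
apply: (na a0); have -> : a^-1 = b * (a * b)^-1 by rewrite invfM mulrCA divff ?mulr1.
exact: (convex_ringM cB).
Qed.

Lemma infinitesimalMl a b : B a -> infinitesimal B b -> infinitesimal B (a * b).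
Proof. by rewrite mulrC => Ba nb; apply: infinitesimalMr. Qed.

Lemma infinitesimal_le a b : infinitesimal B b -> `|a| <= `|b| -> infinitesimal B a.
Proof.
move=> nb ab; have [->|a0] := eqVneq a 0; first exact: infinitesimal0.
have b0 : b != 0 by rewrite -normr_gt0; apply: lt_le_trans ab; rewrite normr_gt0.
rewrite -(divfK b0 a); apply: infinitesimalMl => //.
apply: (convex_ring_le cB (convex_ring1 cB)).
by rewrite normr1 normf_div ler_pdivrMr ?normr_gt0 // mul1r.
Qed.

Lemma infinitesimalD a b : infinitesimal B a -> infinitesimal B b -> infinitesimal B (a + b).
Proof.
wlog ab : a b / `|b| <= `|a|.
  move=> wl na nb; have [ab|/ltW ab] := lerP `|b| `|a|; first exact: wl.
  by rewrite addrC; apply: wl.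
move=> na nb; apply: (@infinitesimal_le _ (a * 2%:R)).
  by apply: infinitesimalMr => //; apply: cring_nat.
by rewrite normrM normr_nat mulr_natr mulr2n; apply: le_trans (ler_normD _ _) _; rewrite lerD2l.
Qed.

Lemma infinitesimalN a : infinitesimal B a -> infinitesimal B (- a).
Proof. by move=> na; apply: (infinitesimal_le na); rewrite normrN. Qed.

Lemma infinitesimalB a b : infinitesimal B a -> infinitesimal B b -> infinitesimal B (a - b).
Proof. by move=> na nb; apply: infinitesimalD => //; apply: infinitesimalN. Qed.

Lemma infinitesimal_sum (I : Type) (r : seq I) (P : pred I) (f : I -> M) :
  (forall i, P i -> infinitesimal B (f i)) -> infinitesimal B (\sum_(i <- r | P i) f i).
Proof.
by move=> fB; elim/big_rec: _ => [|i a Pi Ba]; [exact: infinitesimal0|apply: infinitesimalD; [exact: fB|]].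
Qed.

Lemma infinitesimalX a n : (0 < n)%N -> infinitesimal B a -> infinitesimal B (a ^+ n).
Proof.
case: n => // n _ na; rewrite exprS; apply: infinitesimalMr => //.
exact/cringX/infinitesimal_cring.
Qed.

Lemma infinitesimal_lt1 a : infinitesimal B a -> `|a| < 1.
Proof.
move=> na; rewrite ltNge; apply/negP => a1; apply: infinitesimal1.
by apply: (infinitesimal_le na); rewrite normr1.
Qed.

Lemma infinitesimal_unitD a b : B a^-1 -> a != 0 -> infinitesimal B b ->
  a + b != 0 /\ B (a + b)^-1.
Proof.
move=> Ba a0 nb; apply: cringPn => nab; move/eqP: a0; apply.
apply: infinitesimal_inv_eq0 Ba; rewrite -(addrK b a).
exact: infinitesimalB.
Qed.
End Theory.

Lemma infinitesimal_sub B B' a : B `<=` B' -> infinitesimal B' a -> infinitesimal B a.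
Proof. by move=> BB' na a0 /BB'; apply: na. Qed.

Lemma subfield0 K : is_subfield K -> K 0.
Proof. by move=> [[K1 KB _] _]; rewrite -(subrr 1); apply: KB. Qed.

Lemma subfieldN K a : is_subfield K -> K a -> K (- a).
Proof.
move=> sK Ka; rewrite -sub0r; have [[_ KB _] _] := sK.
by apply: KB => //; apply: subfield0.
Qed.

Lemma subfieldB K a b : is_subfield K -> K a -> K b -> K (a - b).
Proof. by move=> [[_ KB _] _]; apply: KB. Qed.

Lemma subfieldD K a b : is_subfield K -> K a -> K b -> K (a + b).
Proof. by move=> sK Ka Kb; rewrite -(opprK b); apply: subfieldB => //; apply: subfieldN. Qed.

Lemma subfieldM K a b : is_subfield K -> K a -> K b -> K (a * b).
Proof. by move=> [[_ _ KM] _]; apply: KM. Qed.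

Lemma subfieldV K a : is_subfield K -> K a -> K a^-1.
Proof. by move=> [_]; apply. Qed.

Lemma subfield_div K a b : is_subfield K -> K a -> K b -> K (a / b).
Proof. by move=> sK Ka Kb; apply: subfieldM => //; apply: subfieldV. Qed.

Lemma subfield1 K : is_subfield K -> K 1.
Proof. by move=> [[]]. Qed.

Lemma subfieldX K a n : is_subfield K -> K a -> K (a ^+ n).
Proof.
move=> sK Ka; elim: n => [|n IHn]; first by rewrite expr0; apply: subfield1.
by rewrite exprS; apply: subfieldM.
Qed.

Lemma subfield_sum K (I : eqType) (r : seq I) (P : pred I) (f : I -> M) :
  is_subfield K -> (forall i, i \in r -> P i -> K (f i)) ->
  K (\sum_(i <- r | P i) f i).
Proof.
move=> sK fK; rewrite big_seq_cond; elim/big_rec: _ => [|i a /andP[ir Pi] Ka].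
  exact: subfield0.
by apply: subfieldD => //; apply: fK.
Qed.

Lemma subfield_nat K n : is_subfield K -> K n%:R.
Proof.
move=> sK; elim: n => [|n IHn]; first exact: subfield0.
by rewrite -natr1; apply: subfieldD => //; apply: subfield1.
Qed.

Lemma subfield_norm K a : is_subfield K -> K a -> K `|a|.
Proof.
by move=> sK Ka; case: (ger0P a) => // _; apply: subfieldN.
Qed.

Lemma convex_ring_trace K B : is_subfield K -> convex_ring B ->
  is_convex_valuation K (K `&` B).
Proof.
move=> sK cB; split; first split.
- by move=> a [].
- split; first by split; [exact: subfield1|exact: convex_ring1].
    by move=> a b [Ka Ba] [Kb Bb]; split; [exact: subfieldB|exact: convex_ringB].
  by move=> a b [Ka Ba] [Kb Bb]; split; [exact: subfieldM|exact: convex_ringM].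
- move=> a Ka; case: (cring_total cB a); [left|right] => //.
  by split=> //; apply: subfieldV.
- move=> a b c [Ka Ba] [Kc Bc] Kb /andP[ab bc]; split=> //.
  have [bge|/ltW ble] := lerP 0 b; first apply: (convex_ring_le cB Bc).
    by rewrite !ger0_norm //; apply: le_trans bc.
  by apply: (convex_ring_le cB Ba); rewrite !ler0_norm ?lerN2 //; apply: le_trans ab ble.
Qed.

(** The convex hull of the valuation ring in [M] has the same trace. So
    valuations of all subfields can be treated as convex subrings of [M]. *)
Lemma convex_valuation_trace K O : is_subfield K -> is_convex_valuation K O ->
  exists2 B, convex_ring B & O = K `&` B.
Proof.
move=> sK [[OK [one_O OB OM] _] Oconv].
have zero_O : O 0 by rewrite -(subrr 1); apply: OB.
have ON a : O a -> O (- a) by move=> Oa; rewrite -sub0r; apply: OB.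
have OD a b : O a -> O b -> O (a + b) by move=> Oa Ob; rewrite -(opprK b); apply/OB/ON.
have On a : O a -> O `|a| by move=> Oa; case: (ger0P a) => // _; apply: ON.
exists [set a | exists2 b, O b & `|a| <= `|b|]; last first.
  apply/seteqP; split=> [a Oa|a [Ka [b Ob ab]]]; first by split; [exact: OK|exists a].
  apply: (Oconv (- `|b|) a `|b|) => //; first exact/ON/On.
    exact: On.
  by rewrite -ler_norml.
split.
- by exists 1.
- move=> a b [a' Oa' aa'] [b' Ob' bb']; exists (`|a'| + `|b'|); first by apply: OD; exact: On.
  apply: le_trans (ler_normB _ _) _; rewrite [leRHS]ger0_norm ?addr_ge0 //.
  exact: lerD.
- move=> a b [a' Oa' aa'] [b' Ob' bb']; exists (a' * b'); first exact: OM.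
  by rewrite !normrM ler_pM.
- by move=> a b [b' Ob' bb'] ab; exists b' => //; apply: le_trans bb'.
Qed.

Lemma val_leP K B a b : is_subfield K -> K a -> K b -> a != 0 ->
  val_le (K `&` B) a b <-> B (b / a).
Proof.
move=> sK Ka Kb a0; split=> [[u [_ Bu] ->]|Bba]; first by rewrite mulrAC divff ?mul1r.
by exists (b / a); [split=> //; apply: subfield_div|rewrite mulrCA divff ?mulr1].
Qed.

Lemma val_ltP K B a b : is_subfield K -> convex_ring B -> K a -> K b -> a != 0 ->
  val_lt (K `&` B) a b <-> infinitesimal B (b / a).
Proof.
move=> sK cB Ka Kb a0; rewrite /val_lt val_leP //.
have [->|b0] := eqVneq b 0.
  rewrite mul0r; split=> [_|_]; first exact: infinitesimal0.
  split; first exact: cring0.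
  by move=> [u _ /eqP]; rewrite mul0r (negbTE a0).
rewrite val_leP // -(invf_div b a); split=> [[_ h] //|nba].
by split; [exact: infinitesimal_cring|apply: nba; rewrite mulf_neq0 ?invr_eq0].
Qed.

Lemma val_lt_neq0 K O a b : is_valuation_ring K O -> val_lt O a b -> a != 0.
Proof.
move=> [_ [_ OB _] _] [[u Ou ->] nab]; apply/eqP => a0; apply: nab.
by exists 0; rewrite ?a0 ?mul0r // -(subrr u); apply: OB.
Qed.

(** * The convex ring generated by a group of positive elements *)

Record pos_subgroup Y : Prop := PosSubgroup {
  pos_subgroup_gt0 : forall y, Y y -> 0 < y;
  pos_subgroup1 : Y 1;
  pos_subgroup_div : forall y z, Y y -> Y z -> Y (y / z) }.

Definition bounded_by Y : set M :=
  [set a | exists n y, Y y /\ `|a| <= n%:R * y].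

Definition finite_ring : set M := bounded_by [set 1].

Section PosSubgroups.
Variable Y : set M.
Hypothesis gY : pos_subgroup Y.

Lemma pos_subgroup_neq0 y : Y y -> y != 0.
Proof. by move=> /(pos_subgroup_gt0 gY)/lt0r_neq0. Qed.

Lemma pos_subgroupV y : Y y -> Y y^-1.
Proof. by move=> Yy; rewrite -div1r; apply: (pos_subgroup_div gY) => //; apply: pos_subgroup1. Qed.

Lemma pos_subgroupM y z : Y y -> Y z -> Y (y * z).
Proof. by move=> Yy Yz; rewrite -[z]invrK; apply/(pos_subgroup_div gY)/pos_subgroupV. Qed.

Lemma pos_subgroupX y n : Y y -> Y (y ^+ n).
Proof.
move=> Yy; elim: n => [|n IHn]; first by rewrite expr0; apply: pos_subgroup1.
by rewrite exprS; apply: pos_subgroupM.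
Qed.

Lemma pos_subgroupXz y (e : int) : Y y -> Y (y ^ e).
Proof.
by move=> Yy; case: e => n; [|rewrite NegzE -exprnN; apply: pos_subgroupV]; apply: pos_subgroupX.
Qed.

Lemma pos_subgroup_prod (I : Type) (r : seq I) (P : pred I) (f : I -> M) :
  (forall i, P i -> Y (f i)) -> Y (\prod_(i <- r | P i) f i).
Proof.
by move=> fB; elim/big_rec: _ => [|i a Pi Ba]; [exact: pos_subgroup1|apply: pos_subgroupM; [exact: fB|]].
Qed.

Lemma bounded_by_convex_ring : convex_ring (bounded_by Y).
Proof.
have gt0 := pos_subgroup_gt0 gY; have Y1 := pos_subgroup1 gY.
split.
- by exists 1%N, 1; rewrite normr1 mulr1.
- move=> a b [n [y [Yy an]]] [m [z [Yz bm]]].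
  exists (n + m)%N, (Num.max y z); split; first by rewrite maxEle; case: ifP.
  apply: le_trans (ler_normB _ _) _; rewrite natrD mulrDl.
  apply: lerD; [apply: le_trans an _|apply: le_trans bm _]; rewrite ler_wpM2l //;
    by rewrite le_max lexx ?orbT.
- move=> a b [n [y [Yy an]]] [m [z [Yz bm]]]; exists (n * m)%N, (y * z).
  split; first exact: pos_subgroupM.
  by rewrite normrM natrM mulrACA ler_pM.
- by move=> a b [n [y [Yy bn]]] ab; exists n, y; split=> //; apply: le_trans bn.
Qed.

Lemma bounded_by_self y : Y y -> bounded_by Y y.
Proof. by move=> Yy; exists 1%N, y; rewrite mul1r gtr0_norm // (pos_subgroup_gt0 gY). Qed.
End PosSubgroups.

Lemma pos_subgroup_one : pos_subgroup [set 1].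
Proof. by split=> [y ->|//|y z -> ->] //=; rewrite divr1. Qed.

Lemma finite_convex_ring : convex_ring finite_ring.
Proof. exact: (bounded_by_convex_ring pos_subgroup_one). Qed.

Lemma finite_ringP a : finite_ring a <-> exists n : nat, `|a| <= n%:R.
Proof.
split=> [[n [y [-> an]]]|[n an]]; exists n; first by rewrite mulr1 in an.
by exists 1; rewrite mulr1.
Qed.

Lemma finite_ring_sub B : convex_ring B -> finite_ring `<=` B.
Proof.
move=> cB a /finite_ringP[n an]; apply: (convex_ring_le cB (cring_nat cB n)).
by rewrite normr_nat.
Qed.

Lemma bounded_by_sub Y Y' : Y `<=` Y' -> bounded_by Y `<=` bounded_by Y'.
Proof. by move=> YY' a [n [y [/YY' Yy an]]]; exists n, y. Qed.

Lemma natural_ringE K : is_subfield K -> natural_ring K = K `&` finite_ring.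
Proof.
move=> sK; apply/seteqP; split=> [a [Ka h]|a [Ka fa]].
  by apply: h; apply: convex_ring_trace => //; apply: finite_convex_ring.
split=> // O /(convex_valuation_trace sK)[B cB ->]; split=> //.
exact: (finite_ring_sub cB).
Qed.
End ConvexRings.

(** * Hensel's lemma in subfields of an ordered field *)

Section Hensel.
Variable M : realFieldType.
Implicit Types (B K O A : set M) (a b c : M) (p : {poly M}).

Definition coefs_in A p : Prop := forall i, A p`_i.

Lemma horner_cring B p a : convex_ring B -> coefs_in B p -> B a -> B p.[a].
Proof.
move=> cB pB Ba; rewrite horner_coef; apply: cring_sum => // i _.
by apply: (convex_ringM cB) => //; apply: cringX.
Qed.

Lemma horner_subfield K p a : is_subfield K -> coefs_in K p -> K a -> K p.[a].
Proof.
move=> sK pK Ka; rewrite horner_coef; apply: subfield_sum => // i _ _.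
by apply: subfieldM => //; apply: subfieldX.
Qed.

Lemma deriv_coefs_cring B p : convex_ring B -> coefs_in B p -> coefs_in B p^`().
Proof.
move=> cB pB i; rewrite coef_deriv -mulr_natr.
by apply: (convex_ringM cB) => //; apply: cring_nat.
Qed.

Lemma deriv_coefs_subfield K p : is_subfield K -> coefs_in K p -> coefs_in K p^`().
Proof.
move=> sK pK i; rewrite coef_deriv -mulr_natr.
by apply: subfieldM => //; apply: subfield_nat.
Qed.

Lemma horner_taylor2 B p a b : convex_ring B -> coefs_in B p -> B a -> B b ->
  exists2 q, B q & p.[b] = p.[a] + p^`().[a] * (b - a) + q * (b - a) ^+ 2.
Proof.
move=> cB + Ba Bb; elim/poly_ind: p => [|p c IHp] pB.
  by exists 0; [exact: cring0|rewrite deriv0 !horner0; ring].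
have {}pB : coefs_in B p.
  by move=> i; have := pB i.+1; rewrite coefD coefMX coefC /= addr0.
have [q Bq pbE] := IHp pB.
exists (p^`().[a] + q * b).
  apply: cringD => //; first by apply: horner_cring => //; apply: deriv_coefs_cring.
  exact: (convex_ringM cB).
rewrite derivD derivM derivX derivC !hornerE /= pbE; ring.
Qed.

Lemma horner_taylor1 B p a b : convex_ring B -> coefs_in B p -> B a -> B b ->
  exists2 q, B q & p.[b] = p.[a] + q * (b - a).
Proof.
move=> cB pB Ba Bb; have [q Bq ->] := horner_taylor2 cB pB Ba Bb.
exists (p^`().[a] + q * (b - a)); last by ring.
apply: (cringD cB); first by apply: horner_cring => //; apply: deriv_coefs_cring.
by apply: (convex_ringM cB) => //; apply: (convex_ringB cB).
Qed.

(** Hensel's lemma for the natural valuation, with the finite and the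
    infinitesimal elements of [M] in the place of valuations. *)
Definition hensel_property K : Prop := forall p a, coefs_in K p ->
  coefs_in (@finite_ring M) p -> K a -> finite_ring a ->
  infinitesimal (@finite_ring M) p.[a] ->
  p^`().[a] != 0 -> finite_ring (p^`().[a])^-1 ->
  exists b, [/\ K b, root p b & infinitesimal (@finite_ring M) (b - a)].

Lemma henselianP K : is_subfield K ->
  is_henselian K (natural_ring K) <-> hensel_property K.
Proof.
move=> sK; have cF := finite_convex_ring M; rewrite natural_ringE //.
have val_ltE a : K a -> val_lt (K `&` finite_ring (M:=M)) 1 a <->
    infinitesimal (finite_ring (M:=M)) a.
  move=> Ka; rewrite (val_ltP sK cF) ?oner_neq0 ?divr1 //; exact: subfield1.
split=> h p a.
- move=> pK pF Ka Fa pa p'a p'aV.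
  have K1 := subfield1 sK; have F1 := convex_ring1 cF.
  have [||||b [Kb rb ba]] := h p a.
  + by move=> i; split; [exact: pK|exact: pF].
  + by [].
  + by apply/val_ltE => //; apply: horner_subfield.
  + have Kp'a : K p^`().[a] by apply: horner_subfield => //; apply: deriv_coefs_subfield.
    split; rewrite val_leP ?oner_neq0 ?divr1 ?div1r //.
    by apply: horner_cring => //; apply: deriv_coefs_cring.
  + by exists b; split=> //; apply/val_ltE => //; apply: subfieldB.
- move=> pO [Ka Fa].
  have pK : coefs_in K p by move=> i; case: (pO i).
  have pF : coefs_in (@finite_ring M) p by move=> i; case: (pO i).
  have Kp'a : K p^`().[a] by apply: horner_subfield => //; apply: deriv_coefs_subfield.
  have K1 := subfield1 sK.
  move=> /val_ltE pa [_ [u [Ku Fu] /eqP]]; rewrite eq_sym => /eqP p'au.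
  have p'a : p^`().[a] != 0.
    by apply: contra_eq_neq p'au => ->; rewrite mul0r eq_sym oner_neq0.
  have uE : u = (p^`().[a])^-1 by apply: (mulfI p'a); rewrite p'au divff.
  have fin_u : finite_ring (p^`().[a])^-1 by rewrite -uE.
  have [b [Kb rb ba]] := h p a pK pF Ka Fa (pa (horner_subfield sK pK Ka)) p'a fin_u.
  by exists b; split=> //; apply/val_ltE => //; apply: subfieldB.
Qed.

(** A root that is infinitesimally close to a simple approximate root is unique
    in [M], so that henselian subfields can be intersected. *)
Lemma hensel_unique p a b c : coefs_in (@finite_ring M) p -> finite_ring a ->
  p^`().[a] != 0 -> finite_ring (p^`().[a])^-1 ->
  root p b -> infinitesimal (@finite_ring M) (b - a) ->
  root p c -> infinitesimal (@finite_ring M) (c - a) -> b = c.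
Proof.
move=> pF Fa p'a p'aV /rootP pb ba /rootP pc ca.
have cF := finite_convex_ring M.
have Fb : finite_ring b by rewrite -(subrK a b); apply: (cringD cF) => //; apply: (infinitesimal_cring cF).
have Fc : finite_ring c by rewrite -(subrK a c); apply: (cringD cF) => //; apply: (infinitesimal_cring cF).
have [q Fq] := horner_taylor2 cF pF Fb Fc; rewrite pb pc add0r.
have [q' Fq' p'bE] := horner_taylor1 cF (deriv_coefs_cring cF pF) Fa Fb.
have -> : p^`().[b] * (c - b) + q * (c - b) ^+ 2 =
  (p^`().[a] + (q' * (b - a) + q * ((c - a) - (b - a)))) * (c - b).
  by rewrite p'bE; ring.
have [|u0 _] := @infinitesimal_unitD _ _ cF _ (q' * (b - a) + q * ((c - a) - (b - a))) p'aV p'a.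
  apply: (infinitesimalD cF); apply: (infinitesimalMl cF) => //.
  exact: (infinitesimalB cF).
by move/esym/eqP; rewrite mulf_eq0 (negbTE u0) /= subr_eq0 => /eqP.
Qed.

(** Where [p] is dominated by its linear part, it changes sign around [a]. *)
Lemma real_closed_hensel K : is_subfield K -> is_real_closed K -> hensel_property K.
Proof.
move=> sK rcK p a pK pF Ka Fa pa p'a p'aV.
have cF := finite_convex_ring M.
have [pa0|pa0] := eqVneq p.[a] 0.
  by exists a; split; rewrite ?subrr //; [exact/rootP|exact: infinitesimal0].
set s := p^`().[a] in p'a p'aV.
pose e := 2%:R * `|p.[a] / s|.
have Ks : K s by apply: horner_subfield => //; apply: deriv_coefs_subfield.
have Kpa : K p.[a] by exact: horner_subfield.
have Ke : K e.
  by apply: subfieldM => //; [exact: subfield_nat|apply: subfield_norm => //; exact: subfield_div].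
have ie : infinitesimal (@finite_ring M) e.
  apply: (infinitesimalMl cF); first exact: cring_nat.
  apply: (infinitesimal_le cF) (_ : infinitesimal _ (p.[a] / s)) _.
    exact: infinitesimalMr.
  by rewrite normr_id.
have e0 : 0 < e by rewrite mulr_gt0 // normr_gt0 mulf_neq0 ?invr_eq0.
(* [p.[a] / s] has half the size of [t], and the quadratic term is infinitesimal
   compared with [t], so that [p.[a + t] / s] has the sign of [t] *)
have near t : `|t| = e -> `|p.[a + t] / s - t| < e.
  move=> te; have it : infinitesimal (@finite_ring M) t.
    by apply: (infinitesimal_le cF ie); rewrite te ger0_norm // ltW.
  have Ft := infinitesimal_cring cF it.
  have [q Fq] := horner_taylor2 cF pF Fa (cringD cF Fa Ft).
  rewrite (addrC a) addrK => ->; rewrite -/s.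
  have -> : (p.[a] + s * t + q * t ^+ 2) / s - t = p.[a] / s + (q / s * t) * t.
    by field.
  apply: le_lt_trans (ler_normD _ _) _; rewrite [X in _ + X]normrM te.
  have -> : `|p.[a] / s| = e / 2%:R by rewrite /e; field.
  have : `|q / s * t * 2%:R| < 1.
    apply: (infinitesimal_lt1 cF); apply: (infinitesimalMr cF); last exact: cring_nat.
    by apply: (infinitesimalMl cF) => //; apply: (convex_ringM cF).
  by rewrite normrM normr_nat => h; nra.
have neg : p.[a - e] / s < 0.
  by have := near (- e); rewrite normrN ger0_norm ?ltW // ltr_norml => /(_ erefl)/andP[]; lra.
have pos : 0 < p.[a + e] / s.
  by have := near e; rewrite ger0_norm ?ltW // ltr_norml => /(_ erefl)/andP[]; lra.
pose p1 := s^-1 *: p.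
have p1K : coefs_in K p1.
  by move=> i; rewrite coefZ; apply: subfieldM => //; apply: subfieldV.
have [||||z Kz /andP[/andP[az za] rz]] := rcK p1 (a - e) (a + e) p1K.
- exact: subfieldB.
- exact: subfieldD.
- by lra.
- by rewrite !hornerZ ![s^-1 * _]mulrC !ltW.
exists z; split=> //; first by move: rz; rewrite rootZ ?invr_eq0.
apply: (infinitesimal_le cF ie); rewrite [leRHS](ger0_norm (ltW e0)).
by rewrite ler_norml; apply/andP; split; lra.
Qed.
End Hensel.

(** * Henselian closures *)

Lemma subfield_bigcap (M : realFieldType) (P : set M -> Prop) :
  (forall K, P K -> is_subfield K) -> is_subfield [set y | forall K, P K -> K y].
Proof.
move=> PK; split; first split.
- by move=> K /PK; apply: subfield1.
- by move=> a b aP bP K KP; apply: (subfieldB (PK _ KP)); [apply: aP|apply: bP].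
- by move=> a b aP bP K KP; apply: (subfieldM (PK _ KP)); [apply: aP|apply: bP].
- by move=> a aP K KP; apply: (subfieldV (PK _ KP)); apply: aP.
Qed.

Section Closures.
Variables (R : realType) (F : forall n, set (power_series R n)).
Variables (M : realFieldType) (S : an_exp_structure R M).
Variable iota : {rmorphism R -> M}.
Implicit Types (A K X Y : set M).

Local Notation "A ^hF" := (hF_closure F S A) (at level 2, format "A ^hF").

Lemma hF_closureE A : A^hF = [set y | forall K, [/\ is_subfield K, A `<=` K,
  closed_under_family F S K & is_henselian K (natural_ring K)] -> K y].
Proof.
apply/seteqP; split=> [y h K [sK AK fK hK]|y h K sK AK fK hK].
  exact: (h K sK AK fK hK).
exact: (h K (And4 sK AK fK hK)).
Qed.

Lemma hF_closure_subfield A : is_subfield A^hF.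
Proof. by rewrite hF_closureE; apply: subfield_bigcap => K []. Qed.

Lemma hF_closure_sub A : A `<=` A^hF.
Proof. by move=> a Aa K _ AK _ _; apply: AK. Qed.

Lemma hF_closure_family A : closed_under_family F S A^hF.
Proof.
move=> n f y Ff yA K sK AK fK hK; apply: (fK _ f y Ff) => i.
exact: (yA i K sK AK fK hK).
Qed.

Lemma hF_closure_min A K : is_subfield K -> A `<=` K ->
  closed_under_family F S K -> hensel_property K -> A^hF `<=` K.
Proof. by move=> sK AK fK hK y; apply=> //; apply/henselianP. Qed.

Hypothesis M_hensel : hensel_property [set: M].

(** The root exists in [M], and being unique there it belongs to all the henselian
    subfields of which the closure is the intersection. *)
Lemma hF_closure_hensel A : hensel_property A^hF.
Proof.
move=> p a pA pF Aa Fa pa p'a p'aV.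
have cF := finite_convex_ring M.
have [b [_ rb ba]] := M_hensel (fun=> I) pF I Fa pa p'a p'aV.
exists b; split=> // K sK AK fK hK.
have pK : coefs_in K p by move=> i; exact: (pA i K sK AK fK hK).
have Ka : K a by exact: (Aa K sK AK fK hK).
have [b' [Kb' rb' ba']] := (henselianP sK).1 hK p a pK pF Ka Fa pa p'a p'aV.
by rewrite (hensel_unique pF Fa p'a p'aV rb ba rb' ba').
Qed.

Lemma hF_closure_mono A A' : A `<=` A' -> A^hF `<=` A'^hF.
Proof.
move=> AA'; apply: hF_closure_min.
- exact: hF_closure_subfield.
- by apply: subset_trans AA' _; apply: hF_closure_sub.
- exact: hF_closure_family.
- exact: hF_closure_hensel.
Qed.

Lemma real_adjoin_min X K : is_subfield K -> range iota `<=` K -> X `<=` K ->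
  real_adjoin iota X `<=` K.
Proof. by move=> sK rK XK y; apply=> // z [/rK|/XK]. Qed.

Lemma real_adjoin_subset X : X `<=` real_adjoin iota X.
Proof. by move=> x Xx K _; apply; right. Qed.

Lemma real_adjoin_real X r : real_adjoin iota X (iota r).
Proof. by move=> K _; apply; left; exists r. Qed.

Lemma real_adjoin_mono X X' : X `<=` X' -> real_adjoin iota X `<=` real_adjoin iota X'.
Proof. by move=> XX' y h K sK XK; apply: (h K sK) => z [rz|/XX' Xz]; apply: XK; [left|right]. Qed.
End Closures.

(** * Real closedness, standard parts and units *)

Section RealClosedModel.
Variables (R : realType) (M : realFieldType) (S : an_exp_structure R M).
Hypothesis M_model : model_of_Tanexp S.

Definition poly_term n m (c : 'I_n -> 'I_m) (z : 'I_m) : an_term R m :=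
  term_sum (enum 'I_n) (fun i => TMul (TVar R (c i)) (term_pow (TVar R z) i)).

Lemma eval_poly_term (K : realFieldType) (S' : an_exp_structure R K) n m
    (c : 'I_n -> 'I_m) (z : 'I_m) (e : 'I_m -> K) (p : {poly K}) :
  (forall i, e (c i) = p`_i) -> (size p <= n)%N ->
  eval_term S' e (poly_term c z) = p.[e z].
Proof.
move=> ec pn; rewrite /poly_term eval_term_sum big_enum /= (horner_coef_wide _ pn).
by apply: eq_bigr => i _ /=; rewrite eval_term_pow ec.
Qed.

Definition ivt_formula n : an_formula R n.+2 :=
  let a := ord0 : 'I_n.+2 in let b := lift ord0 (ord0 : 'I_n.+1) in
  let c (i : 'I_n) := lift ord0 (lift ord0 i) in
  let z := ord0 : 'I_n.+3 in
  FImp (FAnd (FLe (TVar R a) (TVar R b))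
    (FAnd (FLe (poly_term c a) (TZero R _)) (FLe (TZero R _) (poly_term c b))))
  (FNot (FAll (FNot (FAnd
    (FAnd (FLe (TVar R (lift ord0 a)) (TVar R z)) (FLe (TVar R z) (TVar R (lift ord0 b))))
    (FEq (poly_term (fun i => lift ord0 (c i)) z) (TZero R _)))))).

Lemma holds_ivt_formula (K : realFieldType) (S' : an_exp_structure R K) n
    (a b : K) (p : {poly K}) : (size p <= n)%N ->
  holds S' (ivt_formula n) (extend_env a (extend_env b (fun i : 'I_n => p`_i))) <->
  (a <= b -> p.[a] <= 0 <= p.[b] -> exists2 z, a <= z <= b & root p z).
Proof.
move=> pn; set e := extend_env _ _.
have ec i : e (lift ord0 (lift ord0 i)) = p`_i by rewrite /e !extend_envS.
have ea : e ord0 = a by rewrite /e extend_env0.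
have eb : e (lift ord0 ord0) = b by rewrite /e extend_envS extend_env0.
rewrite holds_FImp !holds_FAnd !holds_FLe !(eval_poly_term S' _ ec pn) /=.
rewrite ea eb; set Q := ~ _.
have -> : Q <-> exists2 z, a <= z <= b & root p z.
  rewrite /Q; split=> [h|[z /andP[az zb] rz] h].
    apply: contrapT => noz; apply: h => z [[/negP az /negP zb] pz]; apply: noz.
    exists z; first by move: az zb; rewrite /= -!leNgt !extend_envS extend_env0 ea eb => -> ->.
    apply/rootP; rewrite -[RHS]pz (eval_poly_term _ _ _ pn) ?extend_env0 // => i.
    by rewrite extend_envS.
  apply: (h z); rewrite !extend_envS extend_env0 ea eb; split.
    by split; apply/negP; rewrite -leNgt.
  rewrite (@eval_poly_term _ _ _ _ _ _ _ p) ?extend_env0 //; first exact/rootP.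
  by move=> i; rewrite extend_envS.
by split=> [h ab /andP[pa pb]|h [ab [pa pb]]]; apply: h; rewrite ?pa.
Qed.

(** For polynomials of bounded degree, the intermediate value property is a
    sentence of the theory. *)
Lemma model_real_closed : is_real_closed [set: M].
Proof.
move=> p a b _ _ _ ab pab.
suff /holds_ivt_formula h : holds S (ivt_formula (size p))
    (extend_env a (extend_env b (fun i : 'I_(size p) => p`_i))).
  by have [//|//|//|z zab rz] := h; exists z => //; rewrite zab.
apply: (transfer_forall M_model) => e.
pose q := \poly_(i < size p) (if insub i is Some j then e (lift ord0 (lift ord0 j)) else 0).
have qe : e \o lift ord0 \o lift ord0 = (fun i : 'I_(size p) => q`_i).
  by apply/funext => i; rewrite coef_poly ltn_ord valK.
rewrite [e]extend_env_eta [e \o lift ord0]extend_env_eta qe.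
apply/holds_ivt_formula; first exact: size_poly.
by move=> le_ab /(poly_ivt le_ab)[z zab rz]; exists z.
Qed.

Lemma model_hensel : hensel_property [set: M].
Proof. by apply: real_closed_hensel model_real_closed; split; [split|]. Qed.
End RealClosedModel.

Section StandardPart.
Variables (R : realType) (M : realFieldType) (iota : {rmorphism R -> M}).
Hypothesis iota_lt : {mono iota : a b / a < b}.

Lemma iota_le : {mono iota : a b / a <= b}.
Proof. by move=> a b; rewrite !leNgt iota_lt. Qed.

Lemma iota_norm r : iota `|r| = `|iota r|.
Proof.
case: (ger0P r) => [r0|/ltW r0]; first by rewrite ger0_norm // -(rmorph0 iota) iota_le.
by rewrite rmorphN ler0_norm // -(rmorph0 iota) iota_le.
Qed.

Lemma finite_iota r : finite_ring (iota r).
Proof.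
apply/finite_ringP; exists (Num.truncn `|r|).+1.
by rewrite -(rmorph_nat iota) -iota_norm iota_le ltW // truncnS_gt.
Qed.

Lemma infinitesimal_iota r : infinitesimal (@finite_ring M) (iota r) -> r = 0.
Proof.
have [//|r0] := eqVneq r 0; move=> /(_ _)/=; rewrite fmorph_eq0 => /(_ r0).
by rewrite -fmorphV => /(_ (finite_iota _)).
Qed.

(** The standard part is the supremum of the reals below [a]. *)
Lemma standard_part a : finite_ring a ->
  exists r, infinitesimal (@finite_ring M) (a - iota r).
Proof.
move=> /finite_ringP[n an].
pose E : set R := [set q | iota q <= a].
have Esup : has_sup E.
  split; first by exists (- n%:R); rewrite /E /= rmorphN rmorph_nat; move: an; rewrite ler_norml => /andP[].
  exists n%:R => q; rewrite /E /= => qa; rewrite -iota_le rmorph_nat.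
  by apply: le_trans qa _; apply: le_trans an; apply: ler_norm.
exists (sup E); apply: contrapT => /cringPn[d0 /finite_ringP[m dm]].
have m0 : (0 < m%:R :> M) by apply: lt_le_trans dm; rewrite normr_gt0 invr_eq0.
have m0' : (0 < m%:R :> R) by rewrite ltr0n; move: m0; rewrite ltr0n.
have {dm} : iota (m%:R^-1) <= `|a - iota (sup E)|.
  rewrite fmorphV rmorph_nat -[leRHS]invrK -normfV lef_pV2 // posrE //.
  by rewrite normr_gt0 invr_eq0.
have im0 : 0 < iota m%:R^-1 by rewrite -(rmorph0 iota) iota_lt invr_gt0.
rewrite ler_normr => /orP[]; rewrite ?opprB => h.
  suff : sup E + m%:R^-1 <= sup E by rewrite gerDl leNgt invr_gt0 m0'.
  by apply: (sup_upper_bound Esup); rewrite /E /= rmorphD; lra.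
have mV0 : 0 < m%:R^-1 :> R by rewrite invr_gt0.
have [q Eq] := sup_adherent mV0 Esup.
rewrite -iota_lt rmorphB /= => qs.
by have := lt_le_trans qs Eq; lra.
Qed.
End StandardPart.

Section Context.
Variables (R : realType) (F : forall n : nat, set (power_series R n)).
Hypothesis F_admissible : admissible_family F.
Variables (M : realFieldType) (S : an_exp_structure R M).
Hypothesis M_model : model_of_Tanexp S.
Variable iota : {rmorphism R -> M}.
Hypothesis iota_embeds : embeds_reals F S iota.
Variables (x : M) (X : set M).
Hypothesis X_monomials : is_monomial_group F S iota x X.
Implicit Types (A K Y : set M) (a b c u y : M).

Local Notation K := (LE F S iota x).

(** The field [R(Y)^hF]. *)
Definition field_of Y : set M := hF_closure F S (real_adjoin iota Y).

Lemma LE_field_of : K = field_of X.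
Proof. exact: monomial_hF X_monomials. Qed.

Lemma field_of_subfield Y : is_subfield (field_of Y).
Proof. exact: hF_closure_subfield. Qed.

Lemma field_of_family Y : closed_under_family F S (field_of Y).
Proof. exact: hF_closure_family. Qed.

Lemma field_of_hensel Y : hensel_property (field_of Y).
Proof. exact: (hF_closure_hensel (model_hensel M_model)). Qed.

Lemma field_of_subset Y : Y `<=` field_of Y.
Proof. by apply: subset_trans (@hF_closure_sub _ _ _ _ _); apply: real_adjoin_subset. Qed.

Lemma field_of_real Y r : field_of Y (iota r).
Proof. by apply: hF_closure_sub; apply: real_adjoin_real. Qed.

Lemma field_of_min Y A : is_subfield A -> range iota `<=` A -> Y `<=` A ->
  closed_under_family F S A -> hensel_property A -> field_of Y `<=` A.
Proof.
move=> sA rA YA fA hA; apply: hF_closure_min => //.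
exact: real_adjoin_min.
Qed.

Lemma field_of_mono Y Y' : Y `<=` Y' -> field_of Y `<=` field_of Y'.
Proof. by move=> YY'; apply: (hF_closure_mono (model_hensel M_model)); apply: real_adjoin_mono. Qed.

Lemma LE_subfield : is_subfield K.
Proof. by rewrite LE_field_of; apply: field_of_subfield. Qed.

Lemma monomial_LE : X `<=` K.
Proof. exact: monomial_sub X_monomials. Qed.

Lemma field_of_LE Y : Y `<=` X -> field_of Y `<=` K.
Proof. by rewrite LE_field_of; apply: field_of_mono. Qed.

Lemma monomial_subgroup : pos_subgroup X.
Proof.
split; [exact: monomial_gt0 X_monomials|exact: monomial_one X_monomials|].
exact: monomial_div X_monomials.
Qed.

Lemma sub_monomial_subgroup Y : Y `<=` X -> Y 1 ->
  (forall y z, Y y -> Y z -> Y (y / z)) -> pos_subgroup Y.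
Proof. by move=> YX Y1 Yd; split=> // y /YX; apply: (pos_subgroup_gt0 monomial_subgroup). Qed.

(** A positive root in one real closed subfield is the positive root in all. *)
Lemma LE_root a n : (0 < n)%N -> K a -> 0 < a -> exists2 b, K b & 0 < b /\ b ^+ n = a.
Proof.
move=> n0 Ka a0.
have root_in (A : set M) : is_subfield A -> is_real_closed A -> A a ->
    exists2 b, A b & 0 < b /\ b ^+ n = a.
  move=> sA rcA Aa; pose p : {poly M} := 'X^n - a%:P.
  have pE b : p.[b] = b ^+ n - a by rewrite /p !hornerE.
  have [|||||b Ab /andP[/andP[b0 _]]] := rcA p 0 (1 + a).
  - move=> i; rewrite coefB coefXn coefC; apply: subfieldB => //.
      by case: (_ == _); [apply: subfield1|apply: subfield0].
    by case: (_ == _) => //; apply: subfield0.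
  - exact: subfield0.
  - by apply: subfieldD => //; apply: subfield1.
  - by rewrite addr_ge0 // ltW.
  - rewrite !pE expr0n eqn0Ngt n0 sub0r oppr_le0 ltW //= subr_ge0.
    have a1 : 1 <= 1 + a by rewrite lerDl ltW.
    apply: le_trans (_ : 1 + a <= _); first by rewrite lerDr.
    by rewrite -[leLHS]expr1 ler_weXn2l.
  rewrite /root pE subr_eq0 => /eqP bn; exists b => //; split=> //.
  rewrite lt_neqAle b0 andbT; apply: contraTneq a0 => b00.
  by rewrite -bn -b00 expr0n eqn0Ngt n0 ltxx.
have sM : is_subfield [set: M] by split; [split|].
have [b _ [b0 bn]] := root_in _ sM (model_real_closed M_model) I.
exists b => // A sA rA xA rcA fA eA lA.
have [b' Ab' [b0' bn']] := root_in A sA rcA (Ka A sA rA xA rcA fA eA lA).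
suff -> : b = b' by [].
by apply/eqP; rewrite -(@eqrXn2 _ n) ?ltW // bn bn'.
Qed.

(** The root of [u] in the field has the value of a monomial, whose power must be
    [u] since monomials are determined by their values. *)
Lemma monomial_root u n : (0 < n)%N -> X u -> exists2 w, X w & w ^+ n = u.
Proof.
move=> n0 Xu; have [s [s1 s2 sM] XE] := monomial_section X_monomials.
have sK := LE_subfield.
have s_id z : X z -> s z = z.
  rewrite XE => -[a [Ka a0] <-]; have [Ksa sa0 sa] := s1 a Ka a0.
  exact: s2.
have u0 := pos_subgroup_gt0 monomial_subgroup Xu.
have Ku := monomial_LE Xu.
have [b Kb [b0 bn]] := LE_root n0 Ku u0.
have b_neq0 := lt0r_neq0 b0.
exists (s b); first by rewrite XE; exists b.
rewrite -(s_id u Xu) -bn; case: n n0 {bn} => // n _.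
elim: n => [|n IHn]; first by rewrite !expr1.
rewrite exprS IHn -sM //; first exact: (subfieldX _ sK Kb).
by rewrite expf_neq0.
Qed.

(** The nonzero elements of a field of representatives have value [0]. *)
Lemma residue_field_unit (B : set M) a : convex_ring B ->
  residue_field F S iota X (K `&` B) a -> a != 0 -> B a /\ B a^-1.
Proof.
move=> cB ka a0; have sK := LE_subfield.
have [_ [_ kK k1 _]] := monomial_residue X_monomials (convex_ring_trace sK cB).
have [+ +] := k1 a ka a0; rewrite !val_leP ?oner_neq0 ?divr1 ?div1r //;
  try exact: kK; exact: subfield1.
Qed.

(** Groups of units of [B] generate subfields of the residue field. *)
Lemma field_of_residue (B : set M) Y : convex_ring B -> Y `<=` X ->
  (forall y, Y y -> B y /\ B y^-1) ->
  field_of Y `<=` residue_field F S iota X (K `&` B).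
Proof.
move=> cB YX YB; apply: field_of_mono => y Yy; split; first exact: YX.
have sK := LE_subfield; have Xy := YX _ Yy.
have [By ByV] := YB _ Yy.
have y0 := pos_subgroup_neq0 monomial_subgroup Xy.
by split; rewrite val_leP ?oner_neq0 ?divr1 ?div1r //; first [exact: subfield1|exact: monomial_LE].
Qed.

(** By the choice of the monomials, [R(Y)^hF] lies in the residue field of the
    valuation whose ring consists of the elements bounded by [Y]. *)
Lemma field_of_unit Y a : pos_subgroup Y -> Y `<=` X -> field_of Y a -> a != 0 ->
  bounded_by Y a /\ bounded_by Y a^-1.
Proof.
move=> gY YX Ya; have cB := bounded_by_convex_ring gY.
apply: residue_field_unit => //; apply: field_of_residue Ya => // y Yy.
by split; apply: bounded_by_self => //; apply: pos_subgroupV.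
Qed.

Lemma field_of_bounded Y a : pos_subgroup Y -> Y `<=` X -> field_of Y a ->
  bounded_by Y a.
Proof.
move=> gY YX Ya; have [->|a0] := eqVneq a 0; first by apply: cring0; apply: bounded_by_convex_ring.
by have [] := field_of_unit gY YX Ya a0.
Qed.

(** * Approximation by sums of monomials *)

Section Approximation.
Variables (Y D : set M).
Hypotheses (gY : pos_subgroup Y) (YX : Y `<=` X).
Hypotheses (gD : pos_subgroup D) (DX : D `<=` X).
Hypothesis D_archimedean : forall d e, D d -> D e -> d < 1 -> exists n, d ^+ n <= e.
Hypothesis D_infinitesimal : forall d, D d -> d < 1 -> infinitesimal (bounded_by Y) d.
Variable t : M.
Hypotheses (Dt : D t) (t1 : t < 1).

Definition product_group : set M := [set z | exists y d, [/\ Y y, D d & z = y * d]].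

Local Notation Z := product_group.
Local Notation B := (bounded_by Y).
Local Notation E := (field_of Y).

Let cB : convex_ring B. Proof. exact: bounded_by_convex_ring. Qed.
Let sE : is_subfield E. Proof. exact: field_of_subfield. Qed.

Lemma product_group_subgroup : pos_subgroup Z.
Proof.
split.
- by move=> z [y [d [Yy Dd ->]]]; apply: mulr_gt0; [exact: pos_subgroup_gt0 Yy|exact: pos_subgroup_gt0 Dd].
- by exists 1, 1; split; rewrite ?mulr1 //; apply: pos_subgroup1.
- move=> z z' [y [d [Yy Dd ->]]] [y' [d' [Yy' Dd' ->]]].
  exists (y / y'), (d / d'); split; [exact: (pos_subgroup_div gY)|exact: (pos_subgroup_div gD)|].
  by rewrite invfM mulrACA.
Qed.

Lemma product_group_monomial : Z `<=` X.
Proof.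
by move=> z [y [d [/YX Xy /DX Xd ->]]]; apply: pos_subgroupM => //; apply: monomial_subgroup.
Qed.

Lemma product_group_l : Y `<=` Z.
Proof. by move=> y Yy; exists y, 1; split; rewrite ?mulr1 //; apply: pos_subgroup1. Qed.

Lemma product_group_r : D `<=` Z.
Proof. by move=> d Dd; exists 1, d; split; rewrite ?mul1r //; apply: pos_subgroup1. Qed.

Let t0 : 0 < t. Proof. exact: pos_subgroup_gt0 Dt. Qed.

Lemma D_neq0 d : D d -> d != 0. Proof. exact: pos_subgroup_neq0. Qed.

Lemma D_bounded d : D d -> d <= 1 -> B d.
Proof.
move=> Dd d1; apply: (convex_ring_le cB (convex_ring1 cB)).
by rewrite normr1 gtr0_norm // (pos_subgroup_gt0 gD).
Qed.

Lemma E_bounded c : E c -> B c.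
Proof. exact: field_of_bounded. Qed.

(** Lists of pairs [(c, d)] that stand for the summands [c * d] of a sum, with
    increasing values of the [d]. *)
Fixpoint normal_terms (l : seq (M * M)) : Prop :=
  if l is p :: l' then
    [/\ E p.1, p.1 != 0, D p.2, (forall q, q \in l' -> q.2 < p.2) & normal_terms l']
  else True.

Definition term_total (l : seq (M * M)) : M := \sum_(p <- l) p.1 * p.2.

Definition monomial_sums : set M :=
  [set s | exists2 l, normal_terms l & s = term_total l].
Local Notation P := monomial_sums.

Lemma normal_terms_mem l p : normal_terms l -> p \in l -> [/\ E p.1, p.1 != 0 & D p.2].
Proof.
elim: l => // q l IHl [Eq q0 Dq _ nl]; rewrite inE => /predU1P[->//|]; exact: IHl.
Qed.

Lemma term_total_cons p l : term_total (p :: l) = p.1 * p.2 + term_total l.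
Proof. exact: big_cons. Qed.

Lemma add_term c d l : E c -> D d -> normal_terms l ->
  exists l', [/\ normal_terms l', term_total l' = c * d + term_total l &
    forall q, q \in l' -> q.2 = d \/ exists2 q', q' \in l & q'.2 = q.2].
Proof.
move=> Ec Dd; have [->|c0] := eqVneq c 0.
  by exists l; split=> //; [rewrite mul0r add0r|move=> q ql; right; exists q].
elim: l => [|p l IHl] /=.
  move=> _; exists [:: (c, d)]; split=> [//||q]; first by rewrite term_total_cons.
  by rewrite inE => /eqP ->; left.
move=> [Ep p0 Dp pl nl]; have [dp|pd|dp] := ltgtP d p.2.
- have [l' [nl' l'E l'q]] := IHl nl; exists (p :: l'); split.
  + split=> // q /l'q[->//|[q' q'l <-]]; exact: pl.
  + by rewrite !term_total_cons l'E addrCA.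
  + move=> q; rewrite inE => /predU1P[->|/l'q[->|[q' q'l <-]]]; [right|by left|right].
      by exists p; rewrite ?inE ?eqxx.
    by exists q'; rewrite // inE q'l orbT.
- exists ((c, d) :: p :: l); split.
  + split=> // q; rewrite inE => /predU1P[->//|/pl]; move=> /lt_trans; exact.
  + by rewrite term_total_cons.
  + by move=> q; rewrite inE => /predU1P[->|ql]; [left|right; exists q].
- have [cp0|cp0] := eqVneq (c + p.1) 0.
    exists l; split=> //.
      by rewrite term_total_cons addrA dp -mulrDl cp0 mul0r add0r.
    by move=> q ql; right; exists q; rewrite // inE ql orbT.
  exists ((c + p.1, d) :: l); split.
  + by split=> //=; [exact: (subfieldD sE)|rewrite dp].
  + by rewrite !term_total_cons addrA dp -mulrDl.
  + move=> q; rewrite inE => /predU1P[->|ql]; [by left|right].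
    by exists q; rewrite // inE ql orbT.
Qed.

Lemma monomial_sums0 : P 0.
Proof. by exists [::]; rewrite ?/term_total ?big_nil. Qed.

Lemma monomial_sums_term c d s : E c -> D d -> P s -> P (c * d + s).
Proof.
by move=> Ec Dd [l nl ->]; have [l' [nl' <- _]] := add_term Ec Dd nl; exists l'.
Qed.

Lemma monomial_sums_ind (Q : M -> Prop) : Q 0 ->
  (forall c d s, E c -> c != 0 -> D d -> P s -> Q s -> Q (c * d + s)) ->
  forall s, P s -> Q s.
Proof.
move=> Q0 QS s [l + ->]; elim: l => [_|p l IHl [Ep p0 Dp _ nl]].
  by rewrite /term_total big_nil.
by rewrite term_total_cons; apply: QS => //; [exists l|apply: IHl].
Qed.

Lemma monomial_sumsD s s' : P s -> P s' -> P (s + s').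
Proof.
move=> + Ps'; elim/monomial_sums_ind => [|c d {}s Ec c0 Dd Ps IHs]; first by rewrite add0r.
by rewrite -addrA; apply: monomial_sums_term.
Qed.

Lemma monomial_sumsMterm c d s : E c -> D d -> P s -> P (c * d * s).
Proof.
move=> Ec Dd; elim/monomial_sums_ind => [|c' d' {}s Ec' c0' Dd' Ps IHs].
  by rewrite mulr0; apply: monomial_sums0.
rewrite mulrDr mulrACA; apply: monomial_sums_term => //; first exact: (subfieldM sE).
exact: (pos_subgroupM gD).
Qed.

Lemma monomial_sumsM s s' : P s -> P s' -> P (s * s').
Proof.
move=> + Ps'; elim/monomial_sums_ind => [|c d {}s Ec c0 Dd Ps IHs].
  by rewrite mul0r; apply: monomial_sums0.
by rewrite mulrDl; apply: monomial_sumsD => //; apply: monomial_sumsMterm.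
Qed.

Lemma monomial_sums_field c : E c -> P c.
Proof.
move=> Ec; rewrite -[c]mulr1 -[c * 1]addr0; apply: monomial_sums_term => //.
  exact: (pos_subgroup1 gD).
exact: monomial_sums0.
Qed.

Lemma monomial_sumsN s : P s -> P (- s).
Proof.
move=> Ps; rewrite -mulN1r; apply: monomial_sumsM => //; apply: monomial_sums_field.
exact: (subfieldN sE (subfield1 sE)).
Qed.

Lemma monomial_sums_sub_field s : P s -> field_of Z s.
Proof.
have sZ := field_of_subfield Z.
elim/monomial_sums_ind => [|c d {}s Ec c0 Dd Ps IHs]; first exact: (subfield0 sZ).
apply: (subfieldD sZ) => //; apply: (subfieldM sZ).
  exact: (field_of_mono product_group_l Ec).
by apply: field_of_subset; apply: product_group_r.
Qed.

(** The quotients of the other terms by the first one are infinitesimal, because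
    the values of the [d] dominate those of the coefficients. *)
Lemma leading_term p l : normal_terms (p :: l) ->
  exists2 eta, infinitesimal B eta & term_total (p :: l) = p.1 * p.2 * (1 + eta).
Proof.
move=> [Ep p0 Dp pl nl]; have pp0 : p.1 * p.2 != 0 by rewrite mulf_neq0 // D_neq0.
exists (term_total l / (p.1 * p.2)).
  rewrite /term_total mulr_suml big_seq; apply: (infinitesimal_sum cB) => q ql.
  have [Eq q0 Dq] := normal_terms_mem nl ql.
  rewrite invfM mulrACA; apply: (infinitesimalMl cB).
    by apply: E_bounded; apply: (subfield_div sE).
  apply: D_infinitesimal; first exact: (pos_subgroup_div gD).
  by rewrite ltr_pdivrMr ?mul1r ?pl // (pos_subgroup_gt0 gD).
by rewrite term_total_cons mulrDr mulr1 mulrC (mulrC _ (_ / _)) divfK // mulrC.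
Qed.

(** The closure of the finite sums in the topology of the powers of [t]. *)
Definition approximable : set M :=
  [set h | field_of Z h /\ forall N, exists2 s, P s & B ((h - s) / t ^+ N)].
Local Notation A := approximable.

Lemma tX_neq0 N : t ^+ N != 0. Proof. by rewrite expf_neq0 // D_neq0. Qed.

Lemma approximable_limit h : field_of Z h ->
  (forall N, exists2 h', A h' & B ((h - h') / t ^+ N)) -> A h.
Proof.
move=> Zh hA; split=> // N; have [h' [_ h'P] hh'] := hA N; have [s Ps h's] := h'P N.
exists s => //; rewrite -(subrKA h') mulrDl; exact: (cringD cB).
Qed.

Lemma approximable_sums s : P s -> A s.
Proof.
move=> Ps; split; first exact: monomial_sums_sub_field.
by move=> N; exists s => //; rewrite subrr mul0r; apply: (cring0 cB).
Qed.

Lemma approximableB h h' : A h -> A h' -> A (h - h').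
Proof.
move=> [Zh hP] [Zh' hP']; split; first exact: (subfieldB (field_of_subfield _)).
move=> N; have [s Ps hs] := hP N; have [s' Ps' hs'] := hP' N.
exists (s - s'); first by apply: monomial_sumsD => //; apply: monomial_sumsN.
have -> : h - h' - (s - s') = (h - s) - (h' - s') by ring.
by rewrite mulrBl; apply: (convex_ringB cB).
Qed.

Lemma monomial_sums_bounded s : P s -> exists N, B (s * t ^+ N).
Proof.
elim/monomial_sums_ind => [|c d {}s Ec c0 Dd Ps [N sN]].
  by exists 0%N; rewrite mul0r; apply: (cring0 cB).
have [N' tN'] := D_archimedean Dt (pos_subgroupV gD Dd) t1.
have tb n : B (t ^+ n).
  by apply: D_bounded; [exact: (pos_subgroupX gD)|rewrite exprn_ile1 // ltW].
exists (N + N')%N; rewrite mulrDl exprD; apply: (cringD cB); last first.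
  by rewrite mulrA; apply: (convex_ringM cB).
rewrite mulrAC -!mulrA; apply: (convex_ringM cB); first exact: E_bounded.
apply: (convex_ringM cB) => //; apply: D_bounded.
  by apply: pos_subgroupM => //; apply: (pos_subgroupX gD).
rewrite -ler_pdivlMr ?div1r //; exact: pos_subgroup_gt0 Dd.
Qed.

Lemma approximable_bounded h : A h -> exists N, B (h * t ^+ N).
Proof.
move=> [_ /(_ 0%N)[s Ps]]; rewrite expr0 divr1 => hs.
have [N sN] := monomial_sums_bounded Ps; exists N; rewrite -(subrK s h) mulrDl.
apply: (cringD cB) => //; apply: (convex_ringM cB) => //; apply: D_bounded.
  exact: (pos_subgroupX gD).
by rewrite exprn_ile1 // ltW.
Qed.

Lemma approximableM h h' : A h -> A h' -> A (h * h').
Proof.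
move=> Ah Ah'; have [Zh hP] := Ah; have [Zh' hP'] := Ah'.
split; first exact: (subfieldM (field_of_subfield _)).
move=> N; have [N1 hN1] := approximable_bounded Ah.
have [s' Ps' hs'] := hP' (N1 + N)%N.
have [N2 sN2] := monomial_sums_bounded Ps'.
have [s Ps hs] := hP (N2 + N)%N.
exists (s * s'); first exact: monomial_sumsM.
have -> : (h * h' - s * s') / t ^+ N =
  h * t ^+ N1 * ((h' - s') / t ^+ (N1 + N)) + s' * t ^+ N2 * ((h - s) / t ^+ (N2 + N)).
  by rewrite !exprD; field; rewrite !tX_neq0.
by apply: (cringD cB); apply: (convex_ringM cB).
Qed.

Lemma approximable_term c d : E c -> D d -> A (c * d).
Proof.
move=> Ec Dd; apply: approximable_sums; rewrite -[c * d]addr0.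
by apply: monomial_sums_term => //; apply: monomial_sums0.
Qed.

Lemma approximable_field c : E c -> A c.
Proof. by move=> Ec; apply/approximable_sums/monomial_sums_field. Qed.

Lemma approximable1 : A 1.
Proof. by apply: approximable_field; apply: (subfield1 sE). Qed.

Lemma approximable0 : A 0.
Proof. by apply: approximable_field; apply: (subfield0 sE). Qed.

Lemma approximableN h : A h -> A (- h).
Proof. by move=> Ah; rewrite -sub0r; apply: approximableB => //; apply: approximable0. Qed.

Lemma approximableD h h' : A h -> A h' -> A (h + h').
Proof. by move=> Ah Ah'; rewrite -[h']opprK; apply/approximableB/approximableN. Qed.

Lemma approximableX h n : A h -> A (h ^+ n).
Proof.
move=> Ah; elim: n => [|n IHn]; first exact: approximable1.
by rewrite exprS; apply: approximableM.
Qed.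

Lemma approximable_sum (I : Type) (r : seq I) (Q : pred I) (f : I -> M) :
  (forall i, Q i -> A (f i)) -> A (\sum_(i <- r | Q i) f i).
Proof.
by move=> fA; elim/big_rec: _ => [|i a Qi Aa]; [exact: approximable0|apply: approximableD; [exact: fA|]].
Qed.

(** Infinitesimals of [D] have arbitrarily small powers, so they tend to [0]
    geometrically. *)
Definition small e : Prop := exists d, [/\ D d, d < 1 & B (e / d)].

Lemma small_powers e N : small e -> exists n, B (e ^+ n / t ^+ N).
Proof.
move=> [d [Dd d1 ed]]; have [n dn] := D_archimedean Dd (pos_subgroupX gD N Dt) d1.
exists n; have -> : e ^+ n / t ^+ N = (e / d) ^+ n * (d ^+ n / t ^+ N).
  by rewrite expr_div_n mulrA divfK // expf_neq0 // D_neq0.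
apply: (convex_ringM cB); first exact: cringX.
apply: D_bounded; first by apply: (pos_subgroup_div gD); apply: (pos_subgroupX gD).
by rewrite ler_pdivrMr ?mul1r // exprn_gt0.
Qed.

(** Up to an error of the order of [t], the leading term of an approximation bounds
    [e]; the monomial of this term is below [1] because [e] is infinitesimal. *)
Lemma approximable_small e : A e -> infinitesimal B e -> small e.
Proof.
move=> [_ /(_ 1%N)[s1 [l + ->]]] + ie; rewrite expr1.
case: l => [_|p l nl]; first by rewrite /term_total big_nil subr0 => eB; exists t.
have [eta ieta sE'] := leading_term nl; rewrite {}sE'.
have [Ep p0 Dp _ _] := nl; have Bp := E_bounded Ep.
have ies : infinitesimal B t by apply: D_infinitesimal.
have Bp' : B p.1^-1 by apply: E_bounded; apply: (subfieldV sE).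
have [u0 uV] : 1 + eta != 0 /\ B (1 + eta)^-1.
  by apply: (infinitesimal_unitD cB) => //; rewrite ?oner_neq0 // invr1; apply: (convex_ring1 cB).
have u_b : B (1 + eta).
  by apply: (cringD cB); [exact: (convex_ring1 cB)|exact: infinitesimal_cring].
set s := _ * (1 + eta) => es.
have is_ : infinitesimal B s.
  have -> : s = e - (e - s) / t * t by rewrite divfK ?D_neq0 // subKr.
  by apply: (infinitesimalB cB) => //; apply: (infinitesimalMl cB).
have ip : infinitesimal B p.2.
  have -> : p.2 = s * ((1 + eta)^-1 * p.1^-1) by rewrite /s; field; rewrite u0 p0.
  by apply: (infinitesimalMr cB) => //; apply: (convex_ringM cB).
have p1 : p.2 < 1.
  by have := infinitesimal_lt1 cB ip; rewrite gtr0_norm // (pos_subgroup_gt0 gD).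
have sp : B (s / p.2).
  have -> : s / p.2 = p.1 * (1 + eta) by rewrite /s; field; rewrite D_neq0.
  exact: (convex_ringM cB).
have B_div d d' : D d -> D d' -> d <= d' -> B (d / d').
  move=> Dd Dd' dd'; apply: D_bounded; first exact: (pos_subgroup_div gD).
  by rewrite ler_pdivrMr ?mul1r // (pos_subgroup_gt0 gD).
have tr a d d' : D d -> D d' -> d <= d' -> B (a / d) -> B (a / d').
  move=> Dd Dd' dd' ad; have -> : a / d' = a / d * (d / d').
    by rewrite mulrA divfK // D_neq0.
  by apply: (convex_ringM cB) => //; apply: B_div.
have [pt|/ltW tp] := lerP p.2 t.
  exists t; split=> //; rewrite -(subrK s e) mulrDl; apply: (cringD cB) => //.
  exact: tr sp.
exists p.2; split=> //; rewrite -(subrK s e) mulrDl; apply: (cringD cB) => //.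
exact: (tr _ t).
Qed.

(** An approximation of [h] that is finer than the value of [h] has the same
    leading term. Such an approximation exists because the value of [h] is bounded
    by the values of [Z]. *)
Lemma approximable_leading h : A h -> h != 0 ->
  exists c d e, [/\ E c, c != 0, D d, A e & infinitesimal B e /\ h = c * d * (1 + e)].
Proof.
move=> Ah h0; have [Zh hP] := Ah.
have [_ [n [z [[y [d [Yy Dd ->]]] hz]]]] :=
  field_of_unit product_group_subgroup product_group_monomial Zh h0.
have [N tN] := D_archimedean Dt (pos_subgroupV gD Dd) t1.
have hN : B (h^-1 * t ^+ N).
  apply: (convex_ring_le cB (b := n%:R * y)).
    by apply: (convex_ringM cB); [exact: cring_nat|exact: bounded_by_self].
  have y0 := pos_subgroup_gt0 gY Yy; have d0 := pos_subgroup_gt0 gD Dd.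
  rewrite normrM (ger0_norm (exprn_ge0 N (ltW t0))) (ger0_norm (mulr_ge0 _ (ltW y0))) //.
  apply: le_trans (ler_wpM2r (exprn_ge0 N (ltW t0)) hz) _.
  rewrite -!mulrA ler_wpM2l // ler_piMr ?(ltW y0) // mulrC.
  by rewrite -ler_pdivlMr // div1r.
have [s [l + ->]] := hP N.+1; case: l => [_|p l nl].
  rewrite /term_total big_nil subr0 => hB; exfalso; apply: (infinitesimal1 cB).
  have -> : 1 = h^-1 * t ^+ N * (h / t ^+ N.+1) * t.
    by rewrite exprS; field; rewrite h0 tX_neq0 D_neq0.
  apply: (infinitesimalMl cB); last exact: D_infinitesimal.
  exact: (convex_ringM cB).
have [eta ieta ->] := leading_term nl; have [Ep p0 Dp _ _] := nl.
set s0 := p.1 * p.2; have s00 : s0 != 0 by rewrite mulf_neq0 // D_neq0.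
move=> hs; exists p.1, p.2, (h / s0 - 1); split=> //.
  apply: approximableB; last exact: approximable1.
  apply: approximableM => //; rewrite invfM; apply: approximable_term.
    exact: (subfieldV sE).
  exact: (pos_subgroupV gD).
(* the error of the approximation is small compared with [h], hence with [s0] *)
pose k := (h - s0 * (1 + eta)) / h.
have ik : infinitesimal B k.
  have -> : k = (h - s0 * (1 + eta)) / t ^+ N.+1 * (h^-1 * t ^+ N) * t.
    by rewrite /k exprS; field; rewrite h0 tX_neq0 D_neq0.
  apply: (infinitesimalMl cB); last exact: D_infinitesimal.
  exact: (convex_ringM cB).
have [u0 uV] : 1 - k != 0 /\ B (1 - k)^-1.
  apply: (infinitesimal_unitD cB) => //; rewrite ?oner_neq0 // ?invr1; first exact: (convex_ring1 cB).
  exact: (infinitesimalN cB).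
have e1 : h / s0 * (1 - k) = 1 + eta by rewrite /k; field; rewrite h0 s00.
split; last by rewrite addrC subrK mulrC divfK.
have -> : h / s0 - 1 = (eta + k) * (1 - k)^-1.
  by apply: (mulIf u0); rewrite divfK // mulrBl e1; ring.
by apply: (infinitesimalMr cB) => //; apply: (infinitesimalD cB).
Qed.

(** The partial sums of the geometric series converge to the inverse. *)
Lemma approximable_geometric e : A e -> infinitesimal B e -> A (1 + e)^-1.
Proof.
move=> Ae ie; have [Ze _] := Ae; have sZ := field_of_subfield Z.
have [u0 uV] : 1 + e != 0 /\ B (1 + e)^-1.
  by apply: (infinitesimal_unitD cB) => //; rewrite ?oner_neq0 // ?invr1; exact: (convex_ring1 cB).
apply: approximable_limit; first exact: (subfieldV sZ (subfieldD sZ (subfield1 sZ) Ze)).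
move=> N; have [n en] := small_powers N (approximable_small Ae ie).
exists (\sum_(i < n) (- e) ^+ i).
  by apply: approximable_sum => i _; apply/approximableX/approximableN.
have -> : (1 + e)^-1 - \sum_(i < n) (- e) ^+ i = (- e) ^+ n * (1 + e)^-1.
  apply: (mulfI u0); rewrite mulrBr divff // mulrCA divff // mulr1.
  have -> : (1 + e) = - (- e - 1) by rewrite opprB opprK.
  by rewrite mulNr -subrX1 opprB; ring.
rewrite mulrAC; apply: (convex_ringM cB) => //.
rewrite exprNn -mulrA; apply: (convex_ringM cB) => //.
by apply: cringX => //; apply: cringN => //; exact: (convex_ring1 cB).
Qed.

Lemma approximableV h : A h -> A h^-1.
Proof.
have [->|h0] := eqVneq h 0; first by rewrite invr0.
move=> /approximable_leading/(_ h0)[c [d [e [Ec c0 Dd Ae [ie ->]]]]].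
rewrite !invfM; apply: approximableM; last exact: approximable_geometric.
by apply: approximable_term; [exact: (subfieldV sE)|exact: (pos_subgroupV gD)].
Qed.

Lemma approximable_subfield : is_subfield A.
Proof.
split; last exact: approximableV.
by split; [exact: approximable1|exact: approximableB|exact: approximableM].
Qed.

(** The residue is the coefficient of the leading term when its monomial is [1],
    and [0] when its monomial is infinitesimal. *)
Lemma approximable_residue h : A h -> B h ->
  exists2 c, E c & infinitesimal B (h - c).
Proof.
move=> Ah Bh; have [->|h0] := eqVneq h 0.
  by exists 0; [exact: (subfield0 sE)|rewrite subrr; exact: infinitesimal0].
have [c [d [e [Ec c0 Dd Ae [ie hE]]]]] := approximable_leading Ah h0.
have [u0 uV] : 1 + e != 0 /\ B (1 + e)^-1.
  by apply: (infinitesimal_unitD cB) => //; rewrite ?oner_neq0 // ?invr1; exact: (convex_ring1 cB).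
have u_b : B (1 + e).
  by apply: (cringD cB); [exact: (convex_ring1 cB)|exact: infinitesimal_cring].
have d0 := pos_subgroup_gt0 gD Dd.
have [d1|d1|d1] := ltgtP d 1.
- exists 0; first exact: (subfield0 sE).
  rewrite subr0 hE mulrAC; apply: (infinitesimalMl cB); last exact: D_infinitesimal.
  by apply: (convex_ringM cB) => //; apply: E_bounded.
- exfalso; have : infinitesimal B d^-1.
    by apply: D_infinitesimal; [exact: (pos_subgroupV gD)|rewrite invf_lt1].
  move=> /(_ _)/=; rewrite invr_eq0 (D_neq0 Dd) invrK => /(_ isT); apply.
  have -> : d = h * (c^-1 * (1 + e)^-1) by rewrite hE; field; rewrite u0 c0.
  apply: (convex_ringM cB) => //; apply: (convex_ringM cB) => //.
  by apply: E_bounded; apply: (subfieldV sE).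
- exists c => //; have -> : h - c = c * e by rewrite hE d1; ring.
  by apply: (infinitesimalMl cB) => //; apply: E_bounded.
Qed.

(** Hensel's lemma for approximable elements: a root of the residue polynomial
    over [R(Y)^hF] is an approximate root, and Newton's iteration from there
    converges to the root in [R(Z)^hF]. *)
Lemma approximable_hensel : hensel_property A.
Proof.
move=> p a pA pF Aa Fa pa p'a p'aV.
have cF := finite_convex_ring M; set Fin := @finite_ring M in cF pF Fa pa p'aV *.
have FB : Fin `<=` B := finite_ring_sub cB.
have ifin e : infinitesimal B e -> infinitesimal Fin e := infinitesimal_sub FB.
have fin_near e e' : Fin e -> infinitesimal Fin (e - e') -> Fin e'.
  move=> Fe ie; rewrite -(subKr e e'); apply: (convex_ringB cF) => //.
  exact: (infinitesimal_cring cF).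
have sA := approximable_subfield.
have [b [Zb rb ba]] : exists b, [/\ field_of Z b, root p b & infinitesimal Fin (b - a)].
  apply: field_of_hensel => //; first by move=> i; case: (pA i).
  by case: Aa.
exists b; split=> //.
have /choice[c Ec] : forall i, exists u, E u /\ infinitesimal B (p`_i - u).
  move=> i; by have [u Eu iu] := approximable_residue (pA i) (FB _ (pF i)); exists u.
have [a0 Ea0 ia0] := approximable_residue Aa (FB _ Fa).
have Fa0 : Fin a0 by apply: fin_near Fa (ifin _ ia0).
pose p0 := \poly_(i < size p) c i.
have p0E i : E p0`_i /\ infinitesimal B (p - p0)`_i.
  rewrite coefB coef_poly; case: ltnP => [_|ps]; first exact: Ec.
  by rewrite nth_default // subr0; split; [exact: (subfield0 sE)|exact: infinitesimal0].
have p0F : coefs_in Fin p0.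
  move=> i; apply: fin_near (pF i) _; rewrite -coefB.
  by case: (p0E i) => _ /ifin.
have infinitesimal_horner (C : set M) (q : {poly M}) z : convex_ring C ->
    (forall i, infinitesimal C q`_i) -> C z -> infinitesimal C q.[z].
  move=> cC iq Cz; rewrite horner_coef; apply: (infinitesimal_sum cC) => i _.
  by apply: (infinitesimalMr cC) => //; apply: cringX.
have infinitesimal_deriv (C : set M) (q : {poly M}) : convex_ring C ->
    (forall i, infinitesimal C q`_i) -> forall i, infinitesimal C q^`()`_i.
  move=> cC iq i; rewrite coef_deriv -mulr_natr; apply: (infinitesimalMr cC) => //.
  exact: cring_nat.
have hornerB (q q' : {poly M}) z : (q - q').[z] = q.[z] - q'.[z].
  by rewrite hornerD hornerN.
have idiff z : Fin z -> infinitesimal B (p - p0).[z].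
  by move=> Fz; apply: infinitesimal_horner => // [i|]; [case: (p0E i)|exact: FB].
have idiff' z : Fin z -> infinitesimal B (p - p0)^`().[z].
  move=> Fz; apply: infinitesimal_horner => //; last exact: FB.
  by apply: infinitesimal_deriv => // i; case: (p0E i).
have near_horner (q : {poly M}) z z' : coefs_in Fin q -> Fin z -> Fin z' ->
    infinitesimal Fin (z' - z) -> infinitesimal Fin (q.[z'] - q.[z]).
  move=> qF Fz Fz' izz'; have [u Fu ->] := horner_taylor1 cF qF Fz Fz'.
  by rewrite addrC addKr; apply: (infinitesimalMl cF).
have deriv_unit z : Fin z -> infinitesimal Fin (z - a) ->
    p^`().[z] != 0 /\ Fin (p^`().[z])^-1.
  move=> Fz iza; rewrite -(subrKC p^`().[a] p^`().[z]).
  apply: (infinitesimal_unitD cF) => //.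
  by apply: near_horner => //; apply: deriv_coefs_cring.
have ia0' : infinitesimal Fin (a0 - a) by rewrite -opprB; apply/(infinitesimalN cF)/ifin.
have [|||||||b0 [Eb0 rb0 b0a0]] := @field_of_hensel Y p0 a0.
- by move=> i; case: (p0E i).
- by [].
- by [].
- by [].
- have -> : p0.[a0] = p.[a] + (p.[a0] - p.[a]) - (p - p0).[a0] by rewrite hornerB; ring.
  apply: (infinitesimalB cF); last exact/ifin/idiff.
  by apply: (infinitesimalD cF) => //; apply: near_horner.
- have := deriv_unit _ Fa0 ia0'; move=> [u0 uV].
  have -> : p0^`().[a0] = p^`().[a0] - (p - p0)^`().[a0] by rewrite derivB hornerB; ring.
  by apply: (infinitesimal_unitD cF uV u0 _).1; apply/(infinitesimalN cF)/ifin/idiff'.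
- have := deriv_unit _ Fa0 ia0'; move=> [u0 uV].
  have -> : p0^`().[a0] = p^`().[a0] - (p - p0)^`().[a0] by rewrite derivB hornerB; ring.
  by apply: (infinitesimal_unitD cF uV u0 _).2; apply/(infinitesimalN cF)/ifin/idiff'.
have b0a : infinitesimal Fin (b0 - a).
  by rewrite -(subrKA a0); apply: (infinitesimalD cF).
have Fb : Fin b by apply: fin_near Fa _; rewrite -opprB; apply: infinitesimalN.
have Fb0 : Fin b0 by apply: fin_near Fa _; rewrite -opprB; apply: infinitesimalN.
have near_b z : infinitesimal Fin (z - a) -> infinitesimal Fin (b - z).
  by move=> iza; rewrite -(subrKA a) -[a - z]opprB; apply: (infinitesimalB cF).
have [d [Dd d1 bd]] : small (b - b0).
  have Ab0 := approximable_field Eb0.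
  have [d [Dd d1 pb0d]] : small p.[b0].
    apply: approximable_small; first exact: horner_subfield.
    have -> : p.[b0] = (p - p0).[b0] by rewrite hornerB (rootP rb0) subr0.
    exact: idiff.
  exists d; split=> //; have [q Fq] := horner_taylor2 cF pF Fb0 Fb.
  rewrite (rootP rb) => e0; have [u0 uV] := deriv_unit _ Fb0 b0a.
  have [v0 vV] : p^`().[b0] + q * (b - b0) != 0 /\ Fin (p^`().[b0] + q * (b - b0))^-1.
    by apply: (infinitesimal_unitD cF) => //; apply: (infinitesimalMl cF) => //; apply: near_b.
  have vb : (p^`().[b0] + q * (b - b0)) * (b - b0) = - p.[b0].
    by apply/eqP; rewrite -subr_eq0 opprK; apply/eqP; rewrite [RHS]e0; ring.
  have -> : (b - b0) / d = - (p^`().[b0] + q * (b - b0))^-1 * (p.[b0] / d).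
    by rewrite -[b - b0 in LHS](mulKf v0) vb mulrN !mulNr mulrA.
  by apply: (convex_ringM cB) => //; apply: (cringN cB); apply: FB.
have newton n : exists z, [/\ A z, Fin z, infinitesimal Fin (z - a) & B ((b - z) / d ^+ n.+1)].
  elim: n => [|n [z [Az Fz iza bz]]].
    by exists b0; split=> //; exact: approximable_field.
  have [u0 uV] := deriv_unit _ Fz iza.
  have [q Fq] := horner_taylor2 cF pF Fz Fb; rewrite (rootP rb) => e0.
  pose z' := z - p.[z] / p^`().[z].
  have bz' : b - z' = - (q * (b - z) ^+ 2) / p^`().[z].
    apply: (mulIf u0); rewrite divfK // /z' opprB addrCA addrC mulrDl divfK //.
    apply/eqP; rewrite -subr_eq0 opprK; apply/eqP; rewrite [RHS]e0.
    by move: p.[z] p^`().[z] => pz p'z; ring.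
  have ibz := near_b _ iza.
  have ibz' : infinitesimal Fin (b - z').
    rewrite bz'; apply: (infinitesimalMr cF) => //; apply: (infinitesimalN cF).
    by apply: (infinitesimalMl cF) => //; apply: infinitesimalX.
  exists z'; split.
  - apply: (subfieldB sA) => //; apply: (subfield_div sA); apply: horner_subfield => //.
    exact: deriv_coefs_subfield.
  - exact: fin_near Fb ibz'.
  - by rewrite -(subrKA b) -[z' - b]opprB addrC; apply: (infinitesimalB cF).
  - have -> : (b - z') / d ^+ n.+2 =
        - q / p^`().[z] * ((b - z) / d ^+ n.+1) ^+ 2 * d ^+ n.
      have := D_neq0 Dd => dn0.
      rewrite bz' !exprS; field; rewrite u0 dn0 expf_neq0 //.
    apply: (convex_ringM cB).
      apply: (convex_ringM cB); last exact: cringX.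
      by apply: (convex_ringM cB); [apply: (cringN cB)|]; apply: FB.
    apply: D_bounded; first exact: (pos_subgroupX gD).
    by rewrite exprn_ile1 ?ltW // (pos_subgroup_gt0 gD).
apply: approximable_limit => // N.
have [n dn] := D_archimedean Dd (pos_subgroupX gD N Dt) d1.
have [z [Az _ _ bz]] := newton n; exists z => //.
have dn0 : d ^+ n.+1 != 0 by rewrite expf_neq0 // D_neq0.
have -> : (b - z) / t ^+ N = (b - z) / d ^+ n.+1 * (d ^+ n.+1 / t ^+ N).
  by rewrite mulrA divfK.
apply: (convex_ringM cB) => //; apply: D_bounded.
  by apply: (pos_subgroup_div gD); exact: (pos_subgroupX gD).
rewrite ler_pdivrMr ?mul1r ?exprn_gt0 //; apply: le_trans dn.
by rewrite exprS ler_piMl ?exprn_ge0 ?ltW // (pos_subgroup_gt0 gD).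
Qed.

Lemma family_iter_deriv n (i : 'I_n) (p : power_series R n) (k : nat) :
  F p -> F (iter k (series_deriv i) p).
Proof. by move=> Fp; elim: k => // k; apply: (family_deriv F_admissible). Qed.

(** Taylor's formula in one variable after the other, at residues of the
    arguments. *)
Lemma approximable_family : closed_under_family F S A.
Proof.
move=> n f y Ff yA.
have [/existsP[i yi]|/existsPn y1] := boolP [exists i, 1 < `|y i|].
  by rewrite (an_fun_eq0 M_model f yi); exact: approximable0.
have {}y1 i : `|y i| <= 1 by rewrite leNgt.
suff H k : (k <= n)%N -> forall (f : an_series R n) (y : 'I_n -> M), F (f : power_series R n) ->
    (forall i, A (y i)) -> (forall i, `|y i| <= 1) ->
    (forall i : 'I_n, (k <= i)%N -> E (y i)) -> A (an_fun S f y).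
  by apply: (H n) => // i; rewrite leqNgt ltn_ord.
elim: k => [_|k IHk kn] {Ff yA y1}{}f {}y Ff yA y1 yE.
  by apply: approximable_field; apply: field_of_family => // i; apply: yE.
pose i := Ordinal kn.
have Byi : B (y i).
  by apply: (convex_ring_le cB (convex_ring1 cB)); rewrite normr1.
have [c Ec ic] := approximable_residue (yA i) Byi.
have c1 : `|c| <= 1.
  (* otherwise [|c| - 1] is positive, not infinitesimal, and below [|y i - c|] *)
  rewrite leNgt; apply/negP => c1.
  have Ec1 : E (`|c| - 1).
    by apply: (subfieldB sE); [exact: (subfield_norm sE)|exact: (subfield1 sE)].
  have c10 : `|c| - 1 != 0 by rewrite subr_eq0 gt_eqF.
  have ic1 : infinitesimal B (`|c| - 1).
    apply: (infinitesimal_le cB ic); rewrite (@ger0_norm _ (`|c| - 1)) ?subr_ge0 ?(ltW c1) //.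
    rewrite distrC; apply: le_trans (lerB_dist _ _).
    by rewrite lerD2l lerN2.
  by move/eqP: c10; apply; apply: (infinitesimal_inv_eq0 ic1); apply: E_bounded; exact: (subfieldV sE).
pose g (a : nat) : an_series R n :=
  AnSeries (family_converges F_admissible (family_iter_deriv i a Ff)).
pose y' := set_coord i c y.
have Ag (a : nat) : A (an_fun S (g a) y').
  apply: IHk => //; first exact: ltnW.
  - exact: (family_iter_deriv i a Ff).
  - by move=> j; rewrite /y' /set_coord; case: eqP => // _; exact: approximable_field.
  - by move=> j; rewrite /y' /set_coord; case: eqP.
  - move=> j kj; rewrite /y' /set_coord; case: eqP => // /eqP ji.
    by apply: yE; rewrite ltn_neqAle kj andbT eq_sym.
have Ayc : A (y i - c) by apply: approximableB => //; exact: approximable_field.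
have sA := approximable_subfield.
apply: approximable_limit.
  by apply: field_of_family => // j; case: (yA j).
move=> N; have [n' en'] := small_powers N (approximable_small Ayc ic).
have [C hC] := @an_fun_taylor _ _ _ M_model n i f g n' (fun _ => erefl).
have fac0 : n'`!%:R != 0 :> M by rewrite pnatr_eq0 -lt0n fact_gt0.
exists ((\sum_(a < n') ((y i - c) ^+ a * an_fun S (g a) y') *+ (n' ^_ (n' - a))) / n'`!%:R).
  apply: approximableM; last by apply: (subfieldV sA); apply: subfield_nat.
  apply: approximable_sum => a _; rewrite -mulr_natr; apply: approximableM.
    by apply: approximableM => //; exact: approximableX.
  exact: subfield_nat.
apply: (convex_ring_le cB (b := C%:R * ((y i - c) ^+ n' / t ^+ N))).
  by apply: (convex_ringM cB) => //; exact: cring_nat.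
rewrite mulrA !normrM ler_wpM2r // normr_nat normrX.
apply: le_trans (hC y c y1 c1); set h' := \sum_(_ < _) _.
have -> : an_fun S f y - h' / n'`!%:R = (an_fun S f y *+ n'`! - h') / n'`!%:R.
  by rewrite mulrBl -[an_fun S f y *+ _]mulr_natr mulfK.
rewrite normf_div normr_nat ler_pdivrMr ?ltr0n ?fact_gt0 // ler_peMr //.
by rewrite ler1n fact_gt0.
Qed.

(** The approximable elements have all closure properties that define [R(Z)^hF]. *)
Lemma approximableE : field_of Z `<=` A.
Proof.
apply: field_of_min.
- exact: approximable_subfield.
- by move=> _ [r _ <-]; apply: approximable_field; apply: field_of_real.
- move=> z [y [d [Yy Dd ->]]]; apply: approximable_term => //.
  exact: field_of_subset.
- exact: approximable_family.
- exact: approximable_hensel.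
Qed.

Lemma split_terms l : normal_terms l -> exists l' c e,
  [/\ normal_terms l', (forall p, p \in l' -> p \in l /\ 1 < p.2), E c, infinitesimal B e &
      term_total l = term_total l' + c + e].
Proof.
elim: l => [_|p l IHl [Ep p0 Dp pl nl]].
  exists [::], 0, 0; split; rewrite ?addr0 //; first exact: (subfield0 sE).
  exact: infinitesimal0.
have Dl q : q \in l -> [/\ E q.1, q.1 != 0 & D q.2] := normal_terms_mem nl.
have tail_small : p.2 <= 1 -> infinitesimal B (term_total l).
  move=> p1; rewrite /term_total big_seq; apply: (infinitesimal_sum cB) => q ql.
  have [Eq _ Dq] := Dl q ql; apply: (infinitesimalMl cB); first exact: E_bounded.
  by apply: D_infinitesimal => //; apply: lt_le_trans (pl q ql) p1.
have [p1|p1|p1] := ltgtP p.2 1.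
- exists [::], 0, (term_total (p :: l)); split=> //; first exact: (subfield0 sE).
    rewrite term_total_cons; apply: (infinitesimalD cB); last exact/tail_small/ltW.
    by apply: (infinitesimalMl cB); [exact: E_bounded|exact: D_infinitesimal].
  by rewrite /term_total big_nil !add0r.
- have [l' [c [e [nl' l'1 Ec ie lE]]]] := IHl nl.
  exists (p :: l'), c, e; split=> //.
  + by split=> // q /l'1[/pl].
  + move=> q; rewrite !inE => /predU1P[->|/l'1[ql q1]]; first by rewrite eqxx.
    by rewrite ql orbT.
  + by rewrite !term_total_cons lE !addrA.
- exists [::], p.1, (term_total l); split=> //; first by apply: tail_small; rewrite p1.
  by rewrite term_total_cons p1 mulr1 /term_total big_nil add0r.
Qed.

(** An approximation up to [t] is enough: its terms with monomials below [1] are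
    infinitesimal, and the term with monomial [1] lies in [R(Y)^hF]. *)
Lemma product_group_expansion h : field_of Z h -> exists l c,
  [/\ normal_terms l, (forall p, p \in l -> 1 < p.2), E c &
      infinitesimal B (h - (term_total l + c))].
Proof.
move=> /approximableE[_ /(_ 1%N)[s [l nl ->]]]; rewrite expr1 => hl.
have [l' [c [e [nl' l'1 Ec ie lE]]]] := split_terms nl.
exists l', c; split=> // [p /l'1[]//|]; have -> : h - (term_total l' + c) = (h - term_total l) / t * t + e.
  by rewrite divfK ?D_neq0 // lE; ring.
apply: (infinitesimalD cB) => //; apply: (infinitesimalMl cB) => //.
exact: D_infinitesimal.
Qed.
End Approximation.

(** * Chains of archimedean groups of monomials *)

Record archimedean_layer (D : set M) : Prop := ArchimedeanLayer {
  layer_subgroup : pos_subgroup D;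
  layer_monomial : D `<=` X;
  layer_archimedean : forall d e, D d -> D e -> d < 1 -> exists n, d ^+ n <= e;
  layer_nontrivial : exists2 t, D t & t < 1;
  layer_root : forall d n, (0 < n)%N -> D d -> exists2 w, D w & w ^+ n = d }.

Definition chain_group (Ds : seq (set M)) : set M :=
  foldr (fun D Y => product_group Y D) [set 1] Ds.

(** The layers are listed from the largest archimedean class to the smallest. *)
Fixpoint layer_chain (Ds : seq (set M)) : Prop :=
  if Ds is D :: Ds' then
    [/\ archimedean_layer D,
        (forall d, D d -> d < 1 -> infinitesimal (bounded_by (chain_group Ds')) d) &
        layer_chain Ds']
  else True.

Lemma chain_group_subgroup Ds : layer_chain Ds -> pos_subgroup (chain_group Ds).
Proof.
elim: Ds => [_|D Ds IHDs [lD _ cDs]]; first exact: pos_subgroup_one.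
by apply: product_group_subgroup; [exact: IHDs|exact: layer_subgroup].
Qed.

Lemma chain_group_monomial Ds : layer_chain Ds -> chain_group Ds `<=` X.
Proof.
elim: Ds => [_ _ ->|D Ds IHDs [lD _ cDs]]; first exact: (pos_subgroup1 monomial_subgroup).
by apply: product_group_monomial; [exact: IHDs|exact: layer_monomial].
Qed.

(** Otherwise [u] would have the value of [1], and monomials are determined by
    their values. *)
Lemma monomial_infinitesimal u : X u -> u < 1 -> infinitesimal (@finite_ring M) u.
Proof.
move=> Xu u1; apply: contrapT => /cringPn[u0 uV].
have [s [s1 s2 sM] XE] := monomial_section X_monomials.
have sK := LE_subfield; have cF := finite_convex_ring M.
have s_id z : X z -> s z = z.
  rewrite XE => -[a [Ka a0] <-]; have [Ksa sa0 sa] := s1 a Ka a0.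
  exact: s2.
have X1 := pos_subgroup1 monomial_subgroup.
have Fu : finite_ring u.
  apply: (convex_ring_le cF (convex_ring1 cF)).
  by rewrite normr1 gtr0_norm ?ltW // (pos_subgroup_gt0 monomial_subgroup).
suff : u = 1 by apply/eqP; rewrite lt_eqF.
rewrite -(s_id u Xu) -[RHS](s_id 1 X1); apply: s2; rewrite ?oner_neq0 //.
- exact: monomial_LE.
- exact: monomial_LE.
- rewrite natural_ringE //; split; rewrite val_leP ?oner_neq0 ?divr1 ?div1r //;
    exact: monomial_LE.
Qed.

(** The divisible hull, among the monomials, of the group generated by [D] and
    [u]. *)
Definition divisible_span (D : set M) u : set M :=
  [set w | X w /\ exists n z (k : int), [/\ (0 < n)%N, D z & w ^+ n = z * u ^ k]].

Section DivisibleSpan.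
Variables (D : set M) (u : M).
Hypotheses (gD : pos_subgroup D) (DX : D `<=` X) (Xu : X u).

Lemma divisible_span_monomial : divisible_span D u `<=` X.
Proof. by move=> w []. Qed.

Lemma divisible_span_sub : D `<=` divisible_span D u.
Proof.
move=> d Dd; split; first exact: DX.
by exists 1%N, d, 0; split; rewrite // expr0z mulr1.
Qed.

Lemma divisible_span_self : divisible_span D u u.
Proof.
split=> //; exists 1%N, 1, 1; split=> //; first exact: pos_subgroup1.
by rewrite expr1z mul1r.
Qed.

Lemma divisible_span_subgroup : pos_subgroup (divisible_span D u).
Proof.
have u0 := pos_subgroup_neq0 monomial_subgroup Xu.
apply: sub_monomial_subgroup; first exact: divisible_span_monomial.
  by apply: divisible_span_sub; apply: pos_subgroup1.
move=> w w' [Xw [n [z [k [n0 Dz wn]]]]] [Xw' [n' [z' [k' [n0' Dz' wn']]]]].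
split; first exact: (pos_subgroup_div monomial_subgroup).
exists (n * n')%N, (z ^+ n' / z' ^+ n), (k * n'%:Z - k' * n%:Z); split.
- by rewrite muln_gt0 n0.
- by apply: (pos_subgroup_div gD); apply: pos_subgroupX.
- rewrite expr_div_n exprM wn (mulnC n) exprM wn' !exprMn invfM mulrACA.
  by congr (_ * _); rewrite expfzDr // -invr_expz !exprnP !exprz_exp.
Qed.

Lemma divisible_span_root d n : (0 < n)%N -> divisible_span D u d ->
  exists2 w, divisible_span D u w & w ^+ n = d.
Proof.
move=> n0 [Xd [m [z [k [m0 Dz dm]]]]]; have [w Xw wn] := monomial_root n0 Xd.
exists w => //; split=> //; exists (n * m)%N, z, k; split=> //.
  by rewrite muln_gt0 n0.
by rewrite exprM wn.
Qed.
End DivisibleSpan.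

Lemma le1_root_ge w n a : 0 < w -> (0 < n)%N -> a <= 1 -> a <= w ^+ n -> a <= w.
Proof.
move=> w0 n0 a1 aw; have [w1|/ltW w1] := lerP 1 w; first exact: le_trans w1.
by apply: le_trans aw _; rewrite -[leRHS]expr1 ler_wiXn2l ?(ltW w0).
Qed.

Lemma infinitesimal_root (B : set M) w n a : convex_ring B -> 0 < w -> w ^+ n <= a ->
  infinitesimal B a -> infinitesimal B w.
Proof.
move=> cB w0 wa ia; apply: contrapT => /cringPn[_ wV].
have wn0 : 0 < w ^+ n by rewrite exprn_gt0.
have a0 : 0 < a by apply: lt_le_trans wa.
apply: ia; first by rewrite gt_eqF.
apply: (convex_ring_le cB (cringX cB n wV)).
by rewrite exprVn !normfV lef_pV2 ?posrE ?normr_gt0 ?gt_eqF // !gtr0_norm.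
Qed.

(** Every element below [1] of the span of [u] has a power below [u], and every
    element has a power above some power of [u]. *)
Lemma new_layer Y u : pos_subgroup Y -> X u -> u < 1 -> infinitesimal (bounded_by Y) u ->
  archimedean_layer (divisible_span [set 1] u) /\
  forall d, divisible_span [set 1] u d -> d < 1 -> infinitesimal (bounded_by Y) d.
Proof.
move=> gY Xu u1 iu; have gX := monomial_subgroup.
have u0 := pos_subgroup_gt0 gX Xu; have u_ge0 := ltW u0; have u_le1 := ltW u1.
have g1 := pos_subgroup_one M.
have X1 : [set 1] `<=` X by move=> _ ->; apply: pos_subgroup1.
have below d : divisible_span [set 1] u d -> d < 1 -> exists2 n, (0 < n)%N & d ^+ n <= u.
  move=> [Xd [n [_ [k [n0 -> dn]]]]] d1; exists n => //.
  rewrite mul1r in dn; have d0 := pos_subgroup_gt0 gX Xd.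
  have : d ^+ n < 1 by rewrite exprn_ilt1 ?(ltW d0) // -lt0n.
  rewrite dn; case: k {dn} => [[|k]|k].
  - by rewrite expr0z ltxx.
  - by move=> _; rewrite -exprnP exprS ler_piMr ?exprn_ile1.
  - rewrite NegzE -exprnN invf_lt1 ?exprn_gt0 // => /lt_geF.
    by rewrite exprn_ile1.
split; first split.
- exact: divisible_span_subgroup.
- exact: divisible_span_monomial.
- move=> d e Dd [Xe [n' [_ [k [n0' -> en]]]]] d1; have [n n0 dn] := below d Dd d1.
  have e0 := pos_subgroup_gt0 gX Xe; have d0 := pos_subgroup_gt0 gX Dd.1.
  exists (n * `|k|)%N; rewrite exprM; apply: le_trans (_ : u ^+ `|k| <= _).
    by apply: lerXn2r; rewrite ?nnegrE ?exprn_ge0 ?(ltW d0).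
  apply: (le1_root_ge e0 n0'); first by rewrite exprn_ile1.
  rewrite en mul1r; case: k {en} => [k|k]; first by rewrite -exprnP.
  rewrite NegzE -exprnN; apply: le_trans (_ : 1 <= _).
    by rewrite exprn_ile1.
  by rewrite invf_ge1 ?exprn_gt0 // exprn_ile1.
- by exists u => //; apply: divisible_span_self.
- by move=> d n; apply: divisible_span_root.
- move=> d Dd d1; have [n _ dn] := below d Dd d1.
  have d0 := pos_subgroup_gt0 gX Dd.1.
  by apply: infinitesimal_root dn iu => //; apply: bounded_by_convex_ring.
Qed.

(** When [D] is divisible, the value of [u] is then infinitely small compared with
    the values of [D], since the bounds hold for the powers of [u] too. *)
Definition below_layer (D : set M) u : Prop := forall d, D d -> d < 1 -> d < u /\ d < u^-1.

(** A power of an element of the span is a power of some [u / e] or of its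
    inverse, which some element of [D] keeps away from [1]. *)
Lemma extend_layer Y D u : pos_subgroup Y -> archimedean_layer D ->
  (forall d, D d -> d < 1 -> infinitesimal (bounded_by Y) d) ->
  X u -> u < 1 -> (exists2 d, D d & d <= u) ->
  ~ (exists2 e, D e & below_layer D (u / e)) ->
  archimedean_layer (divisible_span D u) /\
  forall d, divisible_span D u d -> d < 1 -> infinitesimal (bounded_by Y) d.
Proof.
move=> gY lD Dinf Xu u1 [d2 Dd2 d2u] noe; have gX := monomial_subgroup.
have gD := layer_subgroup lD; have DX := layer_monomial lD.
have u0 := pos_subgroup_gt0 gX Xu; have u_n0 := lt0r_neq0 u0.
have u_ge0 := ltW u0; have u_le1 := ltW u1.
have below d : divisible_span D u d -> d < 1 ->
    exists n e, [/\ D e, e < 1 & d ^+ n <= e].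
  move=> [Xd [n [z [k [n0 Dz dn]]]]] d1.
  have d0 := pos_subgroup_gt0 gX Xd.
  have dn1 : d ^+ n < 1 by rewrite exprn_ilt1 ?(ltW d0) // -lt0n.
  have [k0|k0] := eqVneq k 0.
    by exists n, z; split=> //; [rewrite k0 expr0z mulr1 in dn; rewrite -dn|rewrite dn k0 expr0z mulr1].
  have k_gt0 : (0 < `|k|)%N by rewrite absz_gt0.
  have [e De ek] := layer_root lD k_gt0 Dz.
  have e0 := pos_subgroup_gt0 gD De; have e_n0 := lt0r_neq0 e0.
  (* [d ^+ n] is the power of exponent [|k|] of [v] *)
  pose v := if 0 <= k then u / e^-1 else e / u.
  have v0 : 0 < v by rewrite /v; case: ifP => _; rewrite divr_gt0 ?invr_gt0.
  have dv : d ^+ n = v ^+ `|k|.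
    rewrite dn -ek /v; case: k k0 {k_gt0 dn ek v v0} => [k|k] k0 /=.
      by rewrite invrK exprMn mulrC.
    by rewrite NegzE -exprnN expr_div_n.
  have v1 : v < 1.
    by rewrite ltNge; apply/negP => v1; move: dn1; rewrite dv ltNge exprn_ege1.
  suff [f Df [f1 vf]] : exists2 f, D f & f < 1 /\ v <= f.
    exists n, f; split=> //; rewrite dv; case: `|k|%N k_gt0 => // j _.
    by rewrite exprS; apply: le_trans vf; rewrite ler_piMr ?(ltW v0) // exprn_ile1 ?(ltW v0) ?(ltW v1).
  have vV1 : 1 < v^-1 by rewrite invf_gt1.
  have [e' De' vE] : exists2 e', D e' & v = u / e' \/ v^-1 = u / e'.
    rewrite /v; case: ifP => _; first by exists e^-1; [exact: pos_subgroupV|left].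
    by exists e => //; right; rewrite invf_div.
  apply: contrapT => nof; apply: noe; exists e' => // f Df f1.
  have vf : f < v by rewrite ltNge; apply/negP => vf; apply: nof; exists f.
  have fv : f < v^-1 by apply: lt_trans vV1.
  by case: vE => <-; rewrite ?invrK.
split; first split.
- exact: divisible_span_subgroup.
- exact: divisible_span_monomial.
- move=> d e Dd [Xe [n' [z [k [n0' Dz en]]]]] d1; have [n [f [Df f1 dn]]] := below d Dd d1.
  have e0 := pos_subgroup_gt0 gX Xe; have d0 := pos_subgroup_gt0 gX Dd.1.
  have d20 := pos_subgroup_gt0 gD Dd2; have z0 := pos_subgroup_gt0 gD Dz.
  pose g := Num.min 1 (z * d2 ^+ `|k|).
  have Dg : D g.
    rewrite /g minEle; case: ifP => _; first exact: pos_subgroup1.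
    by apply: (pos_subgroupM gD) => //; exact: pos_subgroupX.
  have ge : g <= e.
    apply: (le1_root_ge e0 n0'); first by rewrite /g ge_min lexx.
    apply: le_trans (_ : z * d2 ^+ `|k| <= _); first by rewrite /g ge_min lexx orbT.
    rewrite en ler_wpM2l ?(ltW z0) //; case: k {en g Dg} => [k|k].
      by rewrite -exprnP /=; apply: lerXn2r; rewrite ?nnegrE ?(ltW d20).
    rewrite NegzE -exprnN; apply: le_trans (_ : 1 <= _).
      by rewrite exprn_ile1 ?(ltW d20) // (le_trans d2u).
    by rewrite invf_ge1 ?exprn_gt0 // exprn_ile1.
  have [m fm] := layer_archimedean lD Df Dg f1.
  exists (n * m)%N; rewrite exprM; apply: le_trans ge; apply: le_trans fm.
  by apply: lerXn2r; rewrite ?nnegrE ?exprn_ge0 ?(ltW d0) ?(ltW (pos_subgroup_gt0 gD Df)).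
- by have [t Dt t1] := layer_nontrivial lD; exists t => //; apply: divisible_span_sub.
- by move=> d n; apply: divisible_span_root.
- move=> d Dd d1; have [n [e [De e1 dn]]] := below d Dd d1.
  have d0 := pos_subgroup_gt0 gX Dd.1.
  by apply: infinitesimal_root dn (Dinf _ De e1) => //; apply: bounded_by_convex_ring.
Qed.

(** The last clause keeps the group inside the divisible hull; it serves to show
    that the new elements of the lower layers remain below the upper layers. *)
Definition chain_extends (Ds : seq (set M)) u (Ds' : seq (set M)) : Prop :=
  [/\ layer_chain Ds', chain_group Ds `<=` chain_group Ds', chain_group Ds' u &
      forall w, chain_group Ds' w -> exists n z (k : int),
        [/\ (0 < n)%N, chain_group Ds z & w ^+ n = z * u ^ k]].

(** If [u] is infinitesimal relative to the whole group then it starts a new layer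
    on top of the chain. Otherwise it is comparable with the top layer [D]; then
    it joins [D], unless some [u / e] with [e] in [D] falls below [D], and this
    quotient is inserted in the rest of the chain. *)
Lemma chain_insert_lt1 Ds u : layer_chain Ds -> X u -> u < 1 ->
  (forall D Ds', Ds = D :: Ds' ->
    forall v, X v -> exists Es, chain_extends Ds' v Es) ->
  exists Es, chain_extends Ds u Es.
Proof.
move=> cDs Xu u1 IH; have gX := monomial_subgroup.
have gDs := chain_group_subgroup cDs; have u0 := pos_subgroup_gt0 gX Xu.
have [iu|] := pselect (infinitesimal (bounded_by (chain_group Ds)) u).
  have [lU iU] := new_layer gDs Xu u1 iu.
  exists (divisible_span [set 1] u :: Ds); split=> //.
  - exact: product_group_l (layer_subgroup lU).
  - apply: product_group_r => //; exact: divisible_span_self (pos_subgroup_one M) _.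
  - move=> w [y [v [Yy [Xv [n [_ [k [n0 -> vn]]]]] ->]]].
    exists n, (y ^+ n), k; split=> //; first exact: pos_subgroupX.
    by rewrite exprMn vn mul1r.
case: Ds IH cDs gDs => [|D Ds] IH cDs gDs nu.
  by exfalso; apply: nu; exact: monomial_infinitesimal.
have [lD iD cDs'] := cDs; have gD := layer_subgroup lD.
have gDs' := chain_group_subgroup cDs'; set Y := chain_group Ds in gDs' iD *.
have [t Dt t1] := layer_nontrivial lD.
have t0 := pos_subgroup_gt0 gD Dt.
have cB := bounded_by_convex_ring gDs'.
have d2 : exists2 d, D d & d <= u.
  have [_ [n [z [[y [d [Yy Dd ->]]] uz]]]] := cringPn nu.
  (* the factor [t] makes up for the part [n * y] of the bound of [u^-1] *)
  exists (t / d); first exact: (pos_subgroup_div gD).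
  have d0 := pos_subgroup_gt0 gD Dd.
  have nyt : n%:R * y * t < 1.
    apply: le_lt_trans (ler_norm _) _; apply: (infinitesimal_lt1 cB).
    apply: (infinitesimalMl cB); last exact: iD.
    by apply: (convex_ringM cB); [exact: cring_nat|exact: bounded_by_self].
  rewrite ler_pdivrMr // mulrC -ler_pdivrMr //.
  apply: le_trans (_ : t * (n%:R * (y * d)) <= _).
    by rewrite ler_wpM2l ?(ltW t0) //; apply: le_trans uz; apply: ler_norm.
  rewrite (_ : _ * _ = n%:R * y * t * d); last by ring.
  by rewrite ler_piMl ?(ltW d0) ?(ltW nyt).
have [[e De ue]|noe] := pselect (exists2 e, D e & below_layer D (u / e)); last first.
  have [lU iU] := extend_layer gDs' lD iD Xu u1 d2 noe.
  exists (divisible_span D u :: Ds); split=> //.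
  - move=> _ [y [d [Yy Dd ->]]]; exists y, d; split=> //.
    by apply: divisible_span_sub => //; exact: layer_monomial.
  - apply: product_group_r => //; exact: divisible_span_self.
  - move=> w [y [v [Yy [Xv [n [z [k [n0 Dz vn]]]]] ->]]].
    exists n, (y ^+ n * z), k; split=> //; last by rewrite exprMn vn mulrA.
    by exists (y ^+ n), z; split=> //; apply: pos_subgroupX.
have Xe : X e by apply: layer_monomial De.
have Xue : X (u / e) by apply: (pos_subgroup_div gX).
have e0 := pos_subgroup_gt0 gD De.
have [Es [cEs sEs Eue EsP]] := IH D Ds erefl (u / e) Xue.
have gEs := chain_group_subgroup cEs.
exists (D :: Es); split.
- split=> // d Dd d1; apply: contrapT => /cringPn[d_n0 [m [w [Ew dmw]]]].
  have [n [z [k [n0 Yz wn]]]] := EsP w Ew.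
  have d0 := pos_subgroup_gt0 gD Dd; have w0 := pos_subgroup_gt0 gEs Ew.
  (* one factor [f] of [d ^+ n] is for [z], the other one for the power of [u / e] *)
  have [f Df f2] := layer_root lD (ltn0Sn 1) (pos_subgroupX gD n Dd).
  have f0 := pos_subgroup_gt0 gD Df.
  have f1 : f < 1.
    rewrite -(@ltr_pXn2r _ 2) ?nnegrE ?ltW // f2 expr1n.
    by rewrite exprn_ilt1 ?(ltW d0) // -lt0n.
  have fz : m%:R ^+ n * z * f < 1.
    apply: le_lt_trans (ler_norm _) _; apply: (infinitesimal_lt1 cB).
    apply: (infinitesimalMl cB); last exact: iD.
    apply: (convex_ringM cB); last exact: bounded_by_self.
    by rewrite -natrX; exact: cring_nat.
  have fu : f * (u / e) ^ k < 1.
    have [k0|k0] := eqVneq k 0; first by rewrite k0 expr0z mulr1.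
    have k_gt0 : (0 < `|k|)%N by rewrite absz_gt0.
    have [g Dg gk] := layer_root lD k_gt0 Df.
    have g0 := pos_subgroup_gt0 gD Dg.
    have g1 : g < 1.
      by rewrite ltNge; apply/negP => g1; move: f1; rewrite -gk ltNge exprn_ege1.
    have [gu gu'] := ue g Dg g1.
    have ue0 : 0 < u / e by rewrite divr_gt0.
    have gp : 0 <= g * (u / e) < 1.
      by rewrite mulr_ge0 ?(ltW g0) ?(ltW ue0) // -ltr_pdivlMr // div1r.
    have gm : 0 <= g * (u / e)^-1 < 1.
      by rewrite mulr_ge0 ?invr_ge0 ?(ltW g0) ?(ltW ue0) // ltr_pdivrMr // mul1r.
    rewrite -gk; case: k k0 k_gt0 {wn gk} => k k0 k_gt0; rewrite ?NegzE.
      by rewrite -exprnP -exprMn exprn_ilt1 -?lt0n //; case/andP: gp.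
    by rewrite -exprnN -exprVn -exprMn exprn_ilt1 //; case/andP: gm.
  have : (m%:R * w * d) ^+ n < 1.
    rewrite !exprMn wn -f2 expr2.
    have -> : m%:R ^+ n * (z * (u / e) ^ k) * (f * f) =
      (m%:R ^+ n * z * f) * (f * (u / e) ^ k) by ring.
    rewrite -[ltRHS]mul1r; apply: ltr_pM => //.
      rewrite !mulr_ge0 ?exprn_ge0 ?(ltW f0) //; exact/ltW/(pos_subgroup_gt0 gDs').
    by rewrite mulr_ge0 ?(ltW f0) ?exprz_ge0 ?divr_ge0 ?(ltW u0) ?(ltW e0).
  rewrite ltNge exprn_ege1 // -ler_pdivrMr // div1r.
  by apply: le_trans dmw; apply: ler_norm.
- by move=> _ [y [d [Yy Dd ->]]]; exists y, d; split=> //; apply: sEs.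
- by exists (u / e), e; split=> //; rewrite divfK // gt_eqF.
- move=> _ [y [d [Ey Dd ->]]]; have [n [z [k [n0 Yz yn]]]] := EsP y Ey.
  exists n, (z * (d ^+ n * (e ^ k)^-1)), k; split=> //.
    exists z, (d ^+ n * (e ^ k)^-1); split=> //; apply: (pos_subgroup_div gD).
      exact: (pos_subgroupX gD).
    exact: (pos_subgroupXz gD).
  rewrite exprMn yn expfzMl exprz_inv -invr_expz.
  by move: (u ^ k) ((e ^ k)^-1) (d ^+ n) => a b c; ring.
Qed.

Lemma chain_insert Ds u : layer_chain Ds -> X u -> exists Es, chain_extends Ds u Es.
Proof.
have gX := monomial_subgroup.
have any_monomial (Es : seq (set M)) : layer_chain Es ->
    (forall v, X v -> v < 1 -> exists Es', chain_extends Es v Es') ->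
    forall v, X v -> exists Es', chain_extends Es v Es'.
  move=> cEs lt1 v Xv; have v0 := pos_subgroup_gt0 gX Xv.
  have [v1|v1|->] := ltgtP v 1; first exact: lt1.
    have [|Es' [cEs' sEs' Ev P]] := lt1 v^-1 (pos_subgroupV gX Xv); first by rewrite invf_lt1.
    exists Es'; split=> //.
      by rewrite -[v]invrK; exact: (pos_subgroupV (chain_group_subgroup cEs')).
    move=> w /P[n [z [k [n0 Ez wn]]]]; exists n, z, (- k); split=> //.
    by rewrite wn exprz_inv.
  exists Es; split=> //; first exact: (pos_subgroup1 (chain_group_subgroup cEs)).
  by move=> w Ew; exists 1%N, w, 0; rewrite expr0z mulr1.
elim: Ds u => [|D Ds IHDs] u cDs; apply: any_monomial => // v Xv v1;
  apply: chain_insert_lt1 => // D' Ds' [_ <-] v' Xv'.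
by case: cDs => _ _ cDs; apply: IHDs.
Qed.

Lemma chain_of_monomials (l : seq M) : (forall u, u \in l -> X u) ->
  exists2 Ds, layer_chain Ds & [set` l] `<=` chain_group Ds.
Proof.
elim: l => [_|u l IHl lX]; first by exists [::].
have [v vl|Ds cDs lDs] := IHl; first by apply: lX; rewrite inE vl orbT.
have [Es [cEs sEs Eu _]] := chain_insert cDs (lX u (mem_head _ _)).
by exists Es => // v; rewrite /= inE => /predU1P[->//|/lDs/sEs].
Qed.

(** Each instance of the closure properties involves finitely many elements, so
    the union of the fields generated by finite sets of monomials has them too. *)
Lemma finitely_many_monomials h : field_of X h ->
  exists2 l : seq M, (forall u, u \in l -> X u) & field_of [set` l] h.
Proof.
pose U := [set h | exists2 l : seq M, (forall u, u \in l -> X u) & field_of [set` l] h].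
have mono (l l' : seq M) a : {subset l <= l'} -> field_of [set` l] a -> field_of [set` l'] a.
  by move=> ll'; apply: field_of_mono => u /=; apply: ll'.
have sE (l : seq M) := field_of_subfield [set` l].
have U2 a b : U a -> U b ->
    exists2 l : seq M, (forall u, u \in l -> X u) & field_of [set` l] a /\ field_of [set` l] b.
  move=> [l lX la] [l' lX' lb]; exists (l ++ l').
    by move=> u; rewrite mem_cat => /orP[/lX|/lX'].
  by split; [apply: mono la|apply: mono lb] => u ul; rewrite mem_cat ul ?orbT.
have Ufin (n : nat) (y : 'I_n -> M) : (forall i, U (y i)) ->
    exists2 l : seq M, (forall u, u \in l -> X u) & forall i, field_of [set` l] (y i).
  move=> yU; have /choice[l lP] : forall i, exists l : seq M,
      (forall u, u \in l -> X u) /\ field_of [set` l] (y i).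
    by move=> i; have [l lX ly] := yU i; exists l.
  exists (flatten [seq l i | i <- enum 'I_n]).
    by move=> u /flatten_mapP[i _]; case: (lP i) => lX _ /lX.
  move=> i; case: (lP i) => _; apply: mono => u ul.
  by apply/flatten_mapP; exists i => //; exact: mem_enum.
suff : field_of X `<=` U by apply.
apply: field_of_min.
- split; first split.
  + by exists [::] => //; exact: subfield1.
  + move=> a b Ua Ub; have [l lX [la lb]] := U2 a b Ua Ub; exists l => //.
    exact: (subfieldB (sE l)).
  + move=> a b Ua Ub; have [l lX [la lb]] := U2 a b Ua Ub; exists l => //.
    exact: (subfieldM (sE l)).
  + by move=> a [l lX la]; exists l => //; exact: (subfieldV (sE l)).
- by move=> _ [r _ <-]; exists [::] => //; exact: field_of_real.
- move=> u Xu; exists [:: u] => [v|]; first by rewrite inE => /eqP ->.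
  by apply: field_of_subset; rewrite /= inE.
- move=> n f y Ff /Ufin[l lX ly]; exists l => //; exact: field_of_family.
- move=> p a pU pF Ua Fa pa p'a p'aV.
  have [l lX lp] := Ufin _ (fun i : 'I_(size p) => p`_i) (fun i => pU i).
  have [l' lX' [la' lp']] : exists2 l' : seq M, (forall u, u \in l' -> X u) &
      field_of [set` l'] a /\ {subset l <= l'}.
    case: Ua => l1 l1X la; exists (l1 ++ l).
      by move=> u; rewrite mem_cat => /orP[/l1X|/lX].
    split; last by move=> u ul; rewrite mem_cat ul orbT.
    by apply: mono la => u ul; rewrite mem_cat ul.
  have [|b [lb rb ba]] := @field_of_hensel [set` l'] p a _ pF la' Fa pa p'a p'aV.
    move=> i; have [ip|pi] := ltnP i (size p); last first.
      by rewrite nth_default //; exact: (subfield0 (sE l')).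
    by apply: mono lp' (lp (Ordinal ip)).
  by exists b; split=> //; exists l'.
Qed.

Lemma LE_chain h : K h -> exists2 Ds, layer_chain Ds & field_of (chain_group Ds) h.
Proof.
rewrite LE_field_of => /finitely_many_monomials[l /chain_of_monomials[Ds cDs lDs] lh].
by exists Ds => //; exact: field_of_mono lDs _ lh.
Qed.

(** * Existence of the decomposition *)

Fixpoint chain_terms (Ds : seq (set M)) (ls : seq (seq (M * M))) : Prop :=
  match Ds, ls with
  | [::], [::] => True
  | D :: Ds', l :: ls' => [/\ normal_terms (chain_group Ds') D l,
      (forall p, p \in l -> 1 < p.2) & chain_terms Ds' ls']
  | _, _ => False
  end.

(** Each layer contributes one block, and the part of the expansion without its
    monomials is expanded along the remaining layers. *)
Lemma chain_expansion Ds h : layer_chain Ds -> field_of (chain_group Ds) h ->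
  exists ls r hp, [/\ chain_terms Ds ls, K hp, infinitesimal (@finite_ring M) hp &
    h = \sum_(l <- ls) term_total l + iota r + hp].
Proof.
have sK := LE_subfield; have cF := finite_convex_ring M.
have Kiota r : K (iota r) by rewrite LE_field_of; exact: field_of_real.
elim: Ds h => [|D Ds IHDs] h cDs Dh.
  have Kh : K h by apply: field_of_LE Dh; exact: (@chain_group_monomial [::]).
  have [r hr] := standard_part (embeds_lt iota_embeds)
    (field_of_bounded (chain_group_subgroup cDs) (chain_group_monomial cDs) Dh).
  exists [::], r, (h - iota r); split=> //; first exact: (subfieldB sK Kh (Kiota r)).
  by rewrite big_nil add0r subrKC.
have [lD iD cDs'] := cDs; have [t Dt t1] := layer_nontrivial lD.
have gY := chain_group_subgroup cDs'; have YX := chain_group_monomial cDs'.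
have cB := bounded_by_convex_ring gY.
have [l [c [nl l1 Ec ie]]] := product_group_expansion gY YX (layer_subgroup lD)
  (layer_monomial lD) (layer_archimedean lD) iD Dt t1 Dh.
have [ls [r [hp [cls Khp ihp cE]]]] := IHDs c cDs' Ec.
have gDs := chain_group_subgroup cDs; have DsX := chain_group_monomial cDs.
exists (l :: ls), r, (hp + (h - (term_total l + c))); split=> //.
- apply: (subfieldD sK) => //; apply: (subfieldB sK).
    exact: (field_of_LE DsX Dh).
  apply: (subfieldD sK); last exact: (field_of_LE YX Ec).
  rewrite /term_total; apply: (subfield_sum sK) => p pl _.
  have [Ep _ Dp] := normal_terms_mem nl pl.
  apply: (subfieldM sK); first exact: (field_of_LE YX Ep).
  by apply: monomial_LE; apply: (layer_monomial lD).
- apply: (infinitesimalD cF) => //.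
  exact: infinitesimal_sub (finite_ring_sub cB) ie.
- rewrite big_cons; set s := \sum_(_ <- _) _ in cE *.
  have -> : term_total l + s + iota r + (hp + (h - (term_total l + c))) =
    h + (s + iota r + hp - c) by ring.
  by rewrite -cE subrr addr0.
Qed.

Lemma layer_chain_drop Ds i : layer_chain Ds -> layer_chain (drop i Ds).
Proof.
by elim: Ds i => [|D Ds IHDs] [|i] //= [_ _ /IHDs].
Qed.

Lemma chain_group_drop Ds i i' : layer_chain Ds -> (i <= i')%N ->
  chain_group (drop i' Ds) `<=` chain_group (drop i Ds).
Proof.
elim: Ds i i' => [|D Ds IHDs] i i'; first by move=> _ _ y.
case: i i' => [|i] [|i'] //=; first by move=> _ _ y.
  move=> [lD iD cDs] _; apply: subset_trans (IHDs 0%N i' cDs (leq0n _)) _.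
  by rewrite drop0; exact: (product_group_l (layer_subgroup lD)).
by move=> [_ _ cDs] ii'; apply: IHDs.
Qed.

Lemma chain_terms_size Ds ls : chain_terms Ds ls -> size ls = size Ds.
Proof. by elim: Ds ls => [|D Ds IHDs] [|l ls] //= [_ _ /IHDs ->]. Qed.

Lemma chain_terms_nth Ds ls i : chain_terms Ds ls -> (i < size Ds)%N ->
  normal_terms (chain_group (drop i.+1 Ds)) (nth set0 Ds i) (nth [::] ls i) /\
  forall p, p \in nth [::] ls i -> 1 < p.2.
Proof.
elim: Ds ls i => [|D Ds IHDs] [|l ls] //= [|i] [nl l1 cls] /=.
  by rewrite drop0.
by rewrite ltnS => /(IHDs _ _ cls).
Qed.

Lemma normal_terms_lt Y D l j j' : normal_terms Y D l -> (j < j' < size l)%N ->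
  (nth (0, 0) l j').2 < (nth (0, 0) l j).2.
Proof.
elim: l j j' => [|p l IHl] j j'; first by rewrite ltn0 andbF.
move=> [_ _ _ pl nl] /andP[]; case: j' => // j' + jl; case: j => [_|j jj'] /=.
  by apply: pl; apply: mem_nth.
by apply: IHl => //; rewrite -ltnS jj'.
Qed.

(** The valuation of a block has as its ring the elements bounded by the group of
    the layers after the one of the block. For the last layer this group is
    trivial and the valuation is the natural one. *)
Lemma chain_decomposition Ds h : layer_chain Ds -> (0 < size Ds)%N ->
  field_of (chain_group Ds) h ->
  exists (k : nat) (w : 'I_k.+1 -> set M) (m : 'I_k.+1 -> nat)
     (c d : forall i, 'I_(m i) -> M) (r : R) (hp : M),
     is_decomposition F S iota x X h w c d r hp.
Proof.
move=> cDs Ds0 /(chain_expansion cDs)[ls [r [hp [cls Khp ihp hE]]]].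
have sK := LE_subfield; have cF := finite_convex_ring M; have gX := monomial_subgroup.
have lsE := chain_terms_size cls.
case kE: (size Ds) Ds0 => [//|k] _.
pose Y (i : nat) := chain_group (drop i.+1 Ds).
pose D i := nth set0 Ds i.
have gY i : pos_subgroup (Y i) by apply: chain_group_subgroup; exact: layer_chain_drop.
have YX i : Y i `<=` X by apply: chain_group_monomial; exact: layer_chain_drop.
have cB i : convex_ring (bounded_by (Y i)) := bounded_by_convex_ring (gY i).
have FB i : @finite_ring M `<=` bounded_by (Y i) := finite_ring_sub (cB i).
have dropE (i : 'I_k.+1) : drop i Ds = D i :: drop i.+1 Ds.
  by apply: drop_nth; rewrite kE.
have lDi (i : 'I_k.+1) : archimedean_layer (D i) /\
    forall u, D i u -> u < 1 -> infinitesimal (bounded_by (Y i)) u.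
  by have := layer_chain_drop i cDs; rewrite dropE => -[].
have DY (i i' : nat) : (i < i')%N -> (i' < k.+1)%N -> D i' `<=` Y i.
  move=> ii' i'k u Du; apply: (chain_group_drop cDs ii').
  rewrite (dropE (Ordinal i'k)); apply: product_group_r => //.
  by apply: chain_group_subgroup; exact: layer_chain_drop.
pose p (i : nat) (j : nat) := nth (0, 0) (nth [::] ls i) j.
have pP (i : 'I_k.+1) (j : nat) : (j < size (nth [::] ls i))%N ->
    [/\ field_of (Y i) (p i j).1, (p i j).1 != 0, D i (p i j).2 & 1 < (p i j).2].
  move=> jm; have [|nl l1] := @chain_terms_nth Ds ls i cls; first by rewrite kE.
  have pl : p i j \in nth [::] ls i by apply: mem_nth.
  by have [? ? ?] := normal_terms_mem nl pl; split=> //; apply: l1.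
have p_lt (i : 'I_k.+1) j j' : (j < j' < size (nth [::] ls i))%N -> (p i j').2 < (p i j).2.
  have [|nl _] := @chain_terms_nth Ds ls i cls; first by rewrite kE.
  exact: normal_terms_lt nl.
pose T i j := (p i j).1 * (p i j).2.
have D0 (i : 'I_k.+1) u : D i u -> 0 < u.
  by case: (lDi i) => lD _; apply: (pos_subgroup_gt0 (layer_subgroup lD)).
have T0 (i : 'I_k.+1) j : (j < size (nth [::] ls i))%N -> T i j != 0.
  by move=> /pP[_ c0 Dd _]; rewrite mulf_neq0 // gt_eqF // (D0 i).
have KT (i : 'I_k.+1) j : (j < size (nth [::] ls i))%N -> K (T i j).
  move=> /pP[Ec _ Dd _]; apply: (subfieldM sK); first exact: (field_of_LE (YX i) Ec).
  by apply: monomial_LE; case: (lDi i) => lD _; exact: (layer_monomial lD).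
have TV (i : 'I_k.+1) j : (j < size (nth [::] ls i))%N ->
    infinitesimal (bounded_by (Y i)) (T i j)^-1.
  move=> /pP[Ec c0 Dd d1]; have [lD iD] := lDi i; rewrite invfM.
  apply: (infinitesimalMl (cB i)).
    by apply: (field_of_bounded (gY i) (YX i)); exact: (subfieldV (field_of_subfield _)).
  by apply: iD; [exact: (pos_subgroupV (layer_subgroup lD))|rewrite invf_lt1 // (D0 i)].
have T_lt (i : 'I_k.+1) j j' : (j < j' < size (nth [::] ls i))%N ->
    infinitesimal (bounded_by (Y i)) (T i j' / T i j).
  move=> jj'; have /andP[j_lt j'm] := jj'; have jm := ltn_trans j_lt j'm.
  have [Ec c0 Dd _] := pP i j jm; have [Ec' _ Dd' _] := pP i j' j'm.
  have [lD iD] := lDi i; rewrite /T invfM mulrACA; apply: (infinitesimalMl (cB i)).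
    by apply: (field_of_bounded (gY i) (YX i)); exact: (subfield_div (field_of_subfield _)).
  apply: iD; first exact: (pos_subgroup_div (layer_subgroup lD)).
  by rewrite ltr_pdivrMr ?mul1r ?p_lt // (D0 i).
have T_rest (i : 'I_k.+1) (i' : 'I_k.+1) j : (i < i')%N ->
    (j < size (nth [::] ls i'))%N -> field_of (Y i) (T i' j).
  move=> ii' /pP[Ec _ Dd _]; apply: (subfieldM (field_of_subfield _)).
    exact: (field_of_mono (chain_group_drop cDs (leqW ii' : (i.+1 <= i'.+1)%N)) Ec).
  by apply: field_of_subset; apply: DY Dd.
have ifin i u : infinitesimal (bounded_by (Y i)) u -> infinitesimal (@finite_ring M) u.
  exact: infinitesimal_sub.
have K1 := subfield1 sK.
exists k, (fun i : 'I_k.+1 => K `&` bounded_by (Y i)),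
  (fun i : 'I_k.+1 => size (nth [::] ls i)), (fun i j => (p i j).1), (fun i j => (p i j).2), r, hp.
have res (i : 'I_k.+1) : field_of (Y i) `<=` residue_field F S iota X (K `&` bounded_by (Y i)).
  apply: field_of_residue => // y Yy.
  by split; apply: bounded_by_self => //; exact: (pos_subgroupV (gY i)).
split.
- by move=> i; apply: convex_ring_trace.
- move=> i i' ii'; split.
    move=> u [Ku Yu]; split=> //; apply: bounded_by_sub Yu.
    by apply: chain_group_drop => //; exact: ltnW.
  have [lD iD] := lDi i'; have [t Dt t1] := layer_nontrivial lD.
  move=> /(_ t^-1) [|_].
    split; first by apply: (subfieldV sK); apply: monomial_LE; apply: (layer_monomial lD).
    by apply: bounded_by_self => //; apply: (pos_subgroupV (gY i)); apply: DY Dt.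
  by apply: iD => //; rewrite gt_eqF // (D0 i').
- by rewrite natural_ringE // /Y drop_oversize ?kE.
- by move=> i j; have [lD _] := lDi i; apply: (layer_monomial lD); case: (pP i j (ltn_ord j)).
- by move=> i j; apply: res; case: (pP i j (ltn_ord j)).
- by split=> //; rewrite natural_ringE // val_ltP ?oner_neq0 ?divr1.
- rewrite hE; congr (_ + _ + _).
  rewrite (big_nth [::]) big_mkord lsE kE; apply: eq_bigr => i _.
  by rewrite /term_total (big_nth (0, 0)) big_mkord.
- move=> i j j' jj'; rewrite natural_ringE // val_ltP //; try exact: KT; last exact: T0.
  by apply: (ifin i); apply: T_lt; rewrite jj' ltn_ord.
- move=> i i' j j' ii'; rewrite natural_ringE // val_ltP //; try exact: KT; last exact: T0.
  apply: (ifin i); apply: (infinitesimalMl (cB i)); last exact: TV.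
  by apply: (field_of_bounded (gY i) (YX i)); exact: T_rest.
- move=> i j j' jj'; rewrite val_ltP //; try exact: KT; last exact: T0.
  by apply: T_lt; rewrite jj' ltn_ord.
- move=> i j; rewrite val_ltP ?div1r //; try exact: KT; last exact: T0.
  exact: TV.
- move=> i mon e f; have [lD iD] := lDi i; have gD := layer_subgroup lD.
  have Dmon g : D i (mon g).
    apply: (pos_subgroup_prod gD) => j _; apply: (pos_subgroupXz gD).
    by case: (pP i j (ltn_ord j)).
  have Kmon g : K (mon g) by apply: monomial_LE; apply: (layer_monomial lD).
  rewrite natural_ringE // !val_ltP ?oner_neq0 ?divr1 // => ie if_.
  have e1 : mon e < 1.
    by have := infinitesimal_lt1 cF ie; rewrite gtr0_norm // (D0 i).
  have [n en] := layer_archimedean lD (Dmon e) (Dmon f) e1.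
  exists n; rewrite val_leP //; [|exact: (subfieldX n sK (Kmon e))|by rewrite gt_eqF // (D0 i)].
  apply: (convex_ring_le cF (convex_ring1 cF)); rewrite normr1 normf_div.
  by rewrite !gtr0_norm ?exprn_gt0 ?(D0 i) // ler_pdivrMr ?mul1r // (D0 i).
- move=> i ik; apply: res; apply: subfield_sum; first exact: field_of_subfield.
  move=> i' _ ii'; apply: subfield_sum; first exact: field_of_subfield.
  by move=> j _ _; apply: T_rest.
Qed.

(** * Uniqueness of the decomposition *)

Lemma convex_ring_comparable (B B' : set M) : convex_ring B -> convex_ring B' ->
  B `<=` B' \/ B' `<=` B.
Proof.
move=> cB cB'; have [BB'|/existsNP[a /not_implyP[Ba nB'a]]] := pselect (B `<=` B').
  by left.
right=> b B'b; apply: (convex_ring_le cB Ba); rewrite leNgt; apply/negP => ab.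
by apply: nB'a; apply: (convex_ring_le cB' B'b); apply: ltW.
Qed.

Lemma residue_field_subfield (B : set M) :
  is_subfield (residue_field F S iota X (K `&` B)).
Proof. exact: hF_closure_subfield. Qed.

Lemma residue_field_ring (B : set M) : convex_ring B ->
  residue_field F S iota X (K `&` B) `<=` B.
Proof.
move=> cB a ka; have [->|a0] := eqVneq a 0; first exact: cring0.
by have [] := residue_field_unit cB ka a0.
Qed.

Lemma residue_field_LE (B : set M) : residue_field F S iota X (K `&` B) `<=` K.
Proof. by apply: field_of_LE => u []. Qed.

Lemma residue_field_mono (B B' : set M) : B `<=` B' ->
  residue_field F S iota X (K `&` B) `<=` residue_field F S iota X (K `&` B').
Proof.
move=> BB'; apply: field_of_mono => u [Xu [[v [Kv Bv] e] [v' [Kv' Bv'] e']]].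
by split=> //; split; [exists v|exists v'] => //; split=> //; apply: BB'.
Qed.

(** The list of pairs [(c, d)] of a block, with respect to the coarsening with
    ring [B]. *)
Fixpoint block_terms (B : set M) (ps : seq (M * M)) : Prop :=
  if ps is p :: l then
    [/\ residue_field F S iota X (K `&` B) p.1, X p.2,
        p.1 * p.2 != 0 /\ infinitesimal B (p.1 * p.2)^-1,
        (forall q, q \in l -> infinitesimal B (q.1 * q.2 / (p.1 * p.2))) &
        block_terms B l]
  else True.

(** What remains of the archimedean property of a block: coarsenings on which
    one of the monomials is infinite do not identify values of monomials. *)
Definition incompressible (ps : seq (M * M)) : Prop :=
  forall B, convex_ring B -> (exists2 p, p \in ps & ~ B p.2) ->
    (forall p, p \in ps -> infinitesimal (@finite_ring M) p.2^-1 -> infinitesimal B p.2^-1) /\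
    (forall p q, p \in ps -> q \in ps ->
      infinitesimal (@finite_ring M) (q.2 / p.2) -> infinitesimal B (q.2 / p.2)).

Lemma block_terms_mem B ps p : block_terms B ps -> p \in ps ->
  [/\ residue_field F S iota X (K `&` B) p.1, X p.2, p.1 * p.2 != 0 &
      infinitesimal B (p.1 * p.2)^-1].
Proof.
elim: ps => // q l IHl [kq Xq [q0 iq] _ bl]; rewrite inE => /predU1P[->//|]; exact: IHl.
Qed.

Section BlockTheory.
Variable B : set M.
Hypothesis cB : convex_ring B.

Lemma block_total_head p l eta : block_terms B (p :: l) -> B eta ->
  exists2 e, infinitesimal B e &
    term_total (p :: l) + eta = p.1 * p.2 * (1 + e).
Proof.
move=> [kp Xp [p0 ip] pl bl] Beta.
exists (term_total l / (p.1 * p.2) + eta / (p.1 * p.2)); last first.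
  by rewrite term_total_cons mulrDr mulr1 -mulrDl (mulrCA (p.1 * p.2)) divff ?mulr1 ?addrA.
apply: (infinitesimalD cB); last exact: (infinitesimalMl cB).
rewrite /term_total mulr_suml big_seq; apply: (infinitesimal_sum cB) => q ql.
exact: pl.
Qed.

Lemma unit1D e : infinitesimal B e -> [/\ 1 + e != 0, B (1 + e) & B (1 + e)^-1].
Proof.
move=> ie; have B1 := convex_ring1 cB.
have [||u0 uV] := @infinitesimal_unitD _ _ cB 1 e _ _ ie; rewrite ?invr1 ?oner_neq0 //.
by split=> //; apply: (cringD cB) => //; exact: (infinitesimal_cring cB).
Qed.

(** The sum has the same value as its leading term, which is infinite. *)
Lemma block_total_infinite p l eta : block_terms B (p :: l) -> B eta ->
  ~ B (term_total (p :: l) + eta).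
Proof.
move=> bp Beta; have [e ie ->] := block_total_head bp Beta.
have [u0 Bu uV] := unit1D ie; have [kp Xp [p0 ip] _ _] := bp => Bt.
apply: ip; first by rewrite invr_eq0.
by rewrite invrK -(mulfK u0 (p.1 * p.2)); apply: (convex_ringM cB).
Qed.

(** The leading terms have the same value; their difference is a monomial times
    an element of the residue field, which cannot be infinitesimal unless it
    vanishes. *)
Lemma block_terms_unique ps ps' eta eta' : block_terms B ps -> block_terms B ps' ->
  B eta -> B eta' -> term_total ps + eta = term_total ps' + eta' ->
  [seq p.1 * p.2 | p <- ps] = [seq p.1 * p.2 | p <- ps'].
Proof.
elim: ps ps' => [|p l IHl] [|p' l'] //= bp bp' Beta Beta' tE.
- exfalso; apply: (block_total_infinite bp' Beta').
  by rewrite -tE /term_total big_nil add0r.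
- exfalso; apply: (block_total_infinite bp Beta).
  by rewrite tE /term_total big_nil add0r.
have [e ie eE] := block_total_head bp Beta.
have [e' ie' eE'] := block_total_head bp' Beta'.
have [kp Xp [p0 ip] pl bl] := bp; have [kp' Xp' [p0' ip'] pl' bl'] := bp'.
set t := p.1 * p.2 in p0 ip eE *; set t' := p'.1 * p'.2 in p0' ip' eE' *.
have [u0 Bu uV] := unit1D ie; have [u0' Bu' uV'] := unit1D ie'.
have ttE : t * (1 + e) = t' * (1 + e') by rewrite -eE -eE' tE.
have rE : t' / t = (1 + e) / (1 + e').
  by apply: (mulIf u0'); apply: (mulIf p0); rewrite divfK // mulrAC divfK // -ttE mulrC.
have Br : B (t' / t) by rewrite rE; exact: (convex_ringM cB).
have BrV : B (t' / t)^-1 by rewrite rE invf_div; exact: (convex_ringM cB).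
have := p0; rewrite /t mulf_eq0 negb_or => /andP[c0 d0].
have := p0'; rewrite /t' mulf_eq0 negb_or => /andP[c0' d0'].
have [Bc cV] := residue_field_unit cB kp c0.
have [Bc' cV'] := residue_field_unit cB kp' c0'.
pose u := p'.2 / p.2; have Xu : X u by exact: (pos_subgroup_div monomial_subgroup).
have u_n0 : u != 0 by rewrite mulf_neq0 ?invr_eq0.
have uE : u = t' / t * (p.1 / p'.1).
  by rewrite /u /t /t'; field; rewrite c0 d0 c0'.
have ku : residue_field F S iota X (K `&` B) u.
  apply: field_of_subset; split=> //; have sK := LE_subfield.
  have K1 := subfield1 sK; have Ku : K u by apply: monomial_LE.
  split; rewrite val_leP ?oner_neq0 ?divr1 ?div1r //.
    by rewrite uE; do 2! apply: (convex_ringM cB) => //.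
  by rewrite uE invfM (invf_div p.1); do 2! apply: (convex_ringM cB) => //.
have tt' : t = t'.
  pose a := p.1 - p'.1 * u.
  have aE : t - t' = a * p.2 by rewrite /a /u /t /t'; field.
  have ka : residue_field F S iota X (K `&` B) a.
    by apply: (subfieldB (residue_field_subfield B)) => //; exact: (subfieldM (residue_field_subfield B)).
  suff a0 : a = 0 by apply/eqP; rewrite -subr_eq0 aE a0 mul0r.
  have [//|a0] := eqVneq a 0; have [_ aV] := residue_field_unit cB ka a0.
  apply: infinitesimal_inv_eq0 aV.
  have -> : a = p.1 * (t' / t * e' - e).
    apply: (mulIf d0); rewrite -aE mulrAC -/t.
    have -> : t - t' = t' * e' - t * e.
      apply/eqP; rewrite -subr_eq0; apply/eqP.
      have -> : t - t' - (t' * e' - t * e) = t * (1 + e) - t' * (1 + e') by ring.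
      by rewrite ttE subrr.
    by field.
  apply: (infinitesimalMl cB) => //; apply: (infinitesimalB cB) => //.
  exact: (infinitesimalMl cB).
congr (_ :: _); first exact: tt'; apply: (IHl l' bl bl' Beta Beta').
by move: tE; rewrite !term_total_cons -/t -/t' -tt' -!addrA => /addrI.
Qed.
End BlockTheory.

(** Coefficients are units for both valuations, so the values of the terms are
    those of the monomials, and these stay distinct. *)
Lemma block_terms_coarsen (B B' : set M) ps : convex_ring B -> convex_ring B' ->
  B `<=` B' -> block_terms B ps -> incompressible ps ->
  (exists2 p, p \in ps & ~ B' p.2) -> block_terms B' ps.
Proof.
move=> cB cB' BB' bps + big => /(_ B' cB' big)[h1 h2].
have FB := finite_ring_sub cB.
have unit_c p : p \in ps -> [/\ p.1 != 0, p.2 != 0, B p.1 & B p.1^-1].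
  move=> /(block_terms_mem bps)[kp _ p0 _].
  have := p0; rewrite mulf_eq0 negb_or => /andP[c0 d0].
  by have [] := residue_field_unit cB kp c0.
have {h1} h1 p : p \in ps -> infinitesimal B' (p.1 * p.2)^-1.
  move=> pps; have [c0 d0 Bc cV] := unit_c p pps.
  have [_ _ _ ip] := block_terms_mem bps pps.
  rewrite invfM; apply: (infinitesimalMl cB'); first exact: BB'.
  apply: h1 => //; apply: (infinitesimal_sub FB).
  have -> : p.2^-1 = p.1 * (p.1 * p.2)^-1 by field; rewrite c0 d0.
  exact: (infinitesimalMl cB).
have {h2} h2 p q : p \in ps -> q \in ps -> infinitesimal B (q.1 * q.2 / (p.1 * p.2)) ->
    infinitesimal B' (q.1 * q.2 / (p.1 * p.2)).
  move=> pps qps iqp; have [c0 d0 Bc cV] := unit_c p pps.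
  have [c0' d0' Bc' cV'] := unit_c q qps.
  rewrite invfM mulrACA; apply: (infinitesimalMl cB').
    by apply: BB'; apply: (convex_ringM cB).
  apply: h2 => //; apply: (infinitesimal_sub FB).
  have -> : q.2 / p.2 = p.1 / q.1 * (q.1 * q.2 / (p.1 * p.2)).
    by field; rewrite c0 d0 c0'.
  by apply: (infinitesimalMl cB) => //; exact: (convex_ringM cB).
suff gen l : block_terms B l -> {subset l <= ps} -> block_terms B' l by exact: gen.
elim: l => // p l IHl [kp Xp [p0 _] pl bl] lps.
have pps : p \in ps by apply: lps; exact: mem_head.
have lps' : {subset l <= ps} by move=> q ql; apply: lps; rewrite inE ql orbT.
split=> //; first exact: (residue_field_mono BB' kp).
- by split=> //; apply: h1.
- by move=> q ql; apply: h2 => //; [exact: lps'|exact: pl].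
- exact: IHl.
Qed.

(** A form of decompositions that allows for an induction on the blocks; [h1] is
    what remains of [h] after the first block. *)
Fixpoint block_decomposition h (bs : seq (seq M)) : Prop :=
  if bs is ts :: bs' then
    exists B ps h1, [/\ convex_ring B, block_terms B ps /\ incompressible ps,
      ts = [seq p.1 * p.2 | p <- ps] /\ ts != [::], h = term_total ps + h1 /\ B h1 &
      block_decomposition h1 bs']
  else exists r e, infinitesimal (@finite_ring M) e /\ h = iota r + e.

(** The coarser one of the valuations of two first blocks serves for both. *)
Lemma block_decomposition_unique h bs bs' :
  block_decomposition h bs -> block_decomposition h bs' -> bs = bs'.
Proof.
have cF := finite_convex_ring M.
have finite_no h' ts ws : block_decomposition h' [::] ->
    block_decomposition h' (ts :: ws) -> False.
  move=> [r [e [ie hE]]] [B [[|p l] [h1 [cB [bps _] [tsE ts0] [hE' Bh1] _]]]].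
    by rewrite tsE in ts0.
  apply: (block_total_infinite cB bps Bh1); rewrite -hE' hE.
  apply: (finite_ring_sub cB); apply: (cringD cF); last exact: (infinitesimal_cring cF).
  exact: finite_iota (embeds_lt iota_embeds) _.
have first_block B B' ps ps' h1 h1' : convex_ring B -> convex_ring B' -> B `<=` B' ->
    block_terms B ps -> incompressible ps -> block_terms B' ps' ->
    [seq p.1 * p.2 | p <- ps] != [::] -> [seq p.1 * p.2 | p <- ps'] != [::] ->
    B h1 -> B' h1' -> term_total ps + h1 = term_total ps' + h1' ->
    [seq p.1 * p.2 | p <- ps] = [seq p.1 * p.2 | p <- ps'].
  move=> cB cB' BB' bps ips bps' ps0 ps0' Bh1 Bh1' tE.
  apply: (block_terms_unique cB' _ bps' (BB' _ Bh1) Bh1' tE).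
  apply: (block_terms_coarsen cB cB' BB' bps ips).
  case: ps ps0 bps ips tE => // p l _ bps ips tE; exists p; first exact: mem_head.
  move=> B'p; case: ps' ps0' bps' tE => // p' l' _ bps' tE.
  apply: (block_total_infinite cB' bps' Bh1'); rewrite -tE.
  have [e ie ->] := block_total_head cB bps Bh1.
  have [_ Bu _] := unit1D cB ie; have [kp _ _ _ _] := bps.
  apply: (convex_ringM cB'); last exact: BB'.
  apply: (convex_ringM cB') => //; apply: BB'; exact: residue_field_ring kp.
elim: bs bs' h => [|ts bs IHbs] [|ts' bs'] h //.
- by move=> d1 d2; case: (finite_no _ _ _ d1 d2).
- by move=> d1 d2; case: (finite_no _ _ _ d2 d1).
move=> [B [ps [h1 [cB [bps ips] [tsE ts0] [hE Bh1] d1]]]].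
move=> [B' [ps' [h1' [cB' [bps' ips'] [tsE' ts0'] [hE' Bh1'] d1']]]].
have tss : ts = ts'.
  rewrite tsE tsE'; rewrite {}tsE in ts0; rewrite {}tsE' in ts0'.
  have tE : term_total ps + h1 = term_total ps' + h1' by rewrite -hE.
  have [BB'|B'B] := convex_ring_comparable cB cB'.
    exact: (first_block B B' ps ps' h1 h1').
  by apply/esym; apply: (first_block B' B ps' ps h1' h1).
congr (_ :: _) => //; apply: (IHbs bs' h1) => //.
suff -> : h1 = h1' by [].
have total ps0 : term_total ps0 = \sum_(a <- [seq p.1 * p.2 | p <- ps0]) a.
  by rewrite big_map.
by apply: (addrI (term_total ps)); rewrite -hE hE' !total -tsE -tsE' tss.
Qed.

(** Some power of an element of positive value of the group has at least the value
    of the inverse of the monomial that is infinite for [B]. So the element cannot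
    be a unit of [B]. *)
Lemma archimedean_incompressible m (c d : 'I_m -> M) (s : seq 'I_m) :
  (forall j, X (d j)) -> archimedean_values (K `&` @finite_ring M) d ->
  incompressible [seq (c j, d j) | j <- s].
Proof.
move=> Xd arch B cB [_ /mapP[j0 _ ->] /= nBd].
have sK := LE_subfield; have cF := finite_convex_ring M; have gX := monomial_subgroup.
have FB := finite_ring_sub cB.
have d_neq0 j : d j != 0 := pos_subgroup_neq0 gX (Xd j).
pose mon (e : 'I_m -> int) := \prod_(j < m) d j ^ e j.
have Xmon e : X (mon e).
  by apply: (pos_subgroup_prod gX) => j _; exact: (pos_subgroupXz gX).
have Kmon e : K (mon e) by apply: monomial_LE.
have mon0 e : mon e != 0 := pos_subgroup_neq0 gX (Xmon e).
have monB e f : mon (fun i => e i - f i) = mon e / mon f.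
  rewrite /mon -prodf_div; apply: eq_bigr => i _.
  by rewrite expfzDr // -invr_expz.
have mon_delta j : mon (fun i => (i == j)%:Z) = d j.
  rewrite /mon (bigD1 j) //= eqxx expr1z big1 ?mulr1 // => i ij.
  by rewrite (negbTE ij) expr0z.
have key e : infinitesimal (@finite_ring M) (mon e) -> infinitesimal B (mon e).
  move=> ie.
  pose f i : int := 0 - (i == j0)%:Z.
  have fE : mon f = (d j0)^-1.
    by rewrite monB mon_delta /mon big1 ?div1r // => i _; rewrite expr0z.
  have if_ : infinitesimal (@finite_ring M) (mon f).
    by rewrite fE => _; rewrite invrK => /FB.
  have lt1 g : infinitesimal (@finite_ring M) (mon g) -> val_lt (K `&` @finite_ring M) 1 (mon g).
    by move=> ig; rewrite val_ltP ?oner_neq0 ?divr1 //; exact: subfield1.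
  have [n] := arch e f (lt1 e ie) (lt1 f if_); rewrite -/(mon e) -/(mon f).
  rewrite val_leP //; last exact: (subfieldX n sK (Kmon e)).
  rewrite fE invrK => Fn; apply: contrapT => /cringPn[_ eV]; apply: nBd.
  have -> : d j0 = mon e ^+ n * d j0 * (mon e)^-1 ^+ n.
    by rewrite mulrAC -exprMn divff // expr1n mul1r.
  by apply: (convex_ringM cB); [exact: FB|exact: cringX].
split.
  move=> _ /mapP[j _ ->] /= ij.
  have dE : mon (fun i => 0 - (i == j)%:Z) = (d j)^-1.
    by rewrite monB mon_delta /mon big1 ?div1r // => i _; rewrite expr0z.
  by rewrite -dE; apply: key; rewrite dE.
move=> _ _ /mapP[j _ ->] /mapP[j' _ ->] /= ij.
have dE : mon (fun i => (i == j')%:Z - (i == j)%:Z) = d j' / d j.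
  by rewrite monB !mon_delta.
by rewrite -dE; apply: key; rewrite dE.
Qed.

Lemma enum_ord_pairwise m : pairwise (fun j j' : 'I_m => (j < j')%N) (enum 'I_m).
Proof.
have := iota_ltn_sorted 0 m; rewrite sorted_pairwise; last exact: ltn_trans.
by rewrite -val_enum_ord pairwise_map.
Qed.

(** By induction on the number [q] of blocks at the end of the list. *)
Lemma block_decomposition_of h k (w : 'I_k.+1 -> set M) (m : 'I_k.+1 -> nat)
    (c d : forall i, 'I_(m i) -> M) (r : R) (hp : M) :
  is_decomposition F S iota x X h w c d r hp ->
  block_decomposition h (summand_blocks c d).
Proof.
move=> [w_conv _ w_last Xd kc [Khp ihp] hE v_lt _ w_lt w_neg arch rest].
have sK := LE_subfield; have cF := finite_convex_ring M.
rewrite natural_ringE // in w_last ihp v_lt arch.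
pose t i j := c i j * d i j.
pose blk i := [seq t i j | j <- enum 'I_(m i)].
pose h_ n := \sum_(i <- drop n (enum 'I_k.+1)) \sum_(j < m i) t i j + iota r + hp.
have -> : h = h_ 0%N by rewrite /h_ drop0 hE big_enum.
rewrite /summand_blocks -[enum 'I_k.+1]drop0 -/blk.
have size_enum : size (enum 'I_k.+1) = k.+1 by exact: size_enum_ord.
have drop_enum (i : 'I_k.+1) : drop i (enum 'I_k.+1) = i :: drop i.+1 (enum 'I_k.+1).
  by rewrite (drop_nth ord0) ?size_enum // nth_ord_enum.
have drop_sum n (f : 'I_k.+1 -> M) : (n <= k.+1)%N ->
    \sum_(i <- drop n (enum 'I_k.+1)) f i = \sum_(i < k.+1 | (n <= i)%N) f i.
  move=> nk; rewrite -(subKn nk); elim: (k.+1 - n)%N (leq_subr n k.+1) => [_|q IHq qk].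
    rewrite subn0 drop_oversize ?size_enum // big_nil big_pred0 // => i.
    by apply/negbTE; rewrite -ltnNge.
  have ik : (k.+1 - q.+1 < k.+1)%N by rewrite ltn_subrL.
  have ikS : (k.+1 - q.+1).+1 = (k.+1 - q)%N by rewrite subnSK.
  rewrite (drop_enum (Ordinal ik)) big_cons ikS IHq ?(ltnW qk) //.
  rewrite [RHS](bigD1 (Ordinal ik)) //=; congr (_ + _); apply: eq_bigl => i.
  by rewrite -ikS ltn_neqAle andbC -val_eqE eq_sym.
have ir : infinitesimal (@finite_ring M) hp.
  by have := ihp; rewrite val_ltP ?oner_neq0 ?divr1 //; exact: subfield1.
suff main q : (q <= k.+1)%N -> block_decomposition (h_ (k.+1 - q)%N)
    [seq b <- [seq blk i | i <- drop (k.+1 - q) (enum 'I_k.+1)] | b != [::]].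
  by have := main k.+1 (leqnn _); rewrite subnn.
elim: q => [_|q IHq qk].
  rewrite subn0 /h_ drop_oversize ?size_enum // big_nil add0r /=.
  by exists r, hp.
have ik : (k.+1 - q.+1 < k.+1)%N by rewrite ltn_subrL.
have ikS : (k.+1 - q.+1).+1 = (k.+1 - q)%N by rewrite subnSK.
pose i := Ordinal ik; have {}IHq := IHq (ltnW qk).
have hE' : h_ (k.+1 - q.+1)%N = \sum_(j < m i) t i j + h_ (k.+1 - q)%N.
  by rewrite /h_ (drop_enum i) big_cons ikS -!addrA.
rewrite (drop_enum i) /= ikS; case: eqP => [blk0|/eqP blk_n0] /=.
  rewrite hE' big1 ?add0r // => j _; exfalso.
  by have := mem_enum 'I_(m i) j; rewrite (size0nil _ : enum 'I_(m i) = [::]) //; rewrite -(size_map (t i)) -/(blk i) blk0.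
have [B cB wE] := convex_valuation_trace sK (w_conv i).
have FB := finite_ring_sub cB.
have kB : residue_field F S iota X (w i) `<=` B by rewrite wE; exact: residue_field_ring.
have KT j : K (t i j).
  apply: (subfieldM sK); last exact: monomial_LE.
  by apply: (@residue_field_LE B); rewrite -wE.
have T0 j : t i j != 0.
  by have [vr _] := w_conv i; exact: (val_lt_neq0 vr (w_neg i j)).
have K1 := subfield1 sK.
exists B, [seq (c i j, d i j) | j <- enum 'I_(m i)], (h_ (k.+1 - q)%N); split=> //.
- split; last exact: archimedean_incompressible.
  have : pairwise (fun j j' : 'I_(m i) => (j < j')%N) (enum 'I_(m i)) := enum_ord_pairwise _.
  elim: (enum 'I_(m i)) => // j s IHs /= /andP[/allP js /IHs bs]; split=> //.
  + by rewrite -wE.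
  + split; first exact: T0.
    by have := w_neg i j; rewrite wE val_ltP ?div1r //; [exact: KT|exact: T0].
  + move=> _ /mapP[j' /js jj' ->] /=.
    have := w_lt i j j' jj'; rewrite wE val_ltP //; [exact: KT|exact: KT|exact: T0].
- by rewrite -map_comp.
- split.
    by rewrite hE' /term_total big_map big_enum.
  rewrite /h_ -addrA; apply: (cringD cB); last first.
    apply: FB; apply: (cringD cF); last exact: infinitesimal_cring.
    exact: finite_iota (embeds_lt iota_embeds) _.
  rewrite -ikS drop_sum //; have [ilt|ige] := ltnP i k; first by apply: kB; exact: rest.
  rewrite big_pred0; first exact: cring0.
  move=> i'; apply/negbTE; rewrite -leqNgt; apply: leq_trans ige.
  by rewrite -ltnS.
Qed.

Lemma decomposition_unique h k (w : 'I_k.+1 -> set M) (m : 'I_k.+1 -> nat)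
    (c d : forall i, 'I_(m i) -> M) (r : R) (hp : M)
    k' (w' : 'I_k'.+1 -> set M) (m' : 'I_k'.+1 -> nat)
    (c' d' : forall i, 'I_(m' i) -> M) (r' : R) (hp' : M) :
  is_decomposition F S iota x X h w c d r hp ->
  is_decomposition F S iota x X h w' c' d' r' hp' ->
  [/\ summand_blocks c d = summand_blocks c' d', r = r' & hp = hp'].
Proof.
move=> dec dec'.
have cF := finite_convex_ring M; have sK := LE_subfield.
have bE := block_decomposition_unique (block_decomposition_of dec) (block_decomposition_of dec').
have total k0 (m0 : 'I_k0.+1 -> nat) (c0 d0 : forall i, 'I_(m0 i) -> M) :
    \sum_(b <- summand_blocks c0 d0) \sum_(a <- b) a =
    \sum_(i < k0.+1) \sum_(j < m0 i) c0 i j * d0 i j.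
  rewrite /summand_blocks big_filter big_mkcond big_map big_enum /=.
  apply: eq_bigr => i _; rewrite -[RHS]big_enum /=.
  rewrite -(big_map (fun j => c0 i j * d0 i j) xpredT id) /=.
  by case: eqP => [->|//]; rewrite big_nil.
have inf k0 w0 (m0 : 'I_k0.+1 -> nat) (c0 d0 : forall i, 'I_(m0 i) -> M) r0 hp0 :
    @is_decomposition R F M S iota x X h k0 w0 m0 c0 d0 r0 hp0 ->
    infinitesimal (@finite_ring M) hp0.
  move=> /decomp_hp[Khp]; rewrite natural_ringE // val_ltP ?oner_neq0 ?divr1 //.
  exact: subfield1.
have e : iota r + hp = iota r' + hp'.
  apply: (addrI (\sum_(i < k.+1) \sum_(j < m i) c i j * d i j)).
  rewrite addrA -(decomp_sum dec) -total bE total addrA.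
  exact: decomp_sum dec'.
have rr' : r = r'.
  apply/eqP; rewrite -subr_eq0; apply/eqP.
  apply: (infinitesimal_iota (embeds_lt iota_embeds)); rewrite rmorphB.
  have -> : iota r - iota r' = hp' - hp.
    by apply/eqP; rewrite subr_eq addrAC eq_sym subr_eq addrC -e addrC.
  by apply: (infinitesimalB cF); [exact: inf dec'|exact: inf dec].
by split=> //; move: e; rewrite rr' => /addrI.
Qed.

Lemma decomposition_exists h : K h -> val_lt (natural_ring K) h 1 ->
  exists (k : nat) (w : 'I_k.+1 -> set M) (m : 'I_k.+1 -> nat)
     (c d : forall i, 'I_(m i) -> M) (r : R) (hp : M),
     is_decomposition F S iota x X h w c d r hp.
Proof.
move=> Kh h_inf; have sK := LE_subfield; have cF := finite_convex_ring M.
have [Ds cDs Dh] := LE_chain Kh.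
apply: (chain_decomposition cDs) => //.
case: Ds cDs Dh => // cDs Dh; exfalso.
have Fh : finite_ring h := field_of_bounded (pos_subgroup_one M) (@chain_group_monomial [::] I) Dh.
have [cv _] := convex_ring_trace sK cF.
have h0 : h != 0.
  by apply: (val_lt_neq0 cv (a := h) (b := 1)); rewrite -natural_ringE.
move: h_inf; rewrite natural_ringE // val_ltP //; last exact: subfield1.
by rewrite div1r => /(_ _); rewrite invr_eq0 invrK => /(_ h0).
Qed.
End Context.

Theorem theorem4p1 (R : realType) (F : forall n : nat, set (power_series R n))
    (F_admissible : admissible_family F)
    (M : realFieldType) (S : an_exp_structure R M)
    (M_model : model_of_Tanexp S)
    (M_nonarchimedean : ~ Num.archimedean_axiom M)
    (iota : {rmorphism R -> M}) (iota_embeds : embeds_reals F S iota)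
    (x : M) (x_gt0 : 0 < x) (x_infinite : val_lt (natural_ring [set: M]) x 1)
    (X : set M) (X_monomials : is_monomial_group F S iota x X)
    (h : M) (h_LE : LE F S iota x h)
    (h_infinite : val_lt (natural_ring (LE F S iota x)) h 1) :
  (exists (k : nat) (w : 'I_k.+1 -> set M) (m : 'I_k.+1 -> nat)
     (c d : forall i, 'I_(m i) -> M) (r : R) (hp : M),
     is_decomposition F S iota x X h w c d r hp) /\
  (forall (k : nat) (w : 'I_k.+1 -> set M) (m : 'I_k.+1 -> nat)
     (c d : forall i, 'I_(m i) -> M) (r : R) (hp : M)
     (k' : nat) (w' : 'I_k'.+1 -> set M) (m' : 'I_k'.+1 -> nat)
     (c' d' : forall i, 'I_(m' i) -> M) (r' : R) (hp' : M),
     is_decomposition F S iota x X h w c d r hp ->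
     is_decomposition F S iota x X h w' c' d' r' hp' ->
     [/\ summand_blocks c d = summand_blocks c' d', r = r' & hp = hp']).
Proof.
split; first exact: (decomposition_exists F_admissible M_model iota_embeds X_monomials).
exact: (decomposition_unique M_model iota_embeds X_monomials).
Qed.
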